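(* Let $K$ be an algebraically closed field and let $K\Delta$ be the (connected) incidence algebra of a finite poset $\Delta$. If $K\Delta$ is a PHI algebra of type $\mathbb{A}_n$, then $K\Delta \cong KQ$ for some quiver $Q$ whose underlying graph $\overline{Q}$ is $\mathbb{A}_n$.
   Context: For a finite poset $\Delta$, let $Q$ be its Hasse quiver: vertices are the elements of $\Delta$ and there is one arrow $a\to b$ whenever $a\prec b$ and there is no $c$ with $a\prec c\prec b$. The incidence algebra is $K\Delta=KQ/I$ where $I$ is the ideal generated by all differences $\gamma-\gamma'$ of parallel paths of $Q$. Incidence algebras are assumed connected (the Hasse quiver is connected). $K\Delta$ is a PHI algebra (piecewise hereditary incidence algebra) of type $\mathbb{A}_n$ if $D^b(\operatorname{mod} K\Delta)$ is triangle-equivalent to $D^b(\operatorname{mod} KQ')$ for some quiver $Q'$ whose underlying graph is the Dynkin graph $\mathbb{A}_n$. $\overline{Q}$ denotes the underlying graph of $Q$. *)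

(* Defs.v *)
From HB Require Import structures.
From mathcomp Require Import all_boot all_order all_algebra.
From mathcomp Require Import generic_quotient ring_quotient finmap.
From mathcomp.multinomials Require Import monalg.
From mathcomp.classical Require Import boolp.

Set Implicit Arguments.
Unset Strict Implicit.
Unset Printing Implicit Defensive.

Import GRing.Theory.
Local Open Scope ring_scope.

(* An algebra is given by its structural morphism with central image; [algType]
   is not used because it excludes the zero algebra, which is the path algebra
   of the empty quiver. *)
Record kalgebra (K : pzRingType) := KAlgebra {
  kring :> pzRingType;
  kscalar : {rmorphism K -> kring};
  kscalar_central : forall k (x : kring), kscalar k * x = x * kscalar k
}.

Definition alg_isomorphic (K : pzRingType) (A B : kalgebra K) : Prop :=
  exists f : {rmorphism A -> B},
    bijective f /\ forall k, f (kscalar A k) = kscalar B k.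

Record quiver := Quiver {
  vertex : finType;
  arrow : finType;
  src : arrow -> vertex;
  tgt : arrow -> vertex
}.

Definition edges (Q : quiver) (x y : vertex Q) : {set arrow Q} :=
  [set a | (src a == x) && (tgt a == y) || (src a == y) && (tgt a == x)].

Definition connected_quiver (Q : quiver) : Prop :=
  (0 < #|vertex Q|)%N /\
  forall x y : vertex Q, connect [rel u v | edges u v != set0] x y.

(* The underlying graph is a multigraph with [edges x y] as the edges between
   x and y.  Here it is the path 0 - 1 - ... - n-1; in particular there are no
   loops and no multiple edges. *)
Definition underlying_graph_A (n : nat) (Q : quiver) : Prop :=
  exists2 f : vertex Q -> 'I_n, bijective f &
    forall x y : vertex Q,
      #|edges x y| = ((f x).+1 == f y) || ((f y).+1 == f x) :> nat.

Section Paths.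
Variable Q : quiver.

Fixpoint walk (x : vertex Q) (s : seq (arrow Q)) : bool :=
  if s is a :: s' then (src a == x) && walk (tgt a) s' else true.

Definition walk_end (x : vertex Q) (s : seq (arrow Q)) : vertex Q :=
  last x (map (@tgt Q) s).

(* A starting vertex followed by composable arrows; the empty sequence of
   arrows gives the trivial path at the vertex. *)
Record qpath := QPath {
  psrc : vertex Q;
  parrows : seq (arrow Q);
  pwalk : walk psrc parrows
}.

Definition ptgt (p : qpath) : vertex Q := walk_end (psrc p) (parrows p).

Definition trivial_path (x : vertex Q) : qpath := @QPath x [::] isT.

Lemma qpath_eq (p q : qpath) :
  psrc p = psrc q -> parrows p = parrows q -> p = q.
Proof.
case: p q => [x s w] [y t w'] /= e1 e2; subst y t.
by rewrite (bool_irrelevance w w').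
Qed.

HB.instance Definition _ := gen_eqMixin qpath.
HB.instance Definition _ := gen_choiceMixin qpath.

Lemma walk_cat x s t : walk x (s ++ t) = walk x s && walk (walk_end x s) t.
Proof.
elim: s x => [|a s IHs] x //=.
by rewrite IHs andbA.
Qed.

Lemma walk_end_cat x s t : walk_end x (s ++ t) = walk_end (walk_end x s) t.
Proof. by rewrite /walk_end map_cat last_cat. Qed.

Lemma walk_comp (p q : qpath) :
  ptgt q = psrc p -> walk (psrc q) (parrows q ++ parrows p).
Proof.
by move=> e; rewrite walk_cat pwalk -[walk_end _ _]/(ptgt q) e; exact: pwalk.
Qed.

(* p after q *)
Definition pcomp (p q : qpath) : option qpath :=
  if ptgt q =P psrc p is ReflectT e then Some (QPath (walk_comp e)) else None.

Lemma pcompP p q : ptgt q = psrc p ->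
  exists r, [/\ pcomp p q = Some r, psrc r = psrc q, ptgt r = ptgt p
             & parrows r = parrows q ++ parrows p].
Proof.
rewrite /pcomp; case: eqP => // e _; exists (QPath (walk_comp e)); split=> //.
by rewrite {1}/ptgt /= walk_end_cat -[walk_end _ (parrows q)]/(ptgt q) e.
Qed.

Lemma pcompN p q : ptgt q != psrc p -> pcomp p q = None.
Proof. by rewrite /pcomp; case: eqP. Qed.

Lemma pcompA p q r :
  obind (pcomp p) (pcomp q r) = obind (pcomp^~ r) (pcomp p q).
Proof.
case: (eqVneq (ptgt r) (psrc q)) => [e1|n1]; last first.
  rewrite (pcompN n1) /=.
  case: (eqVneq (ptgt q) (psrc p)) => [e2|n2]; last by rewrite (pcompN n2).
  by have [x [-> sx tx ax]] := pcompP e2; rewrite /= pcompN // sx.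
have [x [-> sx tx ax]] := pcompP e1.
case: (eqVneq (ptgt q) (psrc p)) => [e2|n2]; last first.
  by rewrite (pcompN n2) /= pcompN // tx.
have [y [-> sy ty ay]] := pcompP e2.
have e3 : ptgt x = psrc p by rewrite tx.
have e4 : ptgt r = psrc y by rewrite sy.
have [z [ez sz tz az]] := pcompP e3.
have [w [ew sw tw aw]] := pcompP e4.
rewrite /= ez ew; congr Some; apply: qpath_eq; first by rewrite sz sw.
by rewrite az aw ax ay catA.
Qed.

Lemma pcomp_idl p v : pcomp (trivial_path v) p =
  if ptgt p == v then Some p else None.
Proof.
case: eqVneq => [e|ne]; last by rewrite pcompN.
have [x [-> sx tx ax]] := @pcompP (trivial_path v) p e.
by congr Some; apply: qpath_eq => //; rewrite ax cats0.
Qed.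

Lemma pcomp_idr p v : pcomp p (trivial_path v) =
  if v == psrc p then Some p else None.
Proof.
case: eqVneq => [e|ne]; last by rewrite pcompN.
have [x [-> sx tx ax]] := @pcompP p (trivial_path v) e.
by congr Some; apply: qpath_eq => //; rewrite sx.
Qed.

End Paths.

Lemma bilinear_assoc (K : fieldType) (W : lmodType K) (P : Type)
    (c : P -> P -> option P) (e : P -> W) (m : W -> W -> W) :
  (forall T : W -> Prop, T 0 ->
     (forall k f g, T f -> T g -> T (k *: f + g)) ->
     (forall p, T (e p)) -> forall f, T f) ->
  (forall p q r, obind (c p) (c q r) = obind (c^~ r) (c p q)) ->
  (forall x, m 0 x = 0) -> (forall x, m x 0 = 0) ->
  (forall k x y z, m (k *: x + y) z = k *: m x z + m y z) ->
  (forall k x y z, m z (k *: x + y) = k *: m z x + m z y) ->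
  (forall p q, m (e p) (e q) = oapp e 0 (c p q)) ->
  associative m.
Proof.
move=> ind cA m0r mr0 mDl mDr mb f g h.
elim/ind: f => [|k f f' IHf IHf'|p].
- by rewrite !m0r.
- by rewrite !mDl IHf IHf'.
elim/ind: g => [|k g g' IHg IHg'|q].
- by rewrite m0r mr0 m0r.
- by rewrite mDl !mDr mDl IHg IHg'.
elim/ind: h => [|k h h' IHh IHh'|r].
- by rewrite !mr0.
- by rewrite !mDr IHh IHh'.
rewrite !mb; have := cA p q r.
by case: (c q r) => [x|]; case: (c p q) => [y|] /= E;
  rewrite ?m0r ?mr0 ?mb ?E // -E.
Qed.

Section PathAlgebra.
Variables (K : fieldType) (Q : quiver).

Definition path_algebra : Type := {malg K[qpath Q]}.

HB.instance Definition _ := GRing.Lmodule.on path_algebra.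

Definition basis_elt (p : qpath Q) : path_algebra := << 1 *g p >>.

Definition lin_ext (V : lmodType K) (h : qpath Q -> V) (g : path_algebra) : V :=
  \sum_(p <- msupp g) mcoeff p g *: h p.

Lemma lin_extEw (V : lmodType K) (h : qpath Q -> V) g (S : {fset qpath Q}) :
  (msupp g `<=` S)%fset -> lin_ext h g = \sum_(p <- S) mcoeff p g *: h p.
Proof.
move=> sgS; rewrite /lin_ext; apply: big_fset_incl => // p _.
by move=> /mcoeff_outdom ->; rewrite scale0r.
Qed.

Lemma lin_ext_is_linear (V : lmodType K) (h : qpath Q -> V) :
  linear (lin_ext h).
Proof.
move=> k f g.
pose S := (msupp f `|` (msupp g `|` msupp (k *: f + g)))%fset.
rewrite (@lin_extEw _ h f S) ?(@lin_extEw _ h g S)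
        ?(@lin_extEw _ h (k *: f + g) S).
- rewrite scaler_sumr -big_split /=; apply: eq_bigr => p _.
  by rewrite mcoeffD mcoeffZ scalerDl scalerA.
- by rewrite /S fsetUA fsubsetUr.
- by rewrite /S fsetUCA fsubsetUl.
- by rewrite /S fsubsetUl.
Qed.

HB.instance Definition _ (V : lmodType K) (h : qpath Q -> V) :=
  GRing.isLinear.Build K path_algebra V *:%R (lin_ext h)
    (lin_ext_is_linear h).

Lemma lin_ext_basis (V : lmodType K) (h : qpath Q -> V) p :
  lin_ext h (basis_elt p) = h p.
Proof.
rewrite (@lin_extEw _ h _ [fset p]%fset); last exact: msuppU_le.
by rewrite big_seq_fset1 mcoeffUU scale1r.
Qed.

Lemma scale_basis k p : k *: basis_elt p = << k *g p >> :> {malg K[qpath Q]}.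
Proof.
apply/malgP => q; rewrite [LHS]mcoeffZ /basis_elt [in LHS]mcoeffU [RHS]mcoeffU.
by case: (p == q); rewrite /= ?mulr1n ?mulr0n ?mulr1 ?mulr0.
Qed.

Lemma path_algebraE (g : path_algebra) :
  g = \sum_(p <- msupp g) mcoeff p g *: basis_elt p.
Proof.
rewrite [LHS]monalgE; apply: eq_bigr => p _; exact/esym/scale_basis.
Qed.

Lemma lin_extDh (V : lmodType K) k (h1 h2 h : qpath Q -> V) g :
  (forall p, h p = k *: h1 p + h2 p) ->
  lin_ext h g = k *: lin_ext h1 g + lin_ext h2 g.
Proof.
move=> e; rewrite /lin_ext scaler_sumr -big_split; apply: eq_bigr => p _ /=.
by rewrite e scalerDr !scalerA mulrC.
Qed.

Lemma lin_ext0h (V : lmodType K) (h : qpath Q -> V) g :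
  (forall p, h p = 0) -> lin_ext h g = 0.
Proof. by move=> e; apply: big1 => p _; rewrite e scaler0. Qed.

Lemma path_algebra_ind (P : path_algebra -> Prop) :
  P 0 -> (forall k f g, P f -> P g -> P (k *: f + g)) ->
  (forall p, P (basis_elt p)) -> forall f, P f.
Proof.
move=> P0 PD Pb f; rewrite [f]path_algebraE.
by elim/big_rec: _ => // p g _ Pg; apply: PD.
Qed.

(* Products are read as composites of maps, p * q = p after q, so that left
   modules are covariant representations of the quiver. *)
Definition basis_mul (p q : qpath Q) : path_algebra :=
  oapp basis_elt 0 (pcomp p q).

Definition path_mul (f g : path_algebra) : path_algebra :=
  lin_ext (fun p => lin_ext (basis_mul p) g) f.

Definition path_one : path_algebra := \sum_(x : vertex Q)
  basis_elt (trivial_path x).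

Lemma path_mulDl g k f1 f2 :
  path_mul (k *: f1 + f2) g = k *: path_mul f1 g + path_mul f2 g.
Proof. by rewrite /path_mul linearP. Qed.

Lemma path_mulDr f k g1 g2 :
  path_mul f (k *: g1 + g2) = k *: path_mul f g1 + path_mul f g2.
Proof.
by apply: lin_extDh => p; rewrite linearP.
Qed.

Lemma path_mul0r f : path_mul 0 f = 0.
Proof. by rewrite /path_mul linear0. Qed.

Lemma path_mulr0 f : path_mul f 0 = 0.
Proof.
by apply: lin_ext0h => p; rewrite linear0.
Qed.

Lemma path_mul_basis p q :
  path_mul (basis_elt p) (basis_elt q) = basis_mul p q.
Proof. by rewrite /path_mul !lin_ext_basis. Qed.

Lemma path_mulA : associative path_mul.
Proof.
move=> f g h.
apply: (@bilinear_assoc K path_algebra _ (@pcomp Q) basis_elt path_mul).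
- exact: path_algebra_ind.
- exact: pcompA.
- exact: path_mul0r.
- exact: path_mulr0.
- by move=> k x y z; apply: path_mulDl.
- by move=> k x y z; apply: path_mulDr.
- exact: path_mul_basis.
Qed.

Lemma path_mulDl1 : left_distributive path_mul +%R.
Proof. by move=> f g h; have := path_mulDl h 1 f g; rewrite !scale1r. Qed.

Lemma path_mulDr1 : right_distributive path_mul +%R.
Proof. by move=> f g h; have := path_mulDr f 1 g h; rewrite !scale1r. Qed.

Lemma path_mul1r : left_id path_one path_mul.
Proof.
elim/path_algebra_ind => [|k f g IHf IHg|p].
- by rewrite path_mulr0.
- by rewrite path_mulDr IHf IHg.
rewrite /path_one (big_morph (path_mul^~ (basis_elt p))
  (fun f g => path_mulDl1 f g (basis_elt p)) (path_mul0r _)).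
transitivity (\sum_(x : vertex Q) if x == ptgt p then basis_elt p else 0).
  apply: eq_bigr => x _; rewrite path_mul_basis /basis_mul pcomp_idl eq_sym.
  by case: eqP.
by rewrite -big_mkcond big_pred1_eq.
Qed.

Lemma path_mulr1 : right_id path_one path_mul.
Proof.
elim/path_algebra_ind => [|k f g IHf IHg|p].
- by rewrite path_mul0r.
- by rewrite path_mulDl IHf IHg.
rewrite /path_one (big_morph (path_mul (basis_elt p))
  (path_mulDr1 (basis_elt p)) (path_mulr0 _)).
transitivity (\sum_(x : vertex Q) if x == psrc p then basis_elt p else 0).
  apply: eq_bigr => x _; rewrite path_mul_basis /basis_mul pcomp_idr.
  by case: eqP.
by rewrite -big_mkcond big_pred1_eq.
Qed.

HB.instance Definition _ := GRing.Zmodule_isPzRing.Build path_algebra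
  path_mulA path_mul1r path_mulr1 path_mulDl1 path_mulDr1.

Lemma path_scaleAl (k : K) (x y : path_algebra) : k *: (x * y) = (k *: x) * y.
Proof.
exact/esym/(linearZZ (lin_ext (fun p => lin_ext (basis_mul p) y))).
Qed.

Lemma path_scaleAr (k : K) (x y : path_algebra) : k *: (x * y) = x * (k *: y).
Proof.
have E : path_mul x (k *: y) = k *: path_mul x y + path_mul x 0.
  by rewrite -path_mulDr addr0.
exact/esym/(etrans E)/(etrans (congr1 _ (path_mulr0 x)))/addr0.
Qed.

Definition path_scalar (k : K) : path_algebra := k *: (1 : path_algebra).

Lemma path_scalar_zmod : zmod_morphism path_scalar.
Proof. by move=> k l; rewrite /path_scalar scalerBl. Qed.

Lemma path_scalar_monoid : monoid_morphism path_scalar.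
Proof.
split=> [|k l]; first by rewrite /path_scalar scale1r.
by rewrite /path_scalar -path_scaleAl mul1r scalerA.
Qed.

HB.instance Definition _ := GRing.isZmodMorphism.Build K path_algebra
  path_scalar path_scalar_zmod.
HB.instance Definition _ := GRing.isMonoidMorphism.Build K path_algebra
  path_scalar path_scalar_monoid.

Lemma path_scalar_central k (x : path_algebra) :
  path_scalar k * x = x * path_scalar k.
Proof.
by rewrite /path_scalar -path_scaleAl -path_scaleAr mul1r mulr1.
Qed.

Definition path_kalgebra : kalgebra K := KAlgebra path_scalar_central.

End PathAlgebra.

Section QuotientAlgebra.
Variables (K : pzRingType) (A : kalgebra K) (S : A -> Prop).

Inductive ideal_gen : A -> Prop :=
| ideal_in x : S x -> ideal_gen x
| ideal_0 : ideal_gen 0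
| ideal_add x y : ideal_gen x -> ideal_gen y -> ideal_gen (x + y)
| ideal_mull a x : ideal_gen x -> ideal_gen (a * x)
| ideal_mulr a x : ideal_gen x -> ideal_gen (x * a).

Definition ideal_pred : {pred A} := fun x => `[< ideal_gen x >].

Lemma ideal_predP x : reflect (ideal_gen x) (x \in ideal_pred).
Proof. exact: asboolP. Qed.

Lemma ideal_zmod_closed : zmod_closed ideal_pred.
Proof.
split=> [|x y /ideal_predP Ix /ideal_predP Iy]; apply/ideal_predP.
  exact: ideal_0.
by apply: ideal_add => //; rewrite -mulN1r; apply: ideal_mull.
Qed.

HB.instance Definition _ := GRing.isZmodClosed.Build A ideal_pred
  ideal_zmod_closed.

Definition quot_algebra : Type := Quotient.quot ideal_pred.

HB.instance Definition _ := GRing.Zmodule.on quot_algebra.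
HB.instance Definition _ := EqQuotient.on quot_algebra.

Local Notation quot := quot_algebra.
Local Notation pi := (\pi_quot_algebra)%qT.

Lemma quot_eqP x y : reflect (pi x = pi y) (x - y \in ideal_pred).
Proof.
have -> : (x - y \in ideal_pred) = (pi x == pi y).
  exact: (Quotient.idealrBE ideal_pred x y).
exact: eqP.
Qed.

Lemma quot_repr x : ideal_gen (repr (pi x) - x).
Proof. by apply/ideal_predP/quot_eqP; rewrite reprK. Qed.

Lemma quot_piD x y : pi (x + y) = pi x + pi y.
Proof. exact: (Quotient.pi_add ideal_pred). Qed.

Definition quot_one : quot := pi 1.
Definition quot_mul (x y : quot) : quot := pi (repr x * repr y).

Lemma quot_piM x y : quot_mul (pi x) (pi y) = pi (x * y).
Proof.
apply/quot_eqP/ideal_predP.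
have -> : repr (pi x) * repr (pi y) - x * y =
  repr (pi x) * (repr (pi y) - y) + (repr (pi x) - x) * y.
  by rewrite mulrBr mulrBl addrA addrNK.
apply: ideal_add; [apply: ideal_mull | apply: ideal_mulr]; exact: quot_repr.
Qed.

Lemma quot_ind (P : quot -> Prop) : (forall x, P (pi x)) -> forall x, P x.
Proof. by move=> H x; rewrite -[x]reprK. Qed.

Lemma quot_mulA : associative quot_mul.
Proof.
elim/quot_ind=> x; elim/quot_ind=> y; elim/quot_ind=> z.
by rewrite !quot_piM mulrA.
Qed.

Lemma quot_mul1 : left_id quot_one quot_mul.
Proof. by elim/quot_ind=> x; rewrite quot_piM mul1r. Qed.

Lemma quot_mulr1 : right_id quot_one quot_mul.
Proof. by elim/quot_ind=> x; rewrite quot_piM mulr1. Qed.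

Lemma quot_mulDl : left_distributive quot_mul +%R.
Proof.
elim/quot_ind=> x; elim/quot_ind=> y; elim/quot_ind=> z.
by rewrite -quot_piD !quot_piM mulrDl quot_piD.
Qed.

Lemma quot_mulDr : right_distributive quot_mul +%R.
Proof.
elim/quot_ind=> x; elim/quot_ind=> y; elim/quot_ind=> z.
by rewrite -quot_piD !quot_piM mulrDr quot_piD.
Qed.

HB.instance Definition _ := GRing.Zmodule_isPzRing.Build quot_algebra
  quot_mulA quot_mul1 quot_mulr1 quot_mulDl quot_mulDr.

Definition quot_scalar (k : K) : quot := pi (kscalar A k).

Lemma quot_piN x : pi (- x) = - pi x.
Proof. exact: (Quotient.pi_opp ideal_pred). Qed.

Lemma quot_scalar_zmod : zmod_morphism quot_scalar.
Proof. by move=> k l; rewrite /quot_scalar rmorphB quot_piD quot_piN. Qed.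

Lemma quot_scalar_monoid : monoid_morphism quot_scalar.
Proof.
split=> [|k l]; first by rewrite /quot_scalar rmorph1.
by rewrite -[RHS]/(quot_mul _ _) quot_piM -rmorphM.
Qed.

HB.instance Definition _ := GRing.isZmodMorphism.Build K quot_algebra
  quot_scalar quot_scalar_zmod.
HB.instance Definition _ := GRing.isMonoidMorphism.Build K quot_algebra
  quot_scalar quot_scalar_monoid.

Lemma quot_scalar_central k (x : quot_algebra) :
  quot_scalar k * x = x * quot_scalar k.
Proof.
elim/quot_ind: x => x; rewrite -[LHS]/(quot_mul _ _) -[RHS]/(quot_mul _ _).
by rewrite !quot_piM kscalar_central.
Qed.

Definition quot_kalgebra : kalgebra K := KAlgebra quot_scalar_central.

End QuotientAlgebra.

Section Incidence.
Variables (d : Order.disp_t) (D : finPOrderType d).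

Definition hasse_cover (p : D * D) : bool :=
  (p.1 < p.2)%O && ~~ [exists c, (p.1 < c)%O && (c < p.2)%O].

Definition hasse_quiver : quiver :=
  @Quiver D {p : D * D | hasse_cover p} (fun a => (val a).1)
    (fun a => (val a).2).

Variable K : fieldType.

Definition parallel_difference (x : path_kalgebra K hasse_quiver) : Prop :=
  exists p q : qpath hasse_quiver,
    [/\ psrc p = psrc q, ptgt p = ptgt q
      & x = basis_elt K p - basis_elt K q].

Definition incidence_algebra : kalgebra K := quot_kalgebra parallel_difference.

End Incidence.

(* Morphisms are compared by a given equivalence relation [heq]. *)
Record category := Category {
  ob :> Type;
  hom : ob -> ob -> Type;
  heq : forall X Y, hom X Y -> hom X Y -> Prop;
  idm : forall X, hom X X;
  comp : forall X Y Z, hom Y Z -> hom X Y -> hom X Z;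
  heq_refl : forall X Y (f : hom X Y), heq f f;
  heq_sym : forall X Y (f g : hom X Y), heq f g -> heq g f;
  heq_trans : forall X Y (f g h : hom X Y), heq f g -> heq g h -> heq f h;
  comp_heq : forall X Y Z (f f' : hom Y Z) (g g' : hom X Y),
    heq f f' -> heq g g' -> heq (comp f g) (comp f' g');
  comp_assoc : forall X Y Z W (f : hom Z W) (g : hom Y Z) (h : hom X Y),
    heq (comp f (comp g h)) (comp (comp f g) h);
  comp_idl : forall X Y (f : hom X Y), heq (comp (idm Y) f) f;
  comp_idr : forall X Y (f : hom X Y), heq (comp f (idm X)) f
}.

Declare Scope category_scope.
Delimit Scope category_scope with cat.
Notation "f == g" := (heq f g) : category_scope.
Notation "f \o g" := (comp f g) : category_scope.

Definition is_iso (C : category) (X Y : C) (f : hom X Y) : Prop :=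
  exists g : hom Y X, (g \o f == idm X /\ f \o g == idm Y)%cat.

Section Functors.
Local Open Scope category_scope.

Record functor (C D : category) := Functor {
  fob :> C -> D;
  fhom : forall X Y, hom X Y -> hom (fob X) (fob Y);
  fhom_heq : forall X Y (f g : hom X Y), f == g -> fhom f == fhom g;
  fhom_id : forall X, fhom (idm X) == idm (fob X);
  fhom_comp : forall X Y Z (f : hom Y Z) (g : hom X Y),
    fhom (f \o g) == fhom f \o fhom g
}.

Implicit Types C D E : category.

Definition functor_id C : functor C C.
Proof.
exists (fun X => X) (fun X Y f => f) => //.
- by move=> X; apply: heq_refl.
- by move=> X Y Z f g; apply: heq_refl.
Defined.

Definition functor_comp C D E (G : functor D E) (F : functor C D) :
  functor C E.
Proof.
exists (fun X => G (F X)) (fun X Y f => fhom G (fhom F f)).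
- by move=> X Y f g e; do 2!apply: fhom_heq.
- move=> X; apply: heq_trans (fhom_id G _).
  by apply: fhom_heq; apply: fhom_id.
- move=> X Y Z f g; apply: heq_trans (fhom_comp G _ _).
  by apply: fhom_heq; apply: fhom_comp.
Defined.

Definition is_natural_iso C D (F G : functor C D)
    (a : forall X, hom (F X) (G X)) : Prop :=
  (forall X Y (f : hom X Y), a Y \o fhom F f == fhom G f \o a X) /\
  (forall X, is_iso (a X)).

Definition naturally_isomorphic C D (F G : functor C D) : Prop :=
  exists a, @is_natural_iso C D F G a.

Definition is_equivalence C D (F : functor C D) : Prop :=
  exists G : functor D C,
    naturally_isomorphic (functor_comp G F) (functor_id C) /\
    naturally_isomorphic (functor_comp F G) (functor_id D).

End Functors.

(* The data of a triangulated category to which the notion of a triangle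
   functor refers: the shift and the distinguished triangles
   X -> Y -> Z -> X[1]. *)
Record tri_category := TriCategory {
  tri_cat :> category;
  shift : functor tri_cat tri_cat;
  distinguished : forall X Y Z : tri_cat,
    hom X Y -> hom Y Z -> hom Z (shift X) -> Prop
}.

(* An equivalence preserves finite products, hence is additive when the
   categories are; so additivity need not be required.  Linearity over a base
   field is not part of the notion. *)
Definition triangle_equivalent (C D : tri_category) : Prop :=
  exists F : functor C D, is_equivalence F /\
  exists a : forall X, hom (F (shift C X)) (shift D (F X)),
    @is_natural_iso C D (functor_comp F (shift C)) (functor_comp (shift D) F) a
    /\ forall (X Y Z : C) (u : hom X Y) (v : hom Y Z) (w : hom Z (shift C X)),
         distinguished u v w ->
         distinguished (fhom F u) (fhom F v) (a X \o fhom F w)%cat.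

Section Derived.
Variable A : pzRingType.

Definition fin_gen (M : lmodType A) : Prop :=
  exists (n : nat) (v : 'I_n -> M), forall x : M,
    exists c : 'I_n -> A, x = \sum_i c i *: v i.

Record bcomplex := BComplex {
  term :> int -> lmodType A;
  diff : forall i, {linear term i -> term (i + 1)};
  diffK : forall i (x : term i), diff (i + 1) (diff i x) = 0;
  term_fin_gen : forall i, fin_gen (term i);
  term_bounded : exists N : nat, forall i : int, (N < `|i|)%N ->
    forall x : term i, x = 0
}.

Record chain_map (X Y : bcomplex) := ChainMap {
  cmap :> forall i, {linear X i -> Y i};
  cmap_diff : forall i (x : X i), cmap (i + 1) (diff X i x) = diff Y i (cmap i x)
}.

Definition chain_id (X : bcomplex) : chain_map X X :=
  @ChainMap X X (fun i => idfun) (fun i x => erefl).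

Lemma chain_comp_diff X Y Z (f : chain_map Y Z) (g : chain_map X Y) i
    (x : X i) :
  (f (i + 1) \o g (i + 1))%FUN (diff X i x) = diff Z i ((f i \o g i)%FUN x).
Proof. by rewrite /= !cmap_diff. Qed.

Definition chain_comp X Y Z (f : chain_map Y Z) (g : chain_map X Y) :
  chain_map X Z :=
  @ChainMap X Z (fun i => (f i \o g i)%FUN) (@chain_comp_diff X Y Z f g).

(* f is bijective on cohomology ker/im in each degree; the degree is written
   i + 1, so that no transport along (i - 1) + 1 = i is needed. *)
Definition quasi_iso (X Y : bcomplex) (f : chain_map X Y) : Prop :=
  forall i : int,
    (forall x : X (i + 1), diff X (i + 1) x = 0 ->
       (exists y : Y i, f (i + 1) x = diff Y i y) ->
       exists x' : X i, x = diff X i x') /\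
    (forall y : Y (i + 1), diff Y (i + 1) y = 0 ->
       exists2 x : X (i + 1), diff X (i + 1) x = 0 &
         exists y' : Y i, y - f (i + 1) x = diff Y i y').

Definition shift_diff_fun (X : bcomplex) (i : int) (x : X (i + 1)) :
  X (i + 1 + 1) := - diff X (i + 1) x.

Lemma shift_diff_linear X i : linear (@shift_diff_fun X i).
Proof.
by move=> k x y; rewrite /shift_diff_fun linearP opprD scalerN.
Qed.

HB.instance Definition _ (X : bcomplex) (i : int) := GRing.isLinear.Build A
  (X (i + 1)) (X (i + 1 + 1)) *:%R (@shift_diff_fun X i) (@shift_diff_linear X i).

Lemma shift_diffK X i x :
  @shift_diff_fun X (i + 1) (@shift_diff_fun X i x) = 0.
Proof. by rewrite /shift_diff_fun linearN diffK !oppr0. Qed.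

Lemma shift_bounded (X : bcomplex) : exists N : nat, forall i : int,
  (N < `|i|)%N -> forall x : X (i + 1), x = 0.
Proof.
have [N HN] := term_bounded X; exists N.+1 => i lti; apply: HN.
have := leqD_dist i (i + 1) 0; rewrite !subr0 opprD addrA subrr sub0r.
by rewrite abszN absz1 add1n => /(leq_trans lti).
Qed.

(* X[1] has X^(i+1) in degree i and differential - d. *)
Definition cpx_shift (X : bcomplex) : bcomplex :=
  @BComplex (fun i => X (i + 1)) (fun i => @shift_diff_fun X i)
    (@shift_diffK X) (fun i => term_fin_gen X (i + 1)) (shift_bounded X).

Lemma chain_shift_diff X Y (f : chain_map X Y) i (x : cpx_shift X i) :
  f (i + 1 + 1) (diff (cpx_shift X) i x) = diff (cpx_shift Y) i (f (i + 1) x).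
Proof. by rewrite /= /shift_diff_fun linearN cmap_diff. Qed.

Definition chain_shift X Y (f : chain_map X Y) :
  chain_map (cpx_shift X) (cpx_shift Y) :=
  @ChainMap (cpx_shift X) (cpx_shift Y) (fun i => f (i + 1))
    (@chain_shift_diff X Y f).

Lemma quasi_iso_shift X Y (f : chain_map X Y) :
  quasi_iso f -> quasi_iso (chain_shift f).
Proof.
move=> qf i; have [inj surj] := qf (i + 1); split=> /=.
  move=> x /eqP; rewrite /shift_diff_fun oppr_eq0 => /eqP dx [y fx].
  have [|x' ->] := inj x dx; first by exists (- y); rewrite linearN.
  by exists (- x'); rewrite linearN opprK.
move=> y /eqP; rewrite /shift_diff_fun oppr_eq0 => /eqP dy.
have [x dx [y' e]] := surj y dy; exists x; first by rewrite dx oppr0.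
by exists (- y'); rewrite linearN opprK.
Qed.

Section Cone.
Variables (X Y : bcomplex) (f : chain_map X Y).

Definition cone_term (i : int) : lmodType A := (X (i + 1)%R * Y i)%type.

Definition cone_diff_fun (i : int) (z : cone_term i) : cone_term (i + 1) :=
  (- diff X (i + 1) z.1, f (i + 1) z.1 + diff Y i z.2).

Lemma cone_diff_linear i : linear (@cone_diff_fun i).
Proof.
move=> k [x y] [x' y']; rewrite /cone_diff_fun /=.
rewrite [RHS]surjective_pairing; congr pair => /=.
  by rewrite linearP opprD -scalerN.
by rewrite !linearP scalerDr addrACA.
Qed.

HB.instance Definition _ i := GRing.isLinear.Build A (cone_term i)
  (cone_term (i + 1)) *:%R (@cone_diff_fun i) (@cone_diff_linear i).

Lemma cone_diffK i z : @cone_diff_fun (i + 1) (@cone_diff_fun i z) = 0.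
Proof.
case: z => x y; rewrite /cone_diff_fun /=; congr pair.
  by rewrite linearN diffK !oppr0.
by rewrite linearN linearD diffK addr0 cmap_diff addNr.
Qed.

Lemma cone_fin_gen i : fin_gen (cone_term i).
Proof.
have [m [v Hv]] := term_fin_gen X (i + 1).
have [n [w Hw]] := term_fin_gen Y i.
exists (m + n)%N, (fun k => match split k with
  inl j => (v j, 0) | inr j => (0, w j) end) => -[x y].
have [c ->] := Hv x; have [e ->] := Hw y.
exists (fun k => match split k with inl j => c j | inr j => e j end).
rewrite big_split_ord /=.
have sl j : split (lshift n j) = inl j :> 'I_m + 'I_n := unsplitK (inl j).
have sr j : split (rshift m j) = inr j :> 'I_m + 'I_n := unsplitK (inr j).
under [X in _ = X + _]eq_bigr => j _ do rewrite sl.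
under [X in _ = _ + X]eq_bigr => j _ do rewrite sr.
rewrite [LHS]surjective_pairing [RHS]surjective_pairing /=; congr pair.
  rewrite (raddf_sum fst) (raddf_sum fst) /=.
  by rewrite [X in _ = _ + X]big1 ?addr0 // => j _; rewrite scaler0.
rewrite (raddf_sum snd) (raddf_sum snd) /=.
by rewrite [X in _ = X + _]big1 ?add0r // => j _; rewrite scaler0.
Qed.

Lemma cone_bounded : exists N : nat, forall i : int,
  (N < `|i|)%N -> forall z : cone_term i, z = 0.
Proof.
have [M HM] := shift_bounded X; have [N HN] := term_bounded Y.
exists (maxn M N) => i; rewrite gtn_max => /andP[ltM ltN] [x y].
by rewrite (HM _ ltM x) (HN _ ltN y).
Qed.

Definition cone : bcomplex :=
  @BComplex cone_term (fun i => @cone_diff_fun i) cone_diffK cone_fin_gen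
    cone_bounded.

Definition cone_in_fun (i : int) (y : Y i) : cone_term i := (0, y).

Lemma cone_in_linear i : linear (@cone_in_fun i).
Proof.
by move=> k x y; congr pair; rewrite /= scaler0 addr0.
Qed.

HB.instance Definition _ (i : int) := GRing.isLinear.Build A (Y i)
  (cone_term i) *:%R (@cone_in_fun i) (@cone_in_linear i).

Lemma cone_in_diff i (y : Y i) :
  @cone_in_fun (i + 1) (diff Y i y) = diff cone i (cone_in_fun y).
Proof.
rewrite /= /cone_diff_fun /=; congr pair.
  by rewrite (linear0 (diff X (i + 1))) oppr0.
by rewrite (linear0 (f (i + 1))) add0r.
Qed.

Definition cone_in : chain_map Y cone :=
  @ChainMap Y cone (fun i => @cone_in_fun i) cone_in_diff.

Definition cone_out_fun (i : int) (z : cone_term i) : X (i + 1) := z.1.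

Lemma cone_out_linear i : linear (@cone_out_fun i).
Proof. by []. Qed.

HB.instance Definition _ (i : int) := GRing.isLinear.Build A (cone_term i)
  (X (i + 1)) *:%R (@cone_out_fun i) (@cone_out_linear i).

Lemma cone_out_diff i (z : cone i) :
  @cone_out_fun (i + 1) (diff cone i z)
  = diff (cpx_shift X) i (@cone_out_fun i z).
Proof. by []. Qed.

Definition cone_out : chain_map cone (cpx_shift X) :=
  @ChainMap cone (cpx_shift X) (fun i => @cone_out_fun i) cone_out_diff.

End Cone.

(* Morphisms of the derived category are formal composites of chain maps and
   formal inverses of quasi-isomorphisms, modulo the congruence [deq]
   generated by the equations between chain maps and by s s^-1 = 1 = s^-1 s:
   this is the construction of a category of fractions without a calculus of
   fractions. *)
Inductive dmor : bcomplex -> bcomplex -> Type :=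
| DMap X Y (f : chain_map X Y) : dmor X Y
| DInv X Y (s : chain_map X Y) (qs : quasi_iso s) : dmor Y X
| DComp X Y Z (u : dmor Y Z) (v : dmor X Y) : dmor X Z.

Inductive deq : forall X Y, dmor X Y -> dmor X Y -> Prop :=
| deq_refl X Y (u : dmor X Y) : deq u u
| deq_sym X Y (u v : dmor X Y) : deq u v -> deq v u
| deq_trans X Y (u v w : dmor X Y) : deq u v -> deq v w -> deq u w
| deq_cong X Y Z (u u' : dmor Y Z) (v v' : dmor X Y) :
    deq u u' -> deq v v' -> deq (DComp u v) (DComp u' v')
| deq_assoc X Y Z W (u : dmor Z W) (v : dmor Y Z) (w : dmor X Y) :
    deq (DComp u (DComp v w)) (DComp (DComp u v) w)
| deq_idl X Y (u : dmor X Y) : deq (DComp (DMap (chain_id Y)) u) u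
| deq_idr X Y (u : dmor X Y) : deq (DComp u (DMap (chain_id X))) u
| deq_map X Y (f g : chain_map X Y) :
    (forall i, f i =1 g i) -> deq (DMap f) (DMap g)
| deq_comp X Y Z (f : chain_map Y Z) (g : chain_map X Y) :
    deq (DMap (chain_comp f g)) (DComp (DMap f) (DMap g))
| deq_invl X Y (s : chain_map X Y) (qs : quasi_iso s) :
    deq (DComp (DInv qs) (DMap s)) (DMap (chain_id X))
| deq_invr X Y (s : chain_map X Y) (qs : quasi_iso s) :
    deq (DComp (DMap s) (DInv qs)) (DMap (chain_id Y)).

Definition derived_cat : category :=
  @Category bcomplex dmor deq (fun X => DMap (chain_id X)) DComp
    deq_refl deq_sym deq_trans deq_cong deq_assoc deq_idl deq_idr.

Fixpoint dmor_shift X Y (u : dmor X Y) : dmor (cpx_shift X) (cpx_shift Y) :=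
  match u with
  | DMap _ _ f => DMap (chain_shift f)
  | DInv _ _ s qs => DInv (quasi_iso_shift qs)
  | DComp _ _ _ v w => DComp (dmor_shift v) (dmor_shift w)
  end.

Lemma deq_shift X Y (u v : dmor X Y) :
  deq u v -> deq (dmor_shift u) (dmor_shift v).
Proof.
elim=> {X Y u v} /=.
- by move=> X Y u; apply: deq_refl.
- by move=> X Y u v _; apply: deq_sym.
- by move=> X Y u v w _ e1 _ e2; apply: deq_trans e1 e2.
- by move=> X Y Z u u' v v' _ e1 _ e2; apply: deq_cong.
- by move=> *; apply: deq_assoc.
- move=> X Y u; apply: deq_trans (deq_idl _); apply: deq_cong (deq_refl _).
  by apply: deq_map.
- move=> X Y u; apply: deq_trans (deq_idr _).
  by apply: deq_cong (deq_refl _) _; apply: deq_map.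
- by move=> X Y f g e; apply: deq_map => i x; apply: e.
- by move=> X Y Z f g; apply: deq_trans (deq_comp _ _); apply: deq_map.
- move=> X Y s qs; apply: deq_trans (deq_invl _) _.
  by apply: deq_map.
- move=> X Y s qs; apply: deq_trans (deq_invr _) _.
  by apply: deq_map.
Qed.

Lemma dmor_shift_id X :
  deq (dmor_shift (DMap (chain_id X))) (DMap (chain_id (cpx_shift X))).
Proof. by apply: deq_map. Qed.

Definition derived_shift : functor derived_cat derived_cat :=
  @Functor derived_cat derived_cat cpx_shift dmor_shift deq_shift dmor_shift_id
    (fun X Y Z u v => deq_refl _).

(* Distinguished triangles are those isomorphic to
   X -> Y -> cone f -> X[1] for a chain map f. *)
Definition derived_distinguished (X Y Z : derived_cat)
    (u : hom X Y) (v : hom Y Z) (w : hom Z (derived_shift X)) : Prop :=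
  exists (X' Y' : bcomplex) (f : chain_map X' Y')
    (a : @hom derived_cat X X') (b : @hom derived_cat Y Y')
    (c : @hom derived_cat Z (cone f)),
    is_iso a /\ is_iso b /\ is_iso c /\
    (b \o u == (DMap f : @hom derived_cat _ _) \o a)%cat /\
    (c \o v == (DMap (cone_in f) : @hom derived_cat _ _) \o b)%cat /\
    (fhom derived_shift a \o w ==
       (DMap (cone_out f) : @hom derived_cat _ _) \o c)%cat.

Definition bounded_derived_category : tri_category :=
  @TriCategory derived_cat derived_shift derived_distinguished.

End Derived.

Definition PHI_type_A (K : fieldType) (n : nat) (d : Order.disp_t)
    (D : finPOrderType d) : Prop :=
  exists2 Q : quiver, underlying_graph_A n Q &
    triangle_equivalent
      (bounded_derived_category (incidence_algebra D K))
      (bounded_derived_category (path_kalgebra K Q)).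

(* Main.v *)
Require Import Defs.
From HB Require Import structures.
From mathcomp Require Import all_boot all_order all_algebra.
From mathcomp Require Import generic_quotient.
From mathcomp.classical Require Import boolp.
From mathcomp Require Import zify ring.
(* imported last as well, so that hom denotes the morphisms of a category *)
Require Import Defs.

Set Implicit Arguments.
Unset Strict Implicit.
Unset Printing Implicit Defensive.

Import Order.TTheory GRing.Theory Num.Theory.
Local Open Scope ring_scope.

(** Let Q be a quiver of type A_n such that the bounded derived categories of
the incidence algebra KD and of KQ are equivalent.  Of the equivalence only the
sets of morphisms and the shift matter.  The indecomposable projectives P_x of
KD satisfy Hom(P_x, P_y) = K if y <= x and 0 otherwise, and there are no
morphisms to the other shifts.  As the equivalence is not assumed to be linear,
this is recorded in a form that any equivalence preserves
([incidence_family], [incidence_family_equiv]).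

Over KQ every complex has an explicit projective resolution of length one
([res_quasi_iso]), so morphisms in the derived category are homology classes of
a complex of matrices ([rmap_homotopic]).  Its Euler characteristic is the Euler
form of Q at the alternating dimension vectors ([reuler_form]).  Hence the
objects corresponding to the P_x have classes w_x in the lattice of the
vertices of Q with <w_x, w_y> = 1 if y <= x and 0 otherwise
([incidence_family_euler]).  Algebraic closedness enters here: it makes the
endomorphisms of these objects scalars ([local_scalar]).

The rest is combinatorics of roots.  The symmetrized Euler form of A_n is the
standard scalar product on the vectors with sum 0 in n + 1 coordinates
([root_coord_dot]), so that w_x becomes a difference of two unit vectors, the
head and the tail of x ([root_vectorP]).  Two distinct elements are comparable
if and only if they have the same head or the same tail, and never both
([shared_ends]).  The elements with a common head, or with a common tail, form
a chain, which bounds the degrees in the Hasse diagram by two ([degree_le2]).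
If all degrees were equal to two, then counting upper minus lower covers would
give a linear relation between the classes, which are linearly independent
([degree_le1], [classes_free]).  A connected graph with degrees at most two and
a vertex of degree at most one is a path ([path_graph]), so the Hasse quiver is
of type A_m, where m is the number of elements.

In particular it has no distinct parallel paths, and KD is its path algebra
([incidence_path_iso]).  Now both algebras are path algebras, and the linear
independence of the classes, applied in both directions, yields m = n
([classes_card]). *)

(** * Equivalences commuting with the shift *)

Section CategoryFacts.
Local Open Scope category_scope.
Implicit Types C D : category.

Definition isomorphic C (X Y : C) : Prop := exists f : hom X Y, is_iso f.

Lemma is_iso_id C (X : C) : is_iso (idm X).
Proof. by exists (idm X); split; apply: comp_idl. Qed.

Lemma isomorphic_refl C (X : C) : isomorphic X X.
Proof. by exists (idm X); apply: is_iso_id. Qed.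

Lemma isomorphic_sym C (X Y : C) : isomorphic X Y -> isomorphic Y X.
Proof. by case=> f [g [e1 e2]]; exists g, f. Qed.

Lemma comp_cancel C (X Y Z W : C) (f : hom Y W) (g : hom Z Y) (h : hom Y Z)
    (k : hom X Y) : g \o h == idm Y -> (f \o g) \o (h \o k) == f \o k.
Proof.
move=> e; apply: heq_trans (heq_sym (comp_assoc _ _ _)) _.
apply: comp_heq (heq_refl _) _; apply: heq_trans (comp_assoc _ _ _) _.
apply: heq_trans (comp_idl _); exact: comp_heq e (heq_refl _).
Qed.

Lemma is_iso_comp C (X Y Z : C) (f : hom Y Z) (g : hom X Y) :
  is_iso f -> is_iso g -> is_iso (f \o g).
Proof.
case=> f' [f1 f2] [g' [g1 g2]]; exists (g' \o f'); split.
  by apply: heq_trans (comp_cancel _ _ f1) g1.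
by apply: heq_trans (comp_cancel _ _ g2) f2.
Qed.

Lemma isomorphic_trans C (X Y Z : C) :
  isomorphic X Y -> isomorphic Y Z -> isomorphic X Z.
Proof.
by case=> f fi [g gi]; exists (g \o f); apply: is_iso_comp.
Qed.

Lemma is_iso_heq C (X Y : C) (f g : hom X Y) : f == g -> is_iso f -> is_iso g.
Proof.
move=> e [h [h1 h2]]; exists h; split.
  by apply: heq_trans h1; apply: comp_heq (heq_refl _) (heq_sym e).
by apply: heq_trans h2; apply: comp_heq (heq_sym e) (heq_refl _).
Qed.

Lemma fhom_iso C D (F : functor C D) (X Y : C) (f : hom X Y) :
  is_iso f -> is_iso (fhom F f).
Proof.
case=> g [g1 g2]; exists (fhom F g); split;
  apply: heq_trans (heq_sym (fhom_comp _ _ _)) _;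
  by apply: heq_trans (fhom_id F _); apply: fhom_heq.
Qed.

Lemma isomorphic_fob C D (F : functor C D) (X Y : C) :
  isomorphic X Y -> isomorphic (F X) (F Y).
Proof. by case=> f fi; exists (fhom F f); apply: fhom_iso. Qed.

(** Stands for Hom(X, Y) = 0 in a category of which only the composition is
used. *)
Definition hom_trivial C (X Y : C) : Prop := forall u v : hom X Y, u == v.

Lemma comp_cancelr C (X Y Z : C) (f : hom Y Z) (a : hom X Y) (b : hom Y X) :
  a \o b == idm Y -> (f \o a) \o b == f.
Proof.
move=> e; apply: heq_trans (heq_sym (comp_assoc _ _ _)) _.
apply: heq_trans (comp_idr _); exact: comp_heq (heq_refl _) e.
Qed.

Lemma comp_cancell C (X Y Z : C) (f : hom X Y) (a : hom Y Z) (b : hom Z Y) :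
  b \o a == idm Y -> b \o (a \o f) == f.
Proof.
move=> e; apply: heq_trans (comp_assoc _ _ _) _.
apply: heq_trans (comp_idl _); exact: comp_heq e (heq_refl _).
Qed.

Lemma hom_trivial_iso C (X X' Y Y' : C) :
  isomorphic X X' -> isomorphic Y Y' -> hom_trivial X Y -> hom_trivial X' Y'.
Proof.
case=> a [a' [a1 a2]] [b [b' [b1 b2]]] H u v.
have E w : (b \o ((b' \o w) \o a)) \o a' == w.
  apply: heq_trans (comp_heq (comp_assoc _ _ _) (heq_refl _)) _.
  apply: heq_trans (comp_cancelr _ a2) _; exact: comp_cancell.
apply: heq_trans (heq_sym (E u)) _; apply: heq_trans (E v).
by apply: comp_heq (heq_refl _); apply: comp_heq (heq_refl _) _; apply: H.
Qed.

Section Equivalence.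
Variables (C D : category) (F : functor C D) (G : functor D C).
Hypothesis GF : naturally_isomorphic (functor_comp G F) (functor_id C).
Hypothesis FG : naturally_isomorphic (functor_comp F G) (functor_id D).

Lemma equiv_unit_iso X : isomorphic (G (F X)) X.
Proof. by have [a [_ ai]] := GF; exists (a X); exact: ai. Qed.

Lemma equiv_counit_iso X : isomorphic (F (G X)) X.
Proof. by have [a [_ ai]] := FG; exists (a X); exact: ai. Qed.

Lemma equiv_faithful X Y (u v : hom X Y) : fhom F u == fhom F v -> u == v.
Proof.
move=> e; have [a [an ai]] := GF; have [b [b1 b2]] := ai X.
have E (w : hom X Y) : (a Y \o fhom G (fhom F w)) \o b == w.
  apply: heq_trans (comp_heq (an _ _ w) (heq_refl _)) _.
  exact: comp_cancelr.
apply: heq_trans (heq_sym (E u)) _; apply: heq_trans (E v).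
by apply: comp_heq (heq_refl _); apply: comp_heq (heq_refl _) _; apply: fhom_heq.
Qed.

End Equivalence.

Lemma equiv_full C D (F : functor C D) (G : functor D C)
  (GF : naturally_isomorphic (functor_comp G F) (functor_id C))
  (FG : naturally_isomorphic (functor_comp F G) (functor_id D))
  X Y (w : hom (F X) (F Y)) : exists u : hom X Y, fhom F u == w.
Proof.
have [a [an ai]] := GF; have [b [b1 b2]] := ai X; have [c [c1 c2]] := ai Y.
exists ((a Y \o fhom G w) \o b).
apply: (equiv_faithful FG).
set u := (a Y \o _) \o b.
(* by naturality a_Y GF(u) = u a_X = a_Y G(w), and a_Y is invertible *)
have := an _ _ u; rewrite /= => E.
have E2 : u \o a X == a Y \o fhom G w by exact: comp_cancelr.
have E3 : a Y \o fhom G (fhom F u) == a Y \o fhom G w by apply: heq_trans E E2.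
apply: heq_trans (heq_sym (comp_cancell _ c1)) _.
apply: heq_trans (comp_cancell _ c1).
exact: comp_heq (heq_refl _) E3.
Qed.

(** What is used of a triangle equivalence; unlike the preservation of
distinguished triangles it is inherited by the quasi-inverse at once. *)
Definition shift_equivalent (C D : tri_category) : Prop :=
  exists (F : functor C D) (G : functor D C),
  [/\ naturally_isomorphic (functor_comp G F) (functor_id C),
      naturally_isomorphic (functor_comp F G) (functor_id D)
    & forall X, isomorphic (F (shift C X)) (shift D (F X))].

Lemma shift_equivalent_tri (C D : tri_category) :
  triangle_equivalent C D -> shift_equivalent C D.
Proof.
case=> F [[G [GF FG]] [a [[_ ai] _]]]; exists F, G; split=> // X.
by exists (a X); apply: ai.
Qed.

Lemma shift_equivalent_sym (C D : tri_category) :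
  shift_equivalent C D -> shift_equivalent D C.
Proof.
case=> F [G [GF FG sF]]; exists G, F; split=> // Y.
apply: isomorphic_trans (equiv_unit_iso GF (shift C (G Y))).
apply: isomorphic_fob; apply: isomorphic_sym.
apply: isomorphic_trans (sF _) _.
by apply: isomorphic_fob; apply: equiv_counit_iso.
Qed.

Definition shiftn (C : tri_category) (k : nat) (X : C) : C :=
  iter k (fun X => shift C X) X.

Lemma shiftn_iso (C : tri_category) k (X Y : C) :
  isomorphic X Y -> isomorphic (shiftn k X) (shiftn k Y).
Proof. by move=> e; elim: k => //= k; apply: isomorphic_fob. Qed.

(** What an equivalence sees of projectives A e_x over an algebra A whose blocks
e_x A e_y are K or 0, with e_x A e_x = K: an endomorphism that is not
invertible behaves like zero, and all morphisms X_x -> X_y arise from a single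
one by endomorphisms of X_x.  No additive structure is mentioned, since an
equivalence is not assumed to be linear. *)
Record incidence_family (C : tri_category) (I : Type) (z : rel I)
    (X : I -> C) : Prop := IncidenceFamily {
  inc_pos : forall x y k, hom_trivial (X x) (shiftn k.+1 (X y));
  inc_neg : forall x y k, hom_trivial (shiftn k.+1 (X x)) (X y);
  inc_zero : forall x y, ~~ z x y -> hom_trivial (X x) (X y);
  inc_one : forall x y, z x y -> exists g : hom (X x) (X y),
    forall u : hom (X x) (X y), exists w : hom (X x) (X x), u == g \o w;
  inc_nontrivial : forall x y, z x y -> ~ hom_trivial (X x) (X y);
  inc_local : forall x (u : hom (X x) (X x)),
    is_iso u \/ forall v w : hom (X x) (X x), u \o v == u \o w
}.

Lemma incidence_family_equiv (C D : tri_category) (I : Type) (z : rel I)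
    (X : I -> C) : shift_equivalent C D -> incidence_family z X ->
  exists Y : I -> D, incidence_family z Y.
Proof.
case=> F [G [GF FG sF]] [h1 h2 h3 h4 h5 h6]; exists (fun x => F (X x)).
have sFn k Y : isomorphic (F (shiftn k Y)) (shiftn k (F Y)).
  elim: k => [|k IHk] /=; first exact: isomorphic_refl.
  by apply: isomorphic_trans (sF _) _; apply: isomorphic_fob.
have full Y Z (w : hom (F Y) (F Z)) := equiv_full GF FG w.
have triv Y Z : hom_trivial Y Z -> hom_trivial (F Y) (F Z).
  move=> H u v; have [u' eu] := full _ _ u; have [v' ev] := full _ _ v.
  apply: heq_trans (heq_sym eu) _; apply: heq_trans ev.
  by apply: fhom_heq; apply: H.
split.
- move=> x y k; apply: hom_trivial_iso (triv _ _ (h1 x y k)).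
    exact: isomorphic_refl.
  exact: sFn.
- move=> x y k; apply: hom_trivial_iso (triv _ _ (h2 x y k)); first exact: sFn.
  exact: isomorphic_refl.
- by move=> x y /h3; apply: triv.
- move=> x y /h4[g H]; exists (fhom F g) => u.
  have [u' eu] := full _ _ u; have [w ew] := H u'; exists (fhom F w).
  apply: heq_trans (heq_sym eu) _; apply: heq_trans (fhom_comp _ _ _).
  exact: fhom_heq.
- move=> x y /h5 H T; apply: H => u v; apply: (equiv_faithful GF); exact: T.
move=> x u; have [u' eu] := full _ _ u; case: (h6 x u') => [i|H].
  by left; apply: is_iso_heq eu _; apply: fhom_iso.
right=> v w; have [v' ev] := full _ _ v; have [w' ew] := full _ _ w.
have E (t' : hom (X x) (X x)) t : fhom F t' == t -> u \o t == fhom F (u' \o t').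
  move=> et; apply: heq_trans (heq_sym (fhom_comp F _ _)).
  by apply: comp_heq; apply: heq_sym.
apply: heq_trans (E _ _ ev) _; apply: heq_trans (heq_sym (E _ _ ew)).
by apply: fhom_heq; apply: H.
Qed.

Lemma incidence_family_iso (C : tri_category) (I : Type) (z : rel I)
    (X Y : I -> C) : (forall x, isomorphic (X x) (Y x)) ->
  incidence_family z X -> incidence_family z Y.
Proof.
move=> XY [h1 h2 h3 h4 h5 h6].
have YX x : isomorphic (Y x) (X x) by apply: isomorphic_sym.
split.
- by move=> x y k; apply: hom_trivial_iso (h1 x y k) => //; apply: shiftn_iso.
- by move=> x y k; apply: hom_trivial_iso (h2 x y k) => //; apply: shiftn_iso.
- by move=> x y /h3; apply: hom_trivial_iso.
- move=> x y /h4[g H]; have [a [a' [a1 a2]]] := XY x.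
  have [b [b' [b1 b2]]] := XY y; exists ((b \o g) \o a') => u.
  have [w ew] := H ((b' \o u) \o a); exists ((a \o w) \o a').
  apply: heq_sym; apply: heq_trans (comp_assoc _ _ _) _.
  apply: heq_trans (comp_heq (comp_cancel _ _ a1) (heq_refl _)) _.
  apply: heq_trans (comp_heq (heq_sym (comp_assoc _ _ _)) (heq_refl _)) _.
  apply: heq_trans (comp_heq (comp_heq (heq_refl _) (heq_sym ew))
    (heq_refl _)) _.
  apply: heq_trans (comp_heq (comp_assoc _ _ _) (heq_refl _)) _.
  by apply: heq_trans (comp_cancelr _ a2) _; exact: comp_cancell.
- move=> x y /h5 H T; apply: H; exact: hom_trivial_iso T.
move=> x u; have [a [a' [a1 a2]]] := XY x.
have E : (a \o ((a' \o u) \o a)) \o a' == u.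
  apply: heq_trans (comp_heq (comp_assoc _ _ _) (heq_refl _)) _.
  by apply: heq_trans (comp_cancelr _ a2) _; exact: comp_cancell.
case: (h6 x ((a' \o u) \o a)) => [i|H]; [left|right=> v w].
  apply: is_iso_heq E _; apply: is_iso_comp; last by exists a.
  by apply: is_iso_comp => //; exists a'.
have F v' : u \o v' == (a \o (((a' \o u) \o a) \o ((a' \o v') \o a))) \o a'.
  apply: heq_sym.
  apply: heq_trans (comp_heq (comp_heq (heq_refl _) (comp_heq (heq_refl _)
    (heq_sym (comp_assoc _ _ _)))) (heq_refl _)) _.
  apply: heq_trans (comp_heq (comp_heq (heq_refl _) (comp_cancel _ _ a2))
    (heq_refl _)) _.
  apply: heq_trans (comp_heq (comp_heq (heq_refl _) (comp_assoc _ _ _))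
    (heq_refl _)) _.
  apply: heq_trans (comp_heq (comp_assoc _ _ _) (heq_refl _)) _.
  apply: heq_trans (comp_cancelr _ a2) _.
  apply: heq_trans (comp_heq (heq_refl _) (heq_sym (comp_assoc _ _ _))) _.
  exact: comp_cancell.
apply: heq_trans (F v) _; apply: heq_trans (heq_sym (F w)).
by apply: comp_heq (heq_refl _); apply: comp_heq (heq_refl _) _; apply: H.
Qed.

End CategoryFacts.

(** * Morphisms out of a homotopically projective complex *)

Section Homotopy.
Variable A : pzRingType.
Implicit Types X Y Z W : bcomplex A.

(** Makes a function with a proof of linearity available as a linear map in
the middle of a proof. *)
Definition mk_linear (U V : lmodType A) (f : U -> V) (fL : linear f) : U -> V :=
  f.

HB.instance Definition _ (U V : lmodType A) (f : U -> V) (fL : linear f) :=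
  GRing.isLinear.Build A U V *:%R (mk_linear fL) fL.

Local Notation DA := (derived_cat A).
Local Notation dmap f := (DMap f : @hom DA _ _).

Definition chain_zero X Y : chain_map X Y.
Proof.
exists (fun i => \0 : {linear X i -> Y i}) => i x /=; by rewrite linear0.
Defined.

Definition chain_sub X Y (f g : chain_map X Y) : chain_map X Y.
Proof.
exists (fun i => f i \- g i : {linear X i -> Y i}) => i x /=.
by rewrite !cmap_diff linearB.
Defined.

(** Stated in the degrees i + 1, so that no transport along i - 1 + 1 = i is
needed; every degree has this form. *)
Definition homotopic X Y (f g : chain_map X Y) : Prop :=
  exists k : forall i, {linear X (i + 1) -> Y i}, forall i (x : X (i + 1)),
    f (i + 1) x - g (i + 1) x = diff Y i (k i x) + k (i + 1) (diff X (i + 1) x).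

Lemma homotopic_refl X Y (f : chain_map X Y) : homotopic f f.
Proof.
exists (fun i => \0 : {linear X (i + 1) -> Y i}) => i x /=.
by rewrite subrr linear0 addr0.
Qed.

Lemma homotopic_sym X Y (f g : chain_map X Y) : homotopic f g -> homotopic g f.
Proof.
case=> k H; exists (fun i => \- k i : {linear X (i + 1) -> Y i}) => i x /=.
by rewrite linearN -opprD -H opprB.
Qed.

Lemma homotopic_trans X Y (f g h : chain_map X Y) :
  homotopic f g -> homotopic g h -> homotopic f h.
Proof.
case=> k H [l L]; exists (fun i => k i \+ l i : {linear X (i + 1) -> Y i}) => i x /=.
by rewrite linearD addrACA -H -L addrA addrNK.
Qed.

Lemma homotopic_compl X Y Z (s : chain_map Y Z) (f g : chain_map X Y) :
  homotopic f g -> homotopic (chain_comp s f) (chain_comp s g).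
Proof.
case=> k H; exists (fun i => s i \o k i : {linear X (i + 1) -> Z i}) => i x /=.
by rewrite -linearB H linearD cmap_diff.
Qed.

Lemma homotopic_compr X Y Z (f g : chain_map Y Z) (h : chain_map X Y) :
  homotopic f g -> homotopic (chain_comp f h) (chain_comp g h).
Proof.
case=> k H; exists (fun i => k i \o h (i + 1) : {linear X (i + 1) -> Z i}).
by move=> i x /=; rewrite H cmap_diff.
Qed.

Lemma homotopic_sub X Y (f g : chain_map X Y) :
  homotopic f g <-> homotopic (chain_sub f g) (chain_zero X Y).
Proof.
by split=> -[k H]; exists k => i x; move: (H i x) => /= <-; rewrite /= ?subr0.
Qed.

Lemma ext_homotopic X Y (f g : chain_map X Y) :
  (forall i x, f i x = g i x) -> homotopic f g.
Proof.
move=> e; have [k H] := homotopic_refl g.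
by exists k => i x; rewrite e H.
Qed.

Definition acyclic (C : bcomplex A) : Prop :=
  forall i (x : C (i + 1)), diff C (i + 1) x = 0 -> exists y, x = diff C i y.

Lemma cone_acyclic X Y (s : chain_map X Y) : quasi_iso s -> acyclic (cone s).
Proof.
move=> qs i [a b] /= [/eqP]; rewrite oppr_eq0 => /eqP da eab.
have [inj _] := qs (i + 1); have [_ surj] := qs i.
have [|c ec] := inj a da.
  by exists (- b); rewrite linearN; apply/eqP; rewrite -addr_eq0 eab.
have [|x dx [b' eb]] := surj (b + s (i + 1) c).
  by rewrite linearD -cmap_diff -ec [LHS]addrC.
exists (x - c, b'); congr pair => /=.
  by rewrite linearB dx sub0r opprK.
by rewrite -eb linearB [RHS]addrC addrA subrK addrK.
Qed.

Lemma quasi_iso_bij X Y (s : chain_map X Y) (t : forall i, Y i -> X i) :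
  (forall i y, t (i + 1) (diff Y i y) = diff X i (t i y)) ->
  (forall i x, t i (s i x) = x) -> (forall i y, s i (t i y) = y) -> quasi_iso s.
Proof.
move=> td ts st i; split=> [x dx [y e]|y dy].
  by exists (t i y); rewrite -td -e ts.
exists (t (i + 1) y); first by rewrite -td dy -[0](linear0 (s (i+1+1))) ts.
by exists 0; rewrite st subrr linear0.
Qed.

Section Sum.
Variables X Y : bcomplex A.

Definition sum_term (i : int) : lmodType A := (X i * Y i)%type.

Definition sum_diff_fun (i : int) (z : sum_term i) : sum_term (i + 1) :=
  (diff X i z.1, diff Y i z.2).

Lemma sum_diff_linear i : linear (@sum_diff_fun i).
Proof.
move=> k [x y] [x' y']; rewrite /sum_diff_fun /=.
by rewrite [RHS]surjective_pairing; congr pair => /=; rewrite linearP.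
Qed.

HB.instance Definition _ i := GRing.isLinear.Build A (sum_term i)
  (sum_term (i + 1)) *:%R (@sum_diff_fun i) (@sum_diff_linear i).

Lemma sum_diffK i z : @sum_diff_fun (i + 1) (@sum_diff_fun i z) = 0.
Proof. by rewrite /sum_diff_fun /= !diffK. Qed.

Lemma sum_fin_gen i : fin_gen (sum_term i).
Proof.
have [m [v Hv]] := term_fin_gen X i.
have [n [w Hw]] := term_fin_gen Y i.
exists (m + n)%N, (fun k => match split k with
  inl j => (v j, 0) | inr j => (0, w j) end) => -[x y].
have [c ->] := Hv x; have [e ->] := Hw y.
exists (fun k => match split k with inl j => c j | inr j => e j end).
rewrite big_split_ord /=.
under [X in _ = X + _]eq_bigr => j _ do rewrite (unsplitK (inl j)).
under [X in _ = _ + X]eq_bigr => j _ do rewrite (unsplitK (inr j)).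
rewrite [LHS]surjective_pairing [RHS]surjective_pairing /=; congr pair.
  rewrite !(raddf_sum fst) /=.
  by rewrite [X in _ = _ + X]big1 ?addr0 // => j _; rewrite scaler0.
rewrite !(raddf_sum snd) /=.
by rewrite [X in _ = X + _]big1 ?add0r // => j _; rewrite scaler0.
Qed.

Lemma sum_bounded : exists N : nat, forall i : int,
  (N < `|i|)%N -> forall z : sum_term i, z = 0.
Proof.
have [M HM] := term_bounded X; have [N HN] := term_bounded Y.
exists (maxn M N) => i; rewrite gtn_max => /andP[ltM ltN] [x y].
by rewrite (HM _ ltM x) (HN _ ltN y).
Qed.

Definition sum_cpx : bcomplex A :=
  @BComplex A sum_term (fun i => @sum_diff_fun i) sum_diffK sum_fin_gen
    sum_bounded.

Definition sum_fst : chain_map sum_cpx X.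
Proof. by exists (fun i => fst : {linear sum_term i -> X i}). Defined.

Lemma sum_pair_linear W (f : chain_map W X) (g : chain_map W Y) i :
  linear (fun x => (f i x, g i x) : sum_term i).
Proof.
move=> k x y; rewrite [RHS]surjective_pairing /=.
by congr pair; rewrite linearP.
Qed.

Definition sum_pair W (f : chain_map W X) (g : chain_map W Y) :
  chain_map W sum_cpx.
Proof.
exists (fun i => mk_linear (@sum_pair_linear W f g i) : {linear W i -> sum_term i}) => i x.
by congr pair; rewrite /= cmap_diff.
Defined.

Lemma sum_copair_linear W (f : chain_map X W) (g : chain_map Y W) i :
  linear (fun z : sum_term i => f i z.1 + g i z.2).
Proof. by move=> k x y /=; rewrite !linearP scalerDr addrACA. Qed.

Definition sum_copair W (f : chain_map X W) (g : chain_map Y W) :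
  chain_map sum_cpx W.
Proof.
exists (fun i => mk_linear (@sum_copair_linear W f g i) : {linear sum_term i -> W i}) => i x.
by rewrite /= /mk_linear /= linearD !cmap_diff.
Defined.

Lemma sum_fst_quasi_iso : acyclic Y -> quasi_iso sum_fst.
Proof.
move=> acY i; split=> [[x y] /= [dx dy] [x' ex]|x dx].
  by have [y' ey] := acY i y dy; exists (x', y'); rewrite ex ey.
by exists (x, 0); rewrite /= /sum_diff_fun /= ?dx ?linear0 //; exists 0;
  rewrite linear0 subrr.
Qed.

End Sum.

(** Homotopic maps differ by a map that factors through the contractible
complex cone(id).  Adding it as a summand of the source gives the usual
cylinder: both X -> X + cone(id), x |-> (x, 0) and x |-> (x, (0, x)), are
sections of the quasi-isomorphism X + cone(id) -> X. *)
Lemma homotopic_deq X Y (f g : chain_map X Y) :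
  homotopic f g -> deq (DMap f) (DMap g).
Proof.
case=> k H.
pose C := cone (chain_id X).
have acC : acyclic C.
  apply: cone_acyclic; apply: (@quasi_iso_bij _ _ _ (fun i x => x)) => //.
pose hf i (z : C i) : Y i := k i z.1 + (f i z.2 - g i z.2).
have hL i : linear (@hf i).
  move=> c x y; rewrite /hf /=.
  rewrite (linearP (k i)) (linearP (f i)) (linearP (g i)) !scalerDr scalerN opprD.
  by rewrite [X in _ + X = _]addrACA [LHS]addrACA.
have hd i (z : C i) : hf (i + 1) (diff C i z) = diff Y i (hf i z).
  rewrite /hf /= linearN !(linearD (f _)) !(linearD (g _)) opprD addrACA H.
  rewrite [LHS]addrA (addrCA (- _ _)).
  by rewrite addNr addr0 !cmap_diff -linearB -linearD.
pose h := @ChainMap A C Y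
  (fun i => mk_linear (hL i) : {linear cone_term X X i -> Y i}) hd.
pose q := sum_fst X C; have qq : quasi_iso q := sum_fst_quasi_iso X acC.
pose j := sum_pair (chain_id X) (chain_zero X C).
pose j' := sum_pair (chain_id X) (cone_in (chain_id X)).
have sec (l : chain_map X (sum_cpx X C)) : (forall i x, q i (l i x) = x) ->
    deq (DMap l) (DInv qq).
  move=> ql; apply: deq_sym; apply: deq_trans (deq_sym (deq_idr _)) _.
  apply: (deq_trans (v := DComp (DInv qq) (DComp (DMap q) (DMap l)))).
    apply: deq_cong (deq_refl _) _; apply: deq_sym.
    by apply: deq_trans (deq_sym (deq_comp _ _)) _; apply: deq_map.
  apply: deq_trans (deq_assoc _ _ _) _; apply: deq_trans (deq_idl _).
  by apply: deq_cong (deq_refl _); apply: deq_invl.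
pose F := sum_copair g h.
have fac (l : chain_map X (sum_cpx X C)) (e : chain_map X Y) :
    (forall i x, q i (l i x) = x) -> (forall i x, e i x = F i (l i x)) ->
    deq (DMap e) (DComp (DMap F) (DInv qq)).
  move=> ql el; apply: (deq_trans (v := DComp (DMap F) (DMap l))).
    by apply: deq_trans (deq_comp _ _); apply: deq_map.
  by apply: deq_cong (deq_refl _) _; apply: sec.
apply: deq_trans (fac j' f _ _) (deq_sym (fac j g _ _)) => // i x.
  by rewrite /= /mk_linear /= /mk_linear /hf /= linear0 add0r addrC subrK.
by exact/esym/(etrans (congr1 _ (linear0 (h i))))/addr0.
Qed.

Lemma all_succ (Q : int -> Prop) : (forall i, Q (i + 1)) -> forall j, Q j.
Proof. by move=> H j; rewrite -(subrK 1 j). Qed.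

(** The transport along j - 1 + 1 = j is confined to this lemma. *)
Lemma family_succ (T : int -> Type) (x : forall i, T (i + 1)) :
  exists y : forall j, T j, forall i, y (i + 1) = x i.
Proof.
exists (fun j => eq_rect _ T (x (j - 1)) j (subrK 1 j)) => i.
have E i' (e : i' = i) (e' : i' + 1 = i + 1) : eq_rect _ T (x i') _ e' = x i.
  by subst i'; rewrite (Prop_irrelevance e' erefl).
by apply: E; rewrite addrK.
Qed.

(** The consequence of being a bounded complex of projectives on which all that
follows rests.  For P it gives the existence of lifts along quasi-isomorphisms,
for the shift of P their uniqueness up to homotopy. *)
Definition hprojective P : Prop := forall n C, acyclic C ->
  forall g : chain_map (iter n (@cpx_shift A) P) C, homotopic g (chain_zero _ C).

Lemma hprojective_shift P : hprojective P -> hprojective (cpx_shift P).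
Proof. by move=> H n; rewrite -iterSr; apply: H n.+1. Qed.

Section HProjective.
Variable P : bcomplex A.
Hypothesis hP : hprojective P.

(** The obstruction is the composite of g with the map from Z to the acyclic
cone of s; the two components of a null-homotopy of it are the lift and the
homotopy. *)
Lemma hprojective_lift Y Z (s : chain_map Y Z) (g : chain_map P Z) :
  quasi_iso s -> exists g' : chain_map P Y, homotopic (chain_comp s g') g.
Proof.
move=> qs.
have [k H] := hP (n := 0) (cone_acyclic qs) (chain_comp (cone_in s) g).
have [p Hp] := @family_succ (fun j => {linear P j -> Y j})
  (fun i => fst \o k i : {linear P (i + 1) -> Y (i + 1)}).
have pd : forall i (x : P i), p (i + 1) (diff P i x) = diff Y i (p i x).
  apply: all_succ => i x; rewrite !Hp /=.
  have := congr1 fst (H i x); rewrite /= subr0 => /esym/eqP.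
  by rewrite addr_eq0 eqr_opp => /eqP.
exists (ChainMap pd); exists (fun i => \- (snd \o k i) : {linear P (i + 1) -> Z i}).
move=> i x /=; rewrite !Hp /=; have := congr1 snd (H i x); rewrite /= subr0 => ->.
have aux (V : zmodType) (a b c : V) : a - (a + b + c) = - b - c.
  by rewrite -addrA opprD addrA subrr sub0r opprD.
by rewrite linearN; apply: aux.
Qed.

(** A null-homotopy of s g together with g is a chain map from the shift of P
to the acyclic cone of s. *)
Lemma hprojective_cancel Y Z (s : chain_map Y Z) (g : chain_map P Y) :
  quasi_iso s -> homotopic (chain_comp s g) (chain_zero P Z) ->
  homotopic g (chain_zero P Y).
Proof.
move=> qs [k H].
have GL i : linear (fun x : P (i + 1) => (g (i + 1) x, - k i x) : cone_term Y Z i).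
  move=> c x y; rewrite [RHS]surjective_pairing /=; congr pair.
    by rewrite linearP.
  by rewrite linearP opprD scalerN.
have Gd i (x : cpx_shift P i) : mk_linear (GL (i + 1)) (diff (cpx_shift P) i x) =
    diff (cone s) i (mk_linear (GL i) x).
  rewrite /= /mk_linear /= /cone_diff_fun /shift_diff_fun /= !linearN !cmap_diff.
  congr pair; rewrite opprK; have := H i x; rewrite /= subr0 => ->.
  by rewrite [X in X - _]addrC addrK.
pose G := @ChainMap A (cpx_shift P) (cone s)
  (fun i => mk_linear (GL i) : {linear P (i + 1) -> cone_term Y Z i}) Gd.
have [l L] := hP (n := 1) (cone_acyclic qs) G.
have [p Hp] := @family_succ (fun j => {linear P (j + 1) -> Y j})
  (fun i => fst \o l i : {linear P (i + 1 + 1) -> Y (i + 1)}).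
exists (fun j => \- p j : {linear P (j + 1) -> Y j}).
apply: all_succ => i x; have := congr1 fst (L i x).
rewrite /= /mk_linear /= !Hp /= => ->.
by rewrite /shift_diff_fun !linearN.
Qed.

Lemma hprojective_inj Y Z (s : chain_map Y Z) (g g' : chain_map P Y) :
  quasi_iso s -> homotopic (chain_comp s g) (chain_comp s g') -> homotopic g g'.
Proof.
move=> qs H; apply/homotopic_sub; apply: hprojective_cancel qs _.
have/homotopic_sub H0 := H; apply: homotopic_trans H0.
by apply: ext_homotopic => i x /=; rewrite linearB.
Qed.

(** Inverted quasi-isomorphisms are absorbed one after the other by lifting. *)
Lemma hprojective_full_comp W Y (u : dmor W Y) (g : chain_map P W) :
  exists g' : chain_map P Y, deq (DComp u (DMap g)) (DMap g').
Proof.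
elim: {W Y} u g => [W Y f|Y Z s qs|X Y Z u IHu v IHv] g.
- by exists (chain_comp f g); apply: deq_sym; apply: deq_comp.
- have [g' H] := hprojective_lift g qs; exists g'.
  apply: deq_trans (deq_cong (deq_refl _) (deq_sym (homotopic_deq H))) _.
  apply: deq_trans (deq_cong (deq_refl _) (deq_comp _ _)) _.
  apply: deq_trans (deq_assoc _ _ _) _; apply: deq_trans (deq_idl _).
  by apply: deq_cong (deq_refl _); apply: deq_invl.
have [g' H'] := IHv g; have [g'' H''] := IHu g'; exists g''.
apply: deq_trans (deq_sym (deq_assoc _ _ _)) _; apply: deq_trans H''.
exact: deq_cong (deq_refl _) H'.
Qed.

Lemma hprojective_full Y (u : dmor P Y) : exists g : chain_map P Y, deq u (DMap g).
Proof.
have [g H] := hprojective_full_comp u (chain_id P); exists g.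
by apply: deq_trans H; apply: deq_sym; apply: deq_idr.
Qed.

(** The action of a formal fraction on homotopy classes of maps out of P, as a
relation: an inverse s^-1 acts by lifting along s, which is well defined
because P does not see acyclic complexes. *)
Fixpoint dmor_rel W Y (u : dmor W Y) : chain_map P W -> chain_map P Y -> Prop :=
  match u with
  | DMap _ _ f => fun g g' => homotopic (chain_comp f g) g'
  | DInv _ _ s _ => fun g g' => homotopic (chain_comp s g') g
  | DComp _ _ _ u v => fun g g' => exists m, dmor_rel v g m /\ dmor_rel u m g'
  end.

Lemma dmor_rel_homotopic W Y (u : dmor W Y) g1 g2 g1' g2' :
  homotopic g1 g2 -> homotopic g1' g2' -> dmor_rel u g1 g1' -> dmor_rel u g2 g2'.
Proof.
elim: {W Y} u g1 g2 g1' g2' => [W Y f|Y Z s qs|X Y Z u IHu v IHv] g1 g2 g1' g2' /=.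
- move=> e e' H; apply: homotopic_trans e'; apply: homotopic_trans H.
  by apply: homotopic_compl; apply: homotopic_sym.
- move=> e e' H; apply: homotopic_trans e; apply: homotopic_trans H.
  by apply: homotopic_compl; apply: homotopic_sym.
move=> e e' [m [H H']]; exists m; split.
  exact: IHv e (homotopic_refl _) H.
exact: IHu (homotopic_refl _) e' H'.
Qed.

Lemma dmor_rel_deq W Y (u v : dmor W Y) : deq u v ->
  forall g g', dmor_rel u g g' <-> dmor_rel v g g'.
Proof.
elim=> {W Y u v} /=.
- by [].
- by move=> X Y u v _ IH g g'; rewrite IH.
- by move=> X Y u v w _ IH _ IH' g g'; rewrite IH.
- by move=> X Y Z u u' v v' _ IH _ IH' g g'; split=> -[m [H H']]; exists m;
    split; first [apply/IH' | apply/IH].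
- move=> X Y Z W u v w g g'; split.
    by case=> m [[l [H1 H2]] H3]; exists l; split=> //; exists m.
  by case=> m [H1 [l [H2 H3]]]; exists l; split=> //; exists m.
- move=> X Y u g g'; split=> [[m [H H']]|H].
    by apply: dmor_rel_homotopic (homotopic_refl _) _ H; apply: homotopic_trans H';
      apply: ext_homotopic.
  by exists g'; split=> //; apply: ext_homotopic.
- move=> X Y u g g'; split=> [[m [H H']]|H].
    by apply: dmor_rel_homotopic (homotopic_refl _) H'; apply: homotopic_sym;
      apply: homotopic_trans H; apply: ext_homotopic.
  by exists g; split=> //; apply: ext_homotopic.
- move=> X Y f f' e g g'; have E : homotopic (chain_comp f g) (chain_comp f' g).
    by apply: ext_homotopic => i x /=; rewrite e.
  by split; apply: homotopic_trans => //; apply: homotopic_sym.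
- move=> X Y Z f g h h'; split=> [H|[m [H H']]].
    by exists (chain_comp g h); split; [apply: homotopic_refl|
      apply: homotopic_trans H; apply: ext_homotopic].
  apply: homotopic_trans H'; apply: homotopic_trans (homotopic_compl _ H).
  exact: ext_homotopic.
- move=> X Y s qs g g'; split=> [[m [H H']]|H].
    have := hprojective_inj qs (homotopic_trans H (homotopic_sym H')).
    by apply: homotopic_trans; apply: ext_homotopic.
  exists (chain_comp s g); split; first exact: homotopic_refl.
  by apply: homotopic_compl; apply: homotopic_trans (homotopic_sym H) _;
    apply: ext_homotopic.
move=> X Y s qs g g'; split=> [[m [H H']]|H].
  apply: homotopic_trans H'; apply: homotopic_sym; apply: homotopic_trans H _.
  exact: ext_homotopic.
have [m Hm] := hprojective_lift g qs; exists m; split=> //.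
by apply: homotopic_trans Hm _; apply: homotopic_trans H; apply: ext_homotopic.
Qed.

Lemma hprojective_faithful Y (f g : chain_map P Y) :
  deq (DMap f) (DMap g) -> homotopic f g.
Proof.
move=> /dmor_rel_deq/(_ (chain_id P) g)[_ /= H].
have E (h : chain_map P Y) : homotopic (chain_comp h (chain_id P)) h.
  exact: ext_homotopic.
by apply: homotopic_trans (homotopic_sym (E f)) _; apply: H; apply: E.
Qed.

End HProjective.

End Homotopy.

(** * Bounded complexes of projective modules *)

Section ProjectiveComplexes.
Variable A : pzRingType.

(** Generators g_i of degree [pdeg i], spanning A e_i with e_i = [pidem i], and
differential d g_i = sum_k D_ik g_k.  A vanishing idempotent switches a
generator off. *)
Record proj_data := ProjData {
  pidx : finType;
  pdeg : pidx -> int;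
  pidem : pidx -> A;
  pmx : pidx -> pidx -> A;
  pidemK : forall i, pidem i * pidem i = pidem i;
  pmx_idl : forall i k, pidem i * pmx i k = pmx i k;
  pmx_idr : forall i k, pmx i k * pidem k = pmx i k;
  pmx_deg : forall i k, pdeg k != pdeg i + 1 -> pmx i k = 0;
  pmxK : forall i l, \sum_k pmx i k * pmx k l = 0
}.

Section Construction.
Variable p : proj_data.
Local Notation I := (pidx p).

Definition proj_pred (j : int) : {pred {ffun I -> A^o}} := fun u =>
  [forall i, ((u i : A) * pidem i == u i) && ((pdeg i != j) ==> (u i == 0))].

Lemma proj_predP j (u : {ffun I -> A^o}) :
  reflect ((forall i, (u i : A) * pidem i = u i) /\
           (forall i, pdeg i != j -> u i = 0)) (u \in proj_pred j).
Proof.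
apply: (iffP forallP) => [H|[H1 H2] i].
  split=> i; first by have /andP[/eqP] := H i.
  by have /andP[_ /implyP H2] := H i; move/H2/eqP.
by apply/andP; split; [apply/eqP | apply/implyP => /H2 ->].
Qed.

Lemma proj_submod_closed j : submod_closed (proj_pred j).
Proof.
split=> [|c u v /proj_predP[u1 u2] /proj_predP[v1 v2]]; apply/proj_predP.
  by split=> i *; rewrite ffunE ?mul0r.
split=> i; rewrite !ffunE; first by rewrite mulrDl -mulrA u1 v1.
by move=> ne; rewrite u2 ?v2 // scaler0 addr0.
Qed.

HB.instance Definition _ j := GRing.isSubmodClosed.Build A {ffun I -> A^o}
  (proj_pred j) (proj_submod_closed j).

Definition proj_term (j : int) : Type := {u : {ffun I -> A^o} | u \in proj_pred j}.

Definition proj_mk j u (pu : u \in proj_pred j) : proj_term j := exist _ u pu.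

HB.instance Definition _ j := SubType.on (proj_term j).
HB.instance Definition _ j := Choice.on (proj_term j).
HB.instance Definition _ j := [SubChoice_isSubLmodule of proj_term j by <:].

Lemma proj_idem j (u : proj_term j) i : (val u i : A) * pidem i = val u i.
Proof. by have [H _] := proj_predP _ _ (valP u). Qed.

Lemma proj_out j (u : proj_term j) i : pdeg i != j -> val u i = 0.
Proof. by have [_ H] := proj_predP _ _ (valP u); apply: H. Qed.

Definition proj_diff_val j (u : proj_term j) : {ffun I -> A^o} :=
  [ffun k => \sum_i (val u i : A) * pmx i k].

Lemma proj_diff_subproof j (u : proj_term j) :
  proj_diff_val u \in proj_pred (j + 1).
Proof.
apply/proj_predP; split=> k; rewrite ffunE.
  by rewrite mulr_suml; apply: eq_bigr => i _; rewrite -mulrA pmx_idr.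
move=> ne; apply: big1 => i _; have [e|ne'] := eqVneq (pdeg i) j.
  by rewrite pmx_deg ?mulr0 ?e.
by rewrite proj_out ?mul0r.
Qed.

Definition proj_diff_fun j (u : proj_term j) : proj_term (j + 1) :=
  Sub (proj_diff_val u) (proj_diff_subproof u).

Lemma proj_diff_linear j : linear (@proj_diff_fun j).
Proof.
move=> c u v; apply: val_inj; rewrite linearP; apply/ffunP => k.
rewrite !SubK !ffunE scaler_sumr -big_split; apply: eq_bigr => i _ /=.
by rewrite !ffunE mulrDl; congr (_ + _); apply/esym/mulrA.
Qed.

HB.instance Definition _ j := GRing.isLinear.Build A (proj_term j)
  (proj_term (j + 1)) *:%R (@proj_diff_fun j) (@proj_diff_linear j).

Lemma proj_diffK j u : @proj_diff_fun (j + 1) (@proj_diff_fun j u) = 0.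
Proof.
apply: val_inj; apply/ffunP => l; rewrite !SubK !ffunE.
under eq_bigr => k _ do rewrite ffunE mulr_suml.
rewrite exchange_big; apply: big1 => i _.
under eq_bigr => k _ do rewrite -mulrA.
by rewrite -mulr_sumr pmxK mulr0.
Qed.

Definition proj_gen_val j (i : I) : {ffun I -> A^o} :=
  [ffun k => if (k == i) && (pdeg i == j) then pidem i else 0].

Lemma proj_gen_subproof j i : proj_gen_val j i \in proj_pred j.
Proof.
apply/proj_predP; split=> k; rewrite ffunE.
  case: (k =P i) => [->|] /=; last by rewrite mul0r.
  by case: ifP; rewrite ?mul0r ?pidemK.
by case: (k =P i) => [->|] //= /negbTE ->.
Qed.

Definition proj_gen j i : proj_term j := Sub (proj_gen_val j i) (proj_gen_subproof j i).

Lemma proj_genE j (u : proj_term j) : u = \sum_i (val u i : A) *: proj_gen j i.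
Proof.
apply: val_inj; apply/ffunP => k; rewrite linear_sum sum_ffunE (bigD1 k) //=.
rewrite !ffunE eqxx /= big1 ?addr0 => [|i ne]; last first.
  by rewrite !ffunE eq_sym (negbTE ne) /= scaler0.
case: eqP => [_|/eqP ne]; first by rewrite -[RHS]/(_ * _) proj_idem.
by rewrite (proj_out _ ne) scale0r.
Qed.

Lemma proj_fin_gen j : fin_gen (proj_term j).
Proof.
exists #|I|, (fun k => proj_gen j (enum_val k)) => u.
exists (fun k => val u (enum_val k)).
by rewrite {1}(proj_genE u) (reindex (@enum_val _ I)) //; apply: onW_bij; exact: enum_val_bij.
Qed.

Definition proj_bound : nat := \max_(i : I) `|pdeg i|%N.

Lemma proj_boundP (i : I) : (`|pdeg i| <= proj_bound)%N.
Proof. exact: (leq_bigmax (F := fun i : I => `|pdeg i|%N)). Qed.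

Lemma proj_bounded : exists N : nat, forall j : int,
  (N < `|j|)%N -> forall u : proj_term j, u = 0.
Proof.
exists proj_bound => j ltj u; apply: val_inj; apply/ffunP => i.
rewrite proj_out ?linear0 ?ffunE //; apply: contraTneq ltj => <-.
by rewrite -leqNgt proj_boundP.
Qed.

Definition proj_cpx : bcomplex A :=
  @BComplex A proj_term (fun j => @proj_diff_fun j) proj_diffK proj_fin_gen
    proj_bounded.

Section Maps.
Variable Y : bcomplex A.

Lemma proj_map_linear j (V : lmodType A) (y : I -> V) :
  linear (fun u : proj_term j => \sum_i (val u i : A) *: y i).
Proof.
move=> c u v; rewrite scaler_sumr -big_split; apply: eq_bigr => i _ /=.
by rewrite !ffunE scalerDl scalerA.
Qed.

Lemma proj_map_diff j (V : lmodType A) (y : I -> V) (u : proj_term j) :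
  \sum_k (val (proj_diff_fun u) k : A) *: y k =
  \sum_i (val u i : A) *: \sum_k pmx i k *: y k.
Proof.
under eq_bigr => k _ do rewrite SubK ffunE scaler_suml.
rewrite exchange_big; apply: eq_bigr => i _; rewrite scaler_sumr.
by apply: eq_bigr => k _; rewrite scalerA.
Qed.

Lemma proj_sum_idem j (V : lmodType A) (y y' : I -> V) (u : proj_term j) :
  (forall i, pdeg i = j -> pidem i *: y i = pidem i *: y' i) ->
  \sum_i (val u i : A) *: y i = \sum_i (val u i : A) *: y' i.
Proof.
move=> H; apply: eq_bigr => i _; have [e|ne] := eqVneq (pdeg i) j.
  by rewrite -proj_idem -!scalerA H.
by rewrite proj_out // !scale0r.
Qed.

Definition proj_family (y : forall j, I -> Y j) : Prop := forall j i,
  pdeg i = j -> pidem i *: diff Y j (y j i) = \sum_k pmx i k *: y (j + 1) k.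

Lemma proj_map_diff_subproof (y : forall j, I -> Y j) (Hy : proj_family y)
    j (u : proj_cpx j) :
  mk_linear (@proj_map_linear (j + 1) (Y (j + 1)) (y (j + 1))) (diff proj_cpx j u) =
  diff Y j (mk_linear (@proj_map_linear j (Y j) (y j)) u).
Proof.
rewrite /mk_linear linear_sum proj_map_diff.
under [RHS]eq_bigr => i _ do rewrite linearZ_LR.
apply: proj_sum_idem => i e; rewrite (Hy j i e) scaler_sumr.
by apply: eq_bigr => k _; rewrite scalerA pmx_idl.
Qed.

Definition proj_map y (Hy : proj_family y) : chain_map proj_cpx Y :=
  @ChainMap A proj_cpx Y (fun j => mk_linear (@proj_map_linear j (Y j) (y j)))
    (proj_map_diff_subproof Hy).

Lemma proj_mapE y (Hy : proj_family y) j (u : proj_cpx j) :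
  proj_map Hy j u = \sum_i (val u i : A) *: y j i.
Proof. by []. Qed.

Lemma chain_mapE (g : chain_map proj_cpx Y) j (u : proj_cpx j) :
  g j u = \sum_i (val u i : A) *: g j (proj_gen j i).
Proof.
rewrite {1}(proj_genE u) linear_sum; apply: eq_bigr => i _.
by rewrite linearZ_LR.
Qed.

Lemma proj_gen_idem j i : pidem i *: proj_gen j i = proj_gen j i.
Proof.
apply: val_inj; apply/ffunP => k; rewrite linearZ_LR !ffunE.
case: (k =P i) => [_|_] /=; last by rewrite scaler0.
by case: ifP => _; rewrite ?scaler0 // -[LHS]/(_ * _) pidemK.
Qed.

Lemma proj_gen_diff j i : pdeg i = j ->
  diff proj_cpx j (proj_gen j i) = \sum_k pmx i k *: proj_gen (j + 1) k.
Proof.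
move=> e; rewrite [LHS]proj_genE; apply: eq_bigr => k _; congr (_ *: _).
rewrite SubK ffunE (bigD1 i) //= ffunE eqxx e eqxx /= pmx_idl.
by rewrite big1 ?addr0 // => l ne; rewrite ffunE (negbTE ne) mul0r.
Qed.

(** Chain maps out of [proj_cpx] are the same as families of images of the
generators, and homotopies are families in degree one less. *)
Lemma chain_map_family (g : chain_map proj_cpx Y) :
  proj_family (fun j i => g j (proj_gen j i)).
Proof.
move=> j i e; rewrite -cmap_diff proj_gen_diff // linear_sum scaler_sumr.
by apply: eq_bigr => k _; rewrite linearZ_LR scalerA pmx_idl.
Qed.

Lemma proj_homotopicP (g h : chain_map proj_cpx Y) :
  homotopic g h <-> exists k : forall j, I -> Y j, forall j i, pdeg i = j + 1 ->
   g (j + 1) (proj_gen (j + 1) i) - h (j + 1) (proj_gen (j + 1) i) =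
   pidem i *: (diff Y j (k j i)) + \sum_l pmx i l *: k (j + 1) l.
Proof.
split=> [[k H]|[k H]].
  exists (fun j i => k j (proj_gen (j + 1) i)) => j i e.
  rewrite H -{1}proj_gen_idem !linearZ_LR; congr (_ + _).
  rewrite proj_gen_diff // linear_sum; apply: eq_bigr => l _.
  by rewrite linearZ_LR.
exists (fun j => mk_linear (@proj_map_linear (j + 1) (Y j) (k j))) => j u.
rewrite chain_mapE [h _ _]chain_mapE -sumrB.
transitivity (\sum_i (val u i : A) *: (diff Y j (k j i)) +
  \sum_i (val u i : A) *: \sum_l pmx i l *: k (j + 1) l); last first.
  congr (_ + _); last exact/esym/proj_map_diff.
  by rewrite /mk_linear linear_sum; apply: eq_bigr => i _; rewrite linearZ_LR.
rewrite -big_split /=; under eq_bigr => i _ do rewrite -scalerBr.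
under [RHS]eq_bigr => i _ do rewrite -scalerDr.
apply: proj_sum_idem => i e; rewrite H // !scalerDr scalerA pidemK.
by congr (_ + _).
Qed.

Lemma family_update (T : int -> Type) (y : forall j, T j) j0 (t : T j0) :
  exists y' : forall j, T j, y' j0 = t /\ forall j, j != j0 -> y' j = y j.
Proof.
exists (fun j => if j0 =P j is ReflectT e then eq_rect j0 T t j e else y j).
split=> [|j ne]; first by case: eqP => // e; rewrite (Prop_irrelevance e erefl).
by case: eqP => // e; rewrite e eqxx in ne.
Qed.

(** The homotopy is chosen from the top degree down, since the differential of
a generator involves generators of the next degree: there the element to be
hit is a cycle, hence a boundary. *)
Lemma proj_null_homotopic (g : chain_map proj_cpx Y) :
  acyclic Y -> homotopic g (chain_zero _ Y).
Proof.
move=> acY; apply/proj_homotopicP; pose c j i := g j (proj_gen j i).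
have cd := chain_map_family g.
suff [k Hk] : exists k : forall j, I -> Y j, forall j i, pdeg i = j + 1 ->
    c (j + 1) i = diff Y j (k j i) + \sum_l pmx i l *: k (j + 1) l.
  exists k => j i e; rewrite subr0 -proj_gen_idem linearZ_LR.
  rewrite -[g _ _]/(c _ _) Hk // scalerDr; congr (_ + _); rewrite scaler_sumr.
  by apply: eq_bigr => l _; rewrite scalerA pmx_idl.
pose b := proj_bound.
have/(_ (b + b.+1)%N)[k Hk] : forall m : nat, exists k : forall j, I -> Y j,
    forall j i, (b%:Z - m%:Z <= j) -> pdeg i = j + 1 ->
    c (j + 1) i = diff Y j (k j i) + \sum_l pmx i l *: k (j + 1) l; last first.
  exists k => j i e; apply: Hk => //; have := proj_boundP i; rewrite e -/b.
  by lia.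
elim=> [|m [k Hk]].
  exists (fun _ _ => 0) => j i lej e; have := proj_boundP i; rewrite e -/b.
  by lia.
pose j0 : int := b%:Z - m.+1%:Z.
have step i : exists t : Y j0, pdeg i = j0 + 1 ->
    c (j0 + 1) i = diff Y j0 t + \sum_l pmx i l *: k (j0 + 1) l.
  have [e|ne] := eqVneq (pdeg i) (j0 + 1); last by exists 0 => /eqP; rewrite (negbTE ne).
  have [|t et] := acY j0 (c (j0 + 1) i - \sum_l pmx i l *: k (j0 + 1) l).
    rewrite linearB linear_sum /c -{1}proj_gen_idem linearZ_LR linearZ_LR cd //.
    rewrite -sumrB.
    under eq_bigr => l _ do rewrite linearZ_LR -scalerBr.
    have E l : pmx i l *: (c (j0 + 1 + 1) l - diff Y (j0 + 1) (k (j0 + 1) l)) =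
        pmx i l *: \sum_l' pmx l l' *: k (j0 + 1 + 1) l'.
      have [el|nel] := eqVneq (pdeg l) (pdeg i + 1); last first.
        by rewrite pmx_deg // !scale0r.
      rewrite Hk ?el ?e //; first by rewrite [X in _ *: (X - _)]addrC addrK.
      by rewrite /j0; lia.
    under eq_bigr => l _ do rewrite E scaler_sumr.
    rewrite exchange_big; apply: big1 => l' _.
    under eq_bigr => l _ do rewrite scalerA.
    by rewrite -scaler_suml pmxK scale0r.
  by exists t => _; rewrite -et subrK.
have [t Ht] := choice step.
have [k' [k'0 k'n]] := family_update k t.
exists k' => j i lej e; have [ej|nej] := eqVneq j j0.
  rewrite ej in e *; rewrite k'0 k'n; first exact: Ht.
  by lia.
rewrite k'n // k'n; last by lia.
by apply: Hk => //; rewrite /j0 in nej; lia.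
Qed.

End Maps.

Definition proj_shift_data : proj_data.
Proof.
exists I (fun i => pdeg i - 1) (@pidem p) (fun i k => - pmx i k).
- exact: pidemK.
- by move=> i k; rewrite mulrN pmx_idl.
- by move=> i k; rewrite mulNr pmx_idr.
- by move=> i k ne; rewrite pmx_deg ?oppr0 //; apply: contraNneq ne => ->; lia.
move=> i l; under eq_bigr => k _ do rewrite mulrNN.
exact: pmxK.
Defined.

End Construction.

Definition chain_isomorphic (X Y : bcomplex A) : Prop :=
  exists (f : chain_map X Y) (g : chain_map Y X),
    (forall i x, g i (f i x) = x) /\ (forall i y, f i (g i y) = y).

Lemma chain_isomorphic_trans X Y Z : chain_isomorphic X Y ->
  chain_isomorphic Y Z -> chain_isomorphic X Z.
Proof.
move=> [f [f' [e1 e2]]] [g [g' [e3 e4]]].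
exists (chain_comp g f), (chain_comp f' g').
by split=> i x /=; rewrite ?e3 ?e1 ?e2 ?e4.
Qed.

Lemma chain_isomorphic_shift X Y : chain_isomorphic X Y ->
  chain_isomorphic (cpx_shift X) (cpx_shift Y).
Proof.
move=> [f [f' [e1 e2]]]; exists (chain_shift f), (chain_shift f').
by split=> i x /=; rewrite ?e1 ?e2.
Qed.

Section ShiftIso.
Variable p : proj_data.
Local Notation q := (proj_shift_data p).

Lemma proj_shift_sub j (u : proj_term p (j + 1)) : val u \in @proj_pred q j.
Proof.
apply/proj_predP; split=> i; first exact: proj_idem.
by move=> ne; apply: proj_out; apply: contraNneq ne => /= ->; rewrite addrK.
Qed.

Lemma proj_unshift_sub j (u : proj_term q j) : val u \in @proj_pred p (j + 1).
Proof.
apply/proj_predP; split=> i; first exact: (proj_idem u).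
move=> ne; apply: (proj_out u); apply: contraNneq ne => /= <-.
by rewrite subrK.
Qed.

Definition proj_shift_fun j (u : proj_term p (j + 1)) : proj_term q j :=
  Sub (val u) (proj_shift_sub u).

Definition proj_unshift_fun j (u : proj_term q j) : proj_term p (j + 1) :=
  Sub (val u) (proj_unshift_sub u).

Lemma proj_shift_linear j : linear (@proj_shift_fun j).
Proof. by move=> c u v; apply: val_inj. Qed.

Lemma proj_unshift_linear j : linear (@proj_unshift_fun j).
Proof. by move=> c u v; apply: val_inj. Qed.

Lemma proj_shift_iso : chain_isomorphic (proj_cpx q) (cpx_shift (proj_cpx p)).
Proof.
have sd j (u : proj_term p (j + 1)) :
    proj_shift_fun (shift_diff_fun (X := proj_cpx p) u) =
    proj_diff_fun (proj_shift_fun u).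
  apply: val_inj; apply/ffunP => k; rewrite !ffunE -sumrN.
  by apply: eq_bigr => i _; rewrite mulrN.
have ud j (u : proj_term q j) : proj_unshift_fun (proj_diff_fun u) =
    shift_diff_fun (X := proj_cpx p) (proj_unshift_fun u).
  apply: val_inj; apply/ffunP => k; rewrite !ffunE -sumrN.
  by apply: eq_bigr => i _; rewrite mulrN.
exists (@ChainMap A (proj_cpx q) (cpx_shift (proj_cpx p))
  (fun j => mk_linear (@proj_unshift_linear j)) ud).
exists (@ChainMap A (cpx_shift (proj_cpx p)) (proj_cpx q)
  (fun j => mk_linear (@proj_shift_linear j)) sd).
by split=> j u; apply: val_inj.
Qed.

End ShiftIso.

Lemma iter_shift_proj n p : exists q,
  chain_isomorphic (proj_cpx q) (iter n (@cpx_shift A) (proj_cpx p)).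
Proof.
elim: n => [|n [q H]].
  by exists p; exists (chain_id _), (chain_id _).
exists (proj_shift_data q); apply: chain_isomorphic_trans (proj_shift_iso q) _.
exact: chain_isomorphic_shift.
Qed.

Lemma hprojective_proj p : hprojective (proj_cpx p).
Proof.
move=> n C acC g; have [q [f [f' [e1 e2]]]] := iter_shift_proj n p.
have := homotopic_compr f' (proj_null_homotopic (chain_comp g f) acC).
move=> /(homotopic_trans _) H; apply: homotopic_trans (H _ _) _.
  by apply: ext_homotopic => i x /=; rewrite e2.
exact: ext_homotopic.
Qed.

End ProjectiveComplexes.

(** * Projectives given by idempotents *)

Section IdempotentProjectives.
Variable A : pzRingType.
Variables (e : A) (ee : e * e = e).

Definition idem_data : proj_data A.
Proof.
exists unit (fun _ => 0) (fun _ => e) (fun _ _ => 0) => //.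
- by move=> *; rewrite mulr0.
- by move=> *; rewrite mul0r.
by move=> *; apply: big1 => *; rewrite mul0r.
Defined.

Definition idem_cpx := proj_cpx idem_data.

Definition idem_gen : idem_cpx 0 := @proj_gen A idem_data 0 tt.

Lemma idem_cpx_out j (u : idem_cpx j) : j != 0 -> u = 0.
Proof.
move=> ne; apply: val_inj; apply/ffunP => i.
by rewrite (proj_out u) /= ?linear0 ?ffunE // eq_sym.
Qed.

Lemma idem_map_ext Y (f g : chain_map idem_cpx Y) :
  f 0 idem_gen = g 0 idem_gen -> forall j u, f j u = g j u.
Proof.
move=> E j u; have [ej|ne] := eqVneq j 0; last first.
  by rewrite (idem_cpx_out u ne) !linear0.
move: u; rewrite ej => u; rewrite !chain_mapE; apply: eq_bigr => -[] _.
by congr (_ *: _).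
Qed.

Lemma idem_map (Y : bcomplex A) (y : Y 0) : diff Y 0 y = 0 ->
  exists f : chain_map idem_cpx Y, f 0 idem_gen = e *: y.
Proof.
move=> dy; have [y' [y'0 y'n]] := family_update (fun j => 0 : Y j) y.
have F : @proj_family A idem_data Y (fun j _ => y' j).
  move=> j i /= ej; rewrite big1 => [|k _]; last by rewrite scale0r.
  by rewrite -ej y'0 dy scaler0.
exists (proj_map F); rewrite proj_mapE (bigD1 tt) //= big1 => [|[]//].
by rewrite addr0 y'0 ffunE.
Qed.

End IdempotentProjectives.

Lemma iter_shift_zero (A : pzRingType) (X : bcomplex A) (m : int) n :
  (forall j, m < j -> forall x : X j, x = 0) ->
  forall j, m - n%:Z < j -> forall x : iter n (@cpx_shift A) X j, x = 0.
Proof.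
move=> H; elim: n => [|n IHn] j /= ltj; first by apply: H; lia.
by apply: IHn; lia.
Qed.

Section IncidenceFamily.
Variables (K : fieldType) (A : kalgebra K) (I : Type) (z : rel I).
Variable e : I -> A.
Hypothesis ee : forall x, e x * e x = e x.
Hypothesis e0 : forall x y, ~~ z x y -> forall a, e x * a * e y = 0.
Hypothesis e1 : forall x y, z x y -> exists c : A, [/\ e x * c * e y = c, c != 0
  & forall a, exists k, e x * a * e y = kscalar A k * c].
Hypothesis exx : forall x a, exists k, e x * a * e x = kscalar A k * e x.

Local Notation P x := (idem_cpx (ee x)).
Local Notation DA := (derived_cat A).

Let hP x : hprojective (P x).
Proof. exact: hprojective_proj. Qed.

(** The value at the generator identifies the chain maps P_x -> P_y with the
block e_x A e_y; composition is reversed. *)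
Let coef x y (g : chain_map (P x) (P y)) : A := val (g 0 (idem_gen (ee x))) tt.

Let coefE x y (g : chain_map (P x) (P y)) : e x * coef g * e y = coef g.
Proof.
have /= := proj_idem (g 0 (idem_gen (ee x))) tt; rewrite -/(coef g) -mulrA => ->.
have E : e x *: g 0 (idem_gen (ee x)) = g 0 (idem_gen (ee x)).
  by rewrite -linearZ_LR (@proj_gen_idem _ (idem_data (ee x))).
by have := congr1 (fun u : P y 0 => val u tt) E; rewrite /= ffunE.
Qed.

Let coef_ext x y (g g' : chain_map (P x) (P y)) :
  coef g = coef g' -> deq (DMap g) (DMap g').
Proof.
move=> E; apply: deq_map => i u; apply: idem_map_ext; apply: val_inj.
by apply/ffunP => -[].
Qed.

Let coef_map x y (a : A) : exists g : chain_map (P x) (P y),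
  coef g = e x * a * e y.
Proof.
have H : [ffun _ => a * e y] \in @proj_pred A (idem_data (ee y)) 0.
  by apply/proj_predP; split=> i; rewrite ffunE //= -mulrA ee.
pose u : proj_term (idem_data (ee y)) 0 := proj_mk H.
have [|g Hg] := @idem_map A (e x) (ee x) (P y) u; first exact: idem_cpx_out.
by exists g; rewrite /coef Hg /= !ffunE; apply: mulrA.
Qed.

Let coef_comp x y w (g : chain_map (P y) (P w)) (f : chain_map (P x) (P y)) :
  coef (chain_comp g f) = coef f * coef g.
Proof.
rewrite /coef /=; set u := f 0 _.
rewrite chain_mapE (bigD1 tt) //= big1 => [|[]//]; rewrite addr0.
by rewrite ffunE.
Qed.

(** Between P_x and a proper shift of P_y there are no chain maps but zero,
because they live in different degrees, and chain maps suffice because P_x is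
projective. *)
Lemma idem_incidence_family :
  @incidence_family (bounded_derived_category A) I z (fun x => P x).
Proof.
have low x j : 0 < j -> forall u : P x j, u = 0.
  by move=> lt0j u; apply: idem_cpx_out; lia.
split.
- move=> x y k u v.
  have [f Hf] := hprojective_full (@hP x) u; have [g Hg] := hprojective_full (@hP x) v.
  apply: deq_trans Hf _; apply: deq_trans (deq_sym Hg); apply: deq_map => i w.
  apply: idem_map_ext.
  have L := @iter_shift_zero A (P y) 0 k.+1 (low y) 0.
  by rewrite (L _ (f 0 _)) ?(L _ (g 0 _)) //; lia.
- move=> x y k u v; have hs n : hprojective (iter n (@cpx_shift A) (P x)).
    by elim: n => [|n] /=; [apply: hP | apply: hprojective_shift].
  have [f Hf] := hprojective_full (@hs k.+1) u.
  have [g Hg] := hprojective_full (@hs k.+1) v.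
  apply: deq_trans Hf _; apply: deq_trans (deq_sym Hg); apply: deq_map => i w.
  have [lti|] := ltrP i 0; first by rewrite (idem_cpx_out (f i w)) ?(idem_cpx_out (g i w)) //; lia.
  move=> le0i; have L := @iter_shift_zero A (P x) 0 k.+1 (low x) i.
  by rewrite (L _ w) ?linear0 //; lia.
- move=> x y zxy u v.
  have [f Hf] := hprojective_full (@hP x) u; have [g Hg] := hprojective_full (@hP x) v.
  apply: deq_trans Hf _; apply: deq_trans (deq_sym Hg); apply: coef_ext.
  by rewrite -[LHS]coefE -[RHS]coefE !e0.
- move=> x y /e1[c [ec _ Hc]]; have [g Hg] := coef_map x y c.
  exists (DMap g) => u; have [f Hf] := hprojective_full (@hP x) u.
  have [k Hk] := Hc (coef f); have [w Hw] := coef_map x x (kscalar A k).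
  exists (DMap w); apply: deq_trans Hf _; apply: deq_trans (deq_comp _ _).
  apply: coef_ext; rewrite coef_comp Hw Hg ec -[LHS]coefE Hk.
  have exc : e x * c = c by rewrite -ec !mulrA ee.
  by rewrite -kscalar_central -!mulrA !exc.
- move=> x y /e1[c [ec c0 _]] T; have [g Hg] := coef_map x y c.
  have [g0 Hg0] := coef_map x y 0.
  have /(hprojective_faithful (@hP x))/proj_homotopicP := T (DMap g) (DMap g0).
  case=> k /(_ (- 1) tt (esym (addNr 1))) H.
  have k0 : k (- 1) tt = 0 by apply: idem_cpx_out.
  rewrite k0 linear0 scaler0 add0r big1 in H; last by move=> *; rewrite scale0r.
  have {H}: coef g = coef g0.
    apply: (congr1 (fun u : P y 0 => val u tt)); apply/eqP.
    by rewrite -subr_eq0; apply/eqP; exact: H.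
  by rewrite Hg Hg0 ec mulr0 mul0r => /eqP; rewrite (negbTE c0).
move=> x u; have [f Hf] := hprojective_full (@hP x) u.
have [k Hk] := exx x (coef f); rewrite coefE in Hk.
have [k0|k0] := eqVneq k 0.
  right=> v w; have [v' Hv] := hprojective_full (@hP x) v.
  have [w' Hw] := hprojective_full (@hP x) w.
  apply: deq_trans (deq_cong Hf Hv) _; apply: deq_trans (deq_sym (deq_cong Hf Hw)).
  apply: deq_trans (deq_sym (deq_comp _ _)) _; apply: deq_trans (deq_comp _ _).
  by apply: coef_ext; rewrite !coef_comp Hk k0 rmorph0 mul0r !mulr0.
left; have [g Hg] := coef_map x x (kscalar A k^-1).
have Eid : coef (chain_id (P x)) = e x by rewrite /coef /= ffunE.
have eke a : e x * kscalar A a * e x = kscalar A a * e x.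
  by rewrite -kscalar_central -mulrA ee.
have kM a b : kscalar A a * e x * (kscalar A b * e x) = kscalar A (a * b) * e x.
  by rewrite -mulrA (mulrA (e x)) eke mulrA -rmorphM.
exists (DMap g); split.
  apply: deq_trans (deq_cong (deq_refl _) Hf) _.
  apply: deq_trans (deq_sym (deq_comp _ _)) _; apply: coef_ext.
  by rewrite coef_comp Hk Hg Eid eke kM mulfV // rmorph1 mul1r.
apply: deq_trans (deq_cong Hf (deq_refl _)) _.
apply: deq_trans (deq_sym (deq_comp _ _)) _; apply: coef_ext.
by rewrite coef_comp Hk Hg Eid eke kM mulVf // rmorph1 mul1r.
Qed.

End IncidenceFamily.

(** * Path algebras by generators *)

(** What is used of a finite-dimensional path algebra.  [pres_ind] says that it
is generated by the vertices and arrows, and [pres_free] that there are no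
relations: the equation of its hypothesis expresses the coefficient of a path
q in the z's by coefficients of longer paths q a. *)
Record presentation (K : fieldType) (Q : quiver) (B : kalgebra K) := Presentation {
  pres_e : vertex Q -> B;
  pres_a : arrow Q -> B;
  pres_ee : forall v w, pres_e v * pres_e w = if v == w then pres_e v else 0;
  pres_1 : \sum_v pres_e v = 1;
  pres_ea : forall a, pres_e (tgt a) * pres_a a = pres_a a;
  pres_ae : forall a, pres_a a * pres_e (src a) = pres_a a;
  pres_ind : forall P : B -> Prop, P 0 ->
    (forall k x y, P x -> P y -> P (kscalar B k * x + y)) ->
    (forall v, P (pres_e v)) -> (forall a x, P x -> P (pres_a a * x)) ->
    forall x, P x;
  pres_free : forall (N : nat) (z : arrow Q -> 'I_N -> B)
    (c : arrow Q -> 'I_N -> 'I_N -> K),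
    (forall a i, z a i * pres_e (tgt a) = z a i) ->
    (forall k, \sum_a z a k * pres_a a =
       \sum_a \sum_i kscalar B (c a i k) * z a i) ->
    forall a i, z a i = 0;
  pres_fd : exists (n : nat) (b : 'I_n -> B), forall x,
    exists c : 'I_n -> K, x = \sum_i kscalar B (c i) * b i
}.

Definition finitely_many_paths (Q : quiver) : Prop :=
  exists s : seq (qpath Q), forall p, p \in s.

Section PathAlgebraPresentation.
Variables (K : fieldType) (Q : quiver).
Local Notation PA := (path_algebra K Q).
Local Notation bas := (basis_elt K).

Definition arrow_path (a : arrow Q) : qpath Q.
Proof. by exists (src a) [:: a]; rewrite /= eqxx. Defined.

Lemma path_kscalarE k (x : path_kalgebra K Q) : kscalar (path_kalgebra K Q) k * x = k *: (x : PA).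
Proof.
exact: etrans (esym (path_scaleAl k (1 : PA) x)) (congr1 _ (mul1r (x : PA))).
Qed.

Lemma bas_mul (p q : qpath Q) : (bas p : PA) * bas q = basis_mul K p q.
Proof. exact: path_mul_basis. Qed.

Lemma bas_mul_comp (p q r : qpath Q) : ptgt q = psrc p -> psrc r = psrc q ->
  parrows r = parrows q ++ parrows p -> (bas p : PA) * bas q = bas r.
Proof.
move=> e sr ar; rewrite bas_mul /basis_mul.
have [r' [-> sr' _ ar']] := pcompP e; congr bas; apply: qpath_eq.
  by rewrite sr' sr.
by rewrite ar' ar.
Qed.

Lemma bas_mul0 (p q : qpath Q) : ptgt q != psrc p -> (bas p : PA) * bas q = 0.
Proof. by move=> ne; rewrite bas_mul /basis_mul pcompN. Qed.

Definition path_behead (p : qpath Q) : qpath Q :=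
  match p with QPath x s w =>
    match s return walk x s -> qpath Q with
    | [::] => fun _ => trivial_path x
    | a :: s' => fun w => QPath (proj2 (andP w))
    end w
  end.

(** A one-sided inverse of right multiplication by the arrow a, which shortens
every path. *)
Definition unarrow (a : arrow Q) : PA -> PA := lin_ext (fun p =>
  if ohead (parrows p) == Some a then bas (path_behead p) else 0).

HB.instance Definition _ a := GRing.isLinear.Build K PA PA *:%R (unarrow a)
  (lin_ext_is_linear _).

Lemma unarrowE a p : unarrow a (bas p) =
  if ohead (parrows p) == Some a then bas (path_behead p) else 0.
Proof. exact: lin_ext_basis. Qed.

Lemma unarrow_mul a b (x : PA) : unarrow b (x * bas (arrow_path a)) =
  if a == b then x * bas (trivial_path (tgt a)) else 0.
Proof.
elim/path_algebra_ind: x => [|k x y IHx IHy|p].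
- by rewrite !mul0r linear0; case: ifP.
- rewrite !mulrDl -!path_scaleAl linearP /= IHx IHy.
  by case: ifP; rewrite // scaler0 addr0.
have [e|ne] := eqVneq (tgt a) (psrc p); last first.
  by rewrite !bas_mul0 // linear0; case: ifP.
have [r [er sr tr ar]] := @pcompP _ p (arrow_path a) e.
rewrite (bas_mul_comp (r := r)) // unarrowE ar /= -[Some a == _]/(a == b).
case: ifP => // _; rewrite (bas_mul_comp (r := p)) //; congr bas.
case: r ar {er sr tr} => x [|c s] //= w [ec es].
by apply: qpath_eq => //=; rewrite ec.
Qed.

(** The paths occurring in x have length less than L. *)
Fixpoint short (L : nat) (x : PA) : Prop :=
  if L is L'.+1 then forall a, short L' (unarrow a x) else x = 0.

Lemma short0 L : short L 0.
Proof.
elim: L => [|L IHL]; first exact: erefl.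
move=> a; rewrite (linear0 (unarrow a)); exact: IHL.
Qed.

Lemma short_lin L k x y : short L x -> short L y -> short L (k *: x + y).
Proof.
elim: L x y => [|L IHL] x y /=; first by move=> -> ->; rewrite scaler0 addr0.
by move=> Hx Hy a; rewrite (linearP (unarrow a)); apply: IHL; [apply: Hx | apply: Hy].
Qed.

Lemma short_sum L (J : finType) (c : J -> K) (x : J -> PA) :
  (forall j, short L (x j)) -> short L (\sum_j c j *: x j).
Proof.
move=> H; elim/big_rec: _ => [|j y _ Hy]; first exact: short0.
exact: short_lin.
Qed.

Lemma short_leq L M x : (L <= M)%N -> short L x -> short M x.
Proof.
elim: L M x => [|L IHL] [|M] x //= leLM; first by move=> -> a; rewrite linear0; apply: short0.
by move=> H a; apply: IHL.
Qed.

Lemma short_ex x : exists L, short L x.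
Proof.
elim/path_algebra_ind: x => [|k x y [L HL] [M HM]|p]; first by exists 0%N.
  exists (maxn L M); apply: short_lin; apply: short_leq; [|exact: HL| |exact: HM].
    exact: leq_maxl.
  exact: leq_maxr.
exists (size (parrows p)).+1.
case: p => x s; elim: s x => [|a s IHs] x w b; rewrite unarrowE /=.
  by [].
by case: ifP => _; [apply: IHs | apply: (short0 _.+1)].
Qed.

(** The equation expresses every z b k through shortened elements z a i, and
an element cannot be shortened forever. *)
Lemma path_free (N : nat) (z : arrow Q -> 'I_N -> PA)
    (c : arrow Q -> 'I_N -> 'I_N -> K) :
  (forall a i, z a i * bas (trivial_path (tgt a)) = z a i) ->
  (forall k, \sum_a z a k * bas (arrow_path a) = \sum_a \sum_i c a i k *: z a i) ->
  forall a i, z a i = 0.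
Proof.
move=> ze zE.
have rec b k : z b k = \sum_a \sum_i c a i k *: unarrow b (z a i).
  have -> : z b k = \sum_a unarrow b (z a k * bas (arrow_path a)).
    under eq_bigr => a _ do rewrite unarrow_mul ze.
    by rewrite -big_mkcond big_pred1_eq.
  rewrite -linear_sum zE linear_sum.
  apply: eq_bigr => a _; rewrite linear_sum; apply: eq_bigr => i _.
  by rewrite linearZ_LR.
have [L HL] : exists L, forall a i, short L (z a i).
  have [f Hf] := choice (fun ai => short_ex (z ai.1 ai.2)).
  exists (\max_ai f ai) => a i; apply: short_leq (Hf (a, i)).
  exact: (leq_bigmax (F := f)).
elim: L HL => [|L IHL] // HL; apply: IHL => b k; rewrite rec.
have -> : \sum_a \sum_i c a i k *: unarrow b (z a i) =
    \sum_a 1 *: \sum_i c a i k *: unarrow b (z a i).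
  by apply: eq_bigr => a _; rewrite scale1r.
by apply: short_sum => a; apply: short_sum => i; apply: HL.
Qed.

Lemma path_ind (P : PA -> Prop) : P 0 ->
  (forall k x y, P x -> P y -> P (k *: x + y)) ->
  (forall v, P (bas (trivial_path v))) ->
  (forall a x, P x -> P (bas (arrow_path a) * x)) -> forall x, P x.
Proof.
move=> P0 PD Pv Pa; apply: path_algebra_ind => // -[x s].
elim/last_ind: s => [|s a IHs] w.
  suff -> : QPath w = trivial_path x by [].
  exact: qpath_eq.
have : walk x s && walk (walk_end x s) [:: a] by rewrite -walk_cat cats1.
case/andP=> ws /= /andP[/eqP es _].
have := Pa a _ (IHs ws).
by rewrite (bas_mul_comp (r := QPath w)) //= -?cats1.
Qed.

Variables (B : kalgebra K).

Lemma presentation_iso : alg_isomorphic (path_kalgebra K Q) B ->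
  finitely_many_paths Q -> inhabited (presentation Q B).
Proof.
move=> [phi [[psi psiK phiK] phik]] [s Hs].
have phiZ k (x : PA) : phi (k *: x) = kscalar B k * phi x.
  by rewrite -path_kscalarE rmorphM phik.
have inj := can_inj psiK.
constructor; exists (fun v => phi (bas (trivial_path v)))
  (fun a => phi (bas (arrow_path a))).
- move=> v w; rewrite -rmorphM.
  case: eqVneq => [->|ne]; last by rewrite bas_mul0 ?rmorph0 //= eq_sym.
  by congr (phi _); apply: bas_mul_comp.
- by rewrite -rmorph_sum -(rmorph1 phi).
- by move=> a; rewrite -rmorphM; congr (phi _); apply: bas_mul_comp.
- by move=> a; rewrite -rmorphM; congr (phi _); apply: bas_mul_comp.
- move=> P P0 PD Pv Pa x; rewrite -[x]phiK.
  elim/path_ind: (psi x) => [|k y z|v|a y] *.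
  + by rewrite rmorph0.
  + by rewrite rmorphD phiZ; apply: PD.
  + exact: Pv.
  + by rewrite rmorphM; apply: Pa.
- move=> N z c ze zE a i; rewrite -[z a i]phiK.
  have zphi b k : z b k = phi (psi (z b k)) by rewrite phiK.
  rewrite (@path_free N (fun a i => psi (z a i)) c) ?rmorph0 //.
    by move=> b k; apply: inj; rewrite rmorphM phiK ze.
  move=> k; apply: inj; rewrite !rmorph_sum.
  under eq_bigr => b _ do rewrite rmorphM phiK.
  rewrite zE; apply: eq_bigr => b _; rewrite rmorph_sum.
  by apply: eq_bigr => j _; rewrite phiZ phiK.
exists (size s), (fun i => phi (bas (tnth (in_tuple s) i))) => x.
rewrite -[x]phiK; elim/path_algebra_ind: (psi x) => [|k y z [c Hc] [d Hd]|p].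
- exists (fun _ => 0); rewrite rmorph0 big1 // => i _.
  by rewrite rmorph0 mul0r.
- exists (fun i => k * c i + d i); rewrite rmorphD phiZ Hc Hd mulr_sumr.
  rewrite -big_split; apply: eq_bigr => i _ /=.
  by rewrite rmorphD rmorphM mulrDl mulrA.
have /tnthP[i ei] : p \in in_tuple s by apply: Hs.
exists (fun j => (j == i)%:R); rewrite (bigD1 i) //= eqxx rmorph1 mul1r -ei.
by rewrite big1 ?addr0 // => j ne; rewrite (negbTE ne) rmorph0 mul0r.
Qed.

End PathAlgebraPresentation.

(** * Graded bases of complexes *)

Section Bases.
Variables (K : fieldType) (B : kalgebra K).
Local Notation ks := (kscalar B).

Definition in_span (M : lmodType B) (J : finType) (b : J -> M) (x : M) : Prop :=
  exists c : J -> K, x = \sum_i ks (c i) *: b i.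

Definition free_family (M : lmodType B) (J : finType) (b : J -> M) : Prop :=
  forall c : J -> K, \sum_i ks (c i) *: b i = 0 -> forall i, c i = 0.

Section Span.
Variables (M : lmodType B) (J : finType) (b : J -> M).

Lemma in_span_lin k x y :
  in_span b x -> in_span b y -> in_span b (ks k *: x + y).
Proof.
move=> [c ->] [d ->]; exists (fun i => k * c i + d i).
rewrite scaler_sumr -big_split; apply: eq_bigr => i _ /=.
by rewrite rmorphD rmorphM scalerDl scalerA.
Qed.

Lemma in_span0 : in_span b 0.
Proof. by exists (fun _ => 0); rewrite big1 // => i _; rewrite rmorph0 scale0r. Qed.

Lemma in_span_mem i : in_span b (b i).
Proof.
exists (fun j => (j == i)%:R); rewrite (bigD1 i) //= eqxx rmorph1 scale1r.
by rewrite big1 ?addr0 // => j /negbTE ->; rewrite rmorph0 scale0r.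
Qed.

Lemma in_span_trans (J' : finType) (w : J' -> M) x :
  (forall i, in_span b (w i)) -> in_span w x -> in_span b x.
Proof.
move=> H [c ->]; elim/big_rec: _ => [|i y _ Hy]; first exact: in_span0.
exact: in_span_lin.
Qed.

End Span.

Lemma extract_basis (M : lmodType B) n (w : 'I_n -> M) :
  exists N (b : 'I_N -> M), [/\ forall i, exists k, b i = w k,
    forall k, in_span b (w k) & free_family b].
Proof.
elim: n w => [|n IHn] w.
  by exists 0%N, w; split=> [|[]|c _ []] // i; exists i.
have [F|] := pselect (free_family w).
  by exists n.+1, w; split=> // i; [exists i | apply: in_span_mem].
move=> /existsNP[c /not_implyP[c0 /existsNP[i0 /eqP ci0]]].
have [N [b [bw wb fb]]] := IHn (w \o lift i0); exists N, b; split=> // [i|k].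
  by have [k ->] := bw i; exists (lift i0 k).
have [j ->|->] := unliftP i0 k; first exact: wb.
apply: (in_span_trans wb); exists (fun j => - c (lift i0 j) / c i0).
have := c0; rewrite (bigD1_ord i0) //= => /eqP; rewrite addr_eq0 => /eqP E.
apply: (@can_inj _ _ ( *:%R (ks (c i0))) ( *:%R (ks (c i0)^-1))).
  by move=> x; rewrite scalerA -rmorphM mulVf // rmorph1 scale1r.
rewrite E scaler_sumr -sumrN; apply: eq_bigr => j _.
by rewrite scalerA -rmorphM mulrC mulfVK // rmorphN scaleNr.
Qed.

End Bases.

Section Models.
Variables (K : fieldType) (Q : quiver) (B : kalgebra K) (pp : presentation Q B).
Local Notation ks := (kscalar B).
Local Notation e := (pres_e pp).
Local Notation ar := (pres_a pp).

Lemma ksC k (M : lmodType B) (b : B) (x : M) : b *: (ks k *: x) = ks k *: (b *: x).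
Proof. by rewrite !scalerA kscalar_central. Qed.

Lemma vertex_basis (M : lmodType B) v : fin_gen M ->
  exists N (b : 'I_N -> M), [/\ forall i, e v *: b i = b i,
    forall x, e v *: x = x -> in_span b x & free_family b].
Proof.
case=> n [g Hg]; have [m [a Ha]] := pres_fd pp.
pose w (k : 'I_#|{: 'I_m * 'I_n}|) := e v *: (a (enum_val k).1 *: g (enum_val k).2).
have [N [b [bw wb fb]]] := extract_basis w; exists N, b; split=> // [i|x ex].
  by have [k ->] := bw i; rewrite /w scalerA pres_ee eqxx.
apply: (in_span_trans wb); have [c Hc] := Hg x.
have [d Hd] := choice (fun i => Ha (c i)).
exists (fun k => d (enum_val k).2 (enum_val k).1).
rewrite -ex Hc /w (reindex (@enum_rank _)) /=; last first.
  by apply: onW_bij; exact: enum_rank_bij.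
under [RHS]eq_bigr => k _ do rewrite !enum_rankK.
rewrite -(pair_bigA _ (fun i j => ks (d j i) *: (e v *: (a i *: g j)))) /=.
rewrite exchange_big scaler_sumr; apply: eq_bigr => j _; rewrite Hd.
rewrite scaler_suml scaler_sumr; apply: eq_bigr => i _.
by rewrite -scalerA ksC.
Qed.

(** A graded K-basis of a complex, each element of which lives at a vertex. *)
Record model (X : bcomplex B) := Model {
  mN : nat;
  mdeg : 'I_mN -> int;
  mvtx : 'I_mN -> vertex Q;
  mbas : forall j, 'I_mN -> X j;
  mcrd : forall j, X j -> 'I_mN -> K;
  mbas_deg : forall j i, mdeg i != j -> mbas j i = 0;
  mbas_vtx : forall j i, e (mvtx i) *: mbas j i = mbas j i;
  mcrdE : forall j (x : X j), x = \sum_i ks (mcrd x i) *: mbas j i;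
  mcrd_deg : forall j (x : X j) i, mdeg i != j -> mcrd x i = 0;
  mfree : forall j (c : 'I_mN -> K), \sum_i ks (c i) *: mbas j i = 0 ->
    forall i, mdeg i = j -> c i = 0
}.

Lemma model_fin (X : bcomplex B) (J : finType) (deg : J -> int)
    (vtx : J -> vertex Q) (bas : forall j, J -> X j) :
  (forall j t, deg t != j -> bas j t = 0) ->
  (forall j t, e (vtx t) *: bas j t = bas j t) ->
  (forall j (x : X j), in_span (bas j) x) ->
  (forall j (c : J -> K), \sum_t ks (c t) *: bas j t = 0 ->
     forall t, deg t = j -> c t = 0) -> inhabited (model X).
Proof.
move=> Hd Hv Hs Hf.
have reidx j (c : J -> K) : \sum_t ks (c t) *: bas j t =
    \sum_(i < #|J|) ks (c (enum_val i)) *: bas j (enum_val i).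
  by rewrite (reindex (@enum_val _ J)) //; apply: onW_bij; exact: enum_val_bij.
have Hc j (x : X j) : exists c : 'I_#|J| -> K,
    x = \sum_i ks (c i) *: bas j (enum_val i) /\
    forall i, deg (enum_val i) != j -> c i = 0.
  have [c ->] := Hs j x.
  exists (fun i => if deg (enum_val i) == j then c (enum_val i) else 0); split.
    rewrite reidx; apply: eq_bigr => i _; case: eqVneq => // ne.
    by rewrite Hd // !scaler0.
  by move=> i /negbTE ->.
constructor; apply: (@Model X #|J| (deg \o enum_val) (vtx \o enum_val)
  (fun j i => bas j (enum_val i)) (fun j x => projT1 (cid (Hc j x)))) => /=.
- by move=> j i; apply: Hd.
- by move=> j i; apply: Hv.
- by move=> j x; case: (cid _) => c [].
- by move=> j x i; case: (cid _) => c [] /= _; apply.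
move=> j c; have := reidx j (c \o enum_rank).
under [X in _ = X -> _]eq_bigr => i _ do rewrite /= enum_valK.
move=> <- /Hf H i /H; by rewrite /= enum_valK.
Qed.

Lemma model_ex (X : bcomplex B) : inhabited (model X).
Proof.
have [n Hn] := term_bounded X.
pose H j v := cid (@vertex_basis (X j) v (term_fin_gen X j)).
pose N j v : nat := projT1 (H j v).
pose b0 j v : 'I_(N j v) -> X j := projT1 (cid (projT2 (H j v))).
have Hb j v : [/\ forall i, e v *: b0 j v i = b0 j v i,
    forall x, e v *: x = x -> in_span (b0 j v) x & free_family (b0 j v)].
  by rewrite /b0; case: (cid _) => b.
pose b j v (i : nat) : X j := oapp (b0 j v) 0 (insub i).
have bE j v (i : 'I_(N j v)) : b j v i = b0 j v i by rewrite /b valK.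
(* the degrees -n, ..., n, outside of which X vanishes *)
pose dg (k : 'I_(n + n).+1) : int := k%:Z - n%:Z.
pose J : finType := {t : 'I_(n + n).+1 * vertex Q & 'I_(N (dg t.1) t.2)}.
pose deg (t : J) := dg (tag t).1; pose vtx (t : J) := (tag t).2.
pose bas j (t : J) : X j := if deg t == j then b j (vtx t) (tagged t) else 0.
have dg_inj : injective dg by move=> k l; rewrite /dg => E; apply: val_inj => /=; lia.
pose tg k v (i : 'I_(N (dg k) v)) : J :=
  @Tagged _ (k, v) (fun t => 'I_(N (dg t.1) t.2)) i.
have basE k (c : J -> K) : \sum_t ks (c t) *: bas (dg k) t =
    \sum_v \sum_(i < N (dg k) v) ks (c (tg k v i)) *: b0 (dg k) v i.
  transitivity (\sum_(p : 'I_(n + n).+1 * vertex Q) \sum_(i < N (dg p.1) p.2)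
      ks (c (tg p.1 p.2 i)) *: bas (dg k) (tg p.1 p.2 i)).
    rewrite (@sig_big_dep _ 0 _ _ (fun t => 'I_(N (dg t.1) t.2)) predT
      (fun _ => predT) (fun p i => ks (c (tg p.1 p.2 i)) *: bas (dg k) (tg p.1 p.2 i))) /=.
    by apply: eq_bigr => -[[k' v] i] _.
  rewrite -(pair_bigA _ (fun k' v => \sum_(i < N (dg k') v)
    ks (c (tg k' v i)) *: bas (dg k) (tg k' v i))) /=.
  rewrite (bigD1 k) //= [X in _ + X]big1 ?addr0 => [|k' ne]; last first.
    apply: big1 => v _; apply: big1 => i _; rewrite /bas ifF ?scaler0 //.
    by apply: contra_neqF ne => /eqP/dg_inj.
  apply: eq_bigr => v _; apply: eq_bigr => i _.
  by rewrite /bas /deg /vtx /tg /= eqxx bE.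
have dgP j (x : X j) : x != 0 -> exists k, dg k = j.
  move=> x0; have lejn : (`|j| <= n)%N.
    by rewrite leqNgt; apply: contra_neqN x0 => /Hn.
  have ltk : (`|(j + n%:Z)%R| < (n + n).+1)%N by lia.
  by exists (Ordinal ltk); rewrite /dg /=; lia.
have Jbas_deg j (t : J) : deg t != j -> bas j t = 0 by rewrite /bas => /negbTE ->.
apply: (@model_fin X J deg vtx bas) => //.
- move=> j [[k v] i]; rewrite /bas; case: eqP => [<-|_]; last by rewrite scaler0.
  by rewrite /deg /vtx /= bE; have [-> _ _] := Hb (dg k) v.
- move=> j x; have [->|/dgP[k ek]] := eqVneq x 0; first exact: in_span0.
  subst j; have Hv v : in_span (b0 (dg k) v) (e v *: x).
    by have [_ H' _] := Hb (dg k) v; apply: H'; rewrite scalerA pres_ee eqxx.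
  have [c Hc] : exists c : forall v, 'I_(N (dg k) v) -> K, forall v,
      e v *: x = \sum_i ks (c v i) *: b0 (dg k) v i.
    by exists (fun v => projT1 (cid (Hv v))) => v; case: (cid _).
  exists (fun t : J => if (tag t).1 =P k is ReflectT E then
    c (tag t).2 (cast_ord (congr1 (fun k => N (dg k) (tag t).2) E) (tagged t)) else 0).
  rewrite basE -[LHS]scale1r -(pres_1 pp) scaler_suml.
  apply: eq_bigr => v _; rewrite Hc; apply: eq_bigr => i _; congr (ks _ *: _).
  rewrite /tg /=; case: eqP => // E; congr c; apply: val_inj => /=.
  by [].
move=> j c c0 t et; case: t et => [[k v] i] /= et.
have ej : dg k = j by exact: et.
subst j; move: c0; rewrite basE => c0; have [_ _ Hf] := Hb (dg k) v.
apply: (Hf (fun i => c (tg k v i))).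
have := congr1 ( *:%R (e v)) c0; rewrite scaler0 scaler_sumr (bigD1 v) //=.
rewrite [X in _ + X]big1 ?addr0 => [|w ne].
  move=> {2}<-; rewrite scaler_sumr; apply: eq_bigr => l _; rewrite ksC.
  by have [-> _ _] := Hb (dg k) v.
rewrite scaler_sumr big1 // => l _; rewrite ksC.
have [Hw _ _] := Hb (dg k) w; rewrite -(Hw l) [e v *: _]scalerA.
by rewrite pres_ee eq_sym (negbTE ne) scale0r scaler0.
Qed.

End Models.

(** * The standard resolution *)

Section Coordinates.
Variables (K : fieldType) (Q : quiver) (B : kalgebra K) (pp : presentation Q B).
Local Notation ks := (kscalar B).
Local Notation e := (pres_e pp).
Local Notation ar := (pres_a pp).
Variables (X : bcomplex B) (m : model pp X).
Local Notation N := (mN m).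
Local Notation crd := (@mcrd _ _ _ _ _ m _).
Local Notation bas := (@mbas _ _ _ _ _ m).

Lemma mcrd_sum j (c : 'I_N -> K) i : mdeg i = j ->
  crd (\sum_i ks (c i) *: bas j i) i = c i.
Proof.
move=> ei; apply/eqP; rewrite -subr_eq0; apply/eqP.
apply: (@mfree _ _ _ _ _ m j (fun i => crd (\sum_i ks (c i) *: bas j i) i - c i)) => //.
under eq_bigr => k _ do rewrite rmorphB scalerBl.
by rewrite sumrB -mcrdE subrr.
Qed.

Lemma mcrdD j (x y : X j) i : crd (x + y) i = crd x i + crd y i.
Proof.
have [ei|ne] := eqVneq (mdeg i) j; last by rewrite !mcrd_deg // addr0.
rewrite {1}(mcrdE m x) {1}(mcrdE m y) -big_split.
under eq_bigr => k _ do rewrite /= -scalerDl -rmorphD.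
by rewrite (mcrd_sum (fun i => crd x i + crd y i)).
Qed.

Lemma mcrdZ j k (x : X j) i : crd (ks k *: x) i = k * crd x i.
Proof.
have [ei|ne] := eqVneq (mdeg i) j; last by rewrite !mcrd_deg // mulr0.
rewrite {1}(mcrdE m x) scaler_sumr.
under eq_bigr => l _ do rewrite scalerA -rmorphM.
by rewrite (mcrd_sum (fun i => k * crd x i)).
Qed.

Lemma mcrd0 j i : crd (0 : X j) i = 0.
Proof. by have := mcrdZ 0 (0 : X j) i; rewrite scaler0 mul0r. Qed.

Lemma mcrd_lin j (J : finType) (c : J -> K) (x : J -> X j) i :
  crd (\sum_k ks (c k) *: x k) i = \sum_k c k * crd (x k) i.
Proof.
apply: (big_ind2 (fun (y : X j) d => crd y i = d)).
- exact: mcrd0.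
- by move=> y d y' d' <- <-; rewrite mcrdD.
- by move=> k _; rewrite mcrdZ.
Qed.

Lemma mcrd_bas j i k : mdeg i = j -> crd (bas j i) k = (k == i)%:R.
Proof.
move=> ei; have [ek|ne] := eqVneq (mdeg k) j; last first.
  by rewrite mcrd_deg //; have [eki|//] := eqVneq k i; rewrite eki ei eqxx in ne.
have := mcrd_sum (fun l => (l == i)%:R) ek; rewrite (bigD1 i) //= big1.
  by rewrite addr0 eqxx rmorph1 scale1r.
by move=> l /negbTE ->; rewrite rmorph0 scale0r.
Qed.

Lemma mcrd_vtx j (x : X j) v k : e v *: x = x -> mvtx k != v -> crd x k = 0.
Proof.
move=> ex ne; have [ek|nek] := eqVneq (mdeg k) j; last by rewrite mcrd_deg.
have E : x = \sum_i ks (if mvtx i == v then crd x i else 0) *: bas j i.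
  rewrite -{1}ex {1}(mcrdE m x) scaler_sumr; apply: eq_bigr => i _.
  rewrite ksC -mbas_vtx [e v *: _]scalerA pres_ee [mvtx i == v]eq_sym.
  case: eqP => [->|_]; first by rewrite mbas_vtx.
  by rewrite scale0r scaler0 rmorph0 scale0r.
by rewrite E mcrd_sum // (negbTE ne).
Qed.

Definition mD (i k : 'I_N) : K := crd (diff X (mdeg i) (bas (mdeg i) i)) k.

Definition mA (a : arrow Q) (i k : 'I_N) : K :=
  crd (ar a *: bas (mdeg i) i) k.

Lemma mD_deg i k : mdeg k != mdeg i + 1 -> mD i k = 0.
Proof. exact: mcrd_deg. Qed.

Lemma mA_deg a i k : mdeg k != mdeg i -> mA a i k = 0.
Proof. exact: mcrd_deg. Qed.

Lemma mD_vtx i k : mvtx k != mvtx i -> mD i k = 0.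
Proof. by apply: mcrd_vtx; rewrite -linearZ_LR mbas_vtx. Qed.

Lemma mA_tgt a i k : mvtx k != tgt a -> mA a i k = 0.
Proof. by apply: mcrd_vtx; rewrite scalerA pres_ea. Qed.

Lemma pres_ae_neq a v : v != src a -> ar a * e v = 0.
Proof. by move=> ne; rewrite -pres_ae -mulrA pres_ee eq_sym (negbTE ne) mulr0. Qed.

Lemma mA_src a i k : mvtx i != src a -> mA a i k = 0.
Proof.
by move=> ne; rewrite /mA -mbas_vtx scalerA pres_ae_neq // scale0r mcrd0.
Qed.

Lemma diff_bas j i : diff X j (bas j i) = \sum_k ks (mD i k) *: bas (j + 1) k.
Proof.
have [<-|ne] := eqVneq (mdeg i) j; first exact: mcrdE.
rewrite mbas_deg // linear0 big1 // => k _.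
have [ek|nek] := eqVneq (mdeg k) (j + 1); last by rewrite mbas_deg // scaler0.
rewrite mD_deg ?rmorph0 ?scale0r // ek.
by apply: contra_neq ne => /addIr.
Qed.

Lemma arrow_bas j a i : ar a *: bas j i = \sum_k ks (mA a i k) *: bas j k.
Proof.
have [<-|ne] := eqVneq (mdeg i) j; first exact: mcrdE.
rewrite mbas_deg // scaler0 big1 // => k _.
have [ek|nek] := eqVneq (mdeg k) j; last by rewrite mbas_deg // scaler0.
by rewrite mA_deg ?rmorph0 ?scale0r // ek eq_sym.
Qed.

Lemma mcrd_diff j (x : X j) k :
  crd (diff X j x) k = \sum_i crd x i * mD i k.
Proof.
have [ek|nek] := eqVneq (mdeg k) (j + 1); last first.
  rewrite mcrd_deg // big1 // => i _; have [ei|ne] := eqVneq (mdeg i) j.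
    by rewrite mD_deg ?mulr0 // ei.
  by rewrite mcrd_deg ?mul0r.
rewrite {1}(mcrdE m x) linear_sum.
under eq_bigr => i _ do rewrite linearZ_LR diff_bas.
rewrite mcrd_lin; apply: eq_bigr => i _; congr (_ * _).
by rewrite mcrd_sum.
Qed.

Lemma mcrd_arrow j a (x : X j) k :
  crd (ar a *: x) k = \sum_i crd x i * mA a i k.
Proof.
have [ek|nek] := eqVneq (mdeg k) j; last first.
  rewrite mcrd_deg // big1 // => i _; have [ei|ne] := eqVneq (mdeg i) j.
    by rewrite mA_deg ?mulr0 // ei.
  by rewrite mcrd_deg ?mul0r.
rewrite {1}(mcrdE m x) scaler_sumr.
under eq_bigr => i _ do rewrite ksC arrow_bas.
rewrite mcrd_lin; apply: eq_bigr => i _; congr (_ * _).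
by rewrite mcrd_sum.
Qed.

Lemma mDD i l : \sum_k mD i k * mD k l = 0.
Proof. by rewrite -mcrd_diff diffK mcrd0. Qed.

Lemma mDA a i l : \sum_k mD i k * mA a k l = \sum_k mA a i k * mD k l.
Proof. by rewrite -mcrd_arrow -mcrd_diff linearZ_LR. Qed.

(** The standard resolution 0 -> (+)_a B e_(t a) (x) X_(s a) -> (+)_v B e_v (x)
X_v -> X -> 0 of modules over a path algebra, totalized.  Generators: [inl i]
over the basis element b_i, and [inr (a, i)] in degree one less, whose
differential is a g_i - g_(a b_i) up to the differential of X. *)
Definition res_mx (p q : 'I_N + arrow Q * 'I_N) : B :=
  match p, q with
  | inl i, inl k => ks (mD i k) * e (mvtx k)
  | inl i, inr _ => 0
  | inr (a, i), inl k => if mvtx i == src a then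
      (if i == k then ar a else 0) - ks (mA a i k) * e (tgt a) else 0
  | inr (a, i), inr (b, k) => if (a == b) && (mvtx i == src a) then
      - (ks (mD i k) * e (tgt a)) else 0
  end.

Definition res_idem (p : 'I_N + arrow Q * 'I_N) : B :=
  match p with
  | inl i => e (mvtx i)
  | inr (a, i) => if mvtx i == src a then e (tgt a) else 0
  end.

Definition res_deg (p : 'I_N + arrow Q * 'I_N) : int :=
  match p with inl i => mdeg i | inr (_, i) => mdeg i - 1 end.

Lemma mD_e i k : ks (mD i k) * e (mvtx k) = ks (mD i k) * e (mvtx i).
Proof.
have [->//|ne] := eqVneq (mvtx k) (mvtx i).
by rewrite mD_vtx // rmorph0 !mul0r.
Qed.

Lemma ee v : e v * e v = e v. Proof. by rewrite pres_ee eqxx. Qed.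

Lemma sum_res (V : nmodType) (F : 'I_N + arrow Q * 'I_N -> V) :
  \sum_r F r = \sum_i F (inl i) + \sum_a \sum_i F (inr (a, i)).
Proof.
rewrite big_sumType /= pair_bigA; congr (_ + _).
by apply: eq_bigr => -[].
Qed.

Lemma ksM x y (u v : B) : (ks x * u) * (ks y * v) = ks (x * y) * (u * v).
Proof. by rewrite -mulrA (mulrA u) -kscalar_central rmorphM !mulrA. Qed.

Lemma mDD_e x i k : ks (x * mD i k) * (e (mvtx i) * e (mvtx k)) =
  ks (x * mD i k) * e (mvtx k).
Proof.
have [->|ne] := eqVneq (mvtx k) (mvtx i); first by rewrite ee.
by rewrite mD_vtx // mulr0 rmorph0 !mul0r.
Qed.

Lemma res_mxK p q : \sum_r res_mx p r * res_mx r q = 0.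
Proof.
rewrite sum_res; case: p q => [i|[a i]] [l|[b l]] /=.
- rewrite [X in _ + X]big1 ?addr0 => [|b _]; last first.
    by apply: big1 => k _; rewrite mul0r.
  under eq_bigr => k _ do rewrite ksM mDD_e.
  by rewrite -mulr_suml -rmorph_sum mDD rmorph0 mul0r.
- rewrite [X in _ + X]big1 ?addr0 => [|c _]; last first.
    by apply: big1 => k _; rewrite mul0r.
  by rewrite big1 // => k _; rewrite mulr0.
- case: eqP => [si|_]; last first.
    rewrite big1 ?add0r => [|k _]; last by rewrite mul0r.
    by apply: big1 => c _; apply: big1 => k _; rewrite andbF mul0r.
  have aD : (ks (mD i l) * ar a) = \sum_k (if i == k then ar a else 0) * (ks (mD k l) * e (mvtx l)).
    rewrite (bigD1 i) //= eqxx big1 ?addr0 => [|k ne]; last first.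
      by rewrite eq_sym (negbTE ne) mul0r.
    rewrite mulrA -kscalar_central -mulrA.
    have [->|ne] := eqVneq (mvtx l) (mvtx i); first by rewrite si pres_ae.
    by rewrite mD_vtx // rmorph0 !mul0r.
  have MD k : ks (mA a i k) * e (tgt a) * (ks (mD k l) * e (mvtx l)) =
      ks (mA a i k * mD k l) * e (tgt a).
    rewrite ksM; have [<-|ne] := eqVneq (mvtx k) (tgt a).
      by rewrite mDD_e rmorphM -!mulrA mD_e.
    by rewrite mA_tgt // !(mul0r, rmorph0).
  under eq_bigr => k _ do rewrite mulrBl MD.
  rewrite sumrB -aD (bigD1 a) //= [X in _ + (_ + X)]big1 ?addr0; last first.
    move=> c ne; apply: big1 => k _; by rewrite eq_sym (negbTE ne) mul0r.
  have DM k : (if (a == a) && true then - (ks (mD i k) * e (tgt a)) else 0) *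
    (if mvtx k == src a then (if k == l then ar a else 0) - ks (mA a k l) * e (tgt a) else 0) =
    - (if k == l then ks (mD i k) * ar a else 0) + ks (mD i k * mA a k l) * e (tgt a).
    rewrite eqxx /=; have [sk|ne] := eqVneq (mvtx k) (src a); last first.
      have D0 : mD i k = 0 by apply: mD_vtx; rewrite si.
      by rewrite mulr0 D0 !(mul0r, rmorph0) if_same oppr0 addr0.
    rewrite mulrBr !mulNr ksM ee opprK; congr (- _ + _).
    case: eqP => _; last by rewrite mulr0.
    by rewrite -mulrA pres_ea.
  rewrite (eq_bigr _ (fun k _ => DM k)).
  rewrite big_split /= sumrN -big_mkcond big_pred1_eq.
  rewrite -!mulr_suml -!rmorph_sum mDA.
  by rewrite addrACA subrr addNr addr0.
rewrite big1 ?add0r => [|k _]; last by rewrite mulr0.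
apply: big1 => c _; case: (a =P c) => [<-|_] /=; last first.
  by apply: big1 => k _; rewrite mul0r.
case: eqP => [si|_]; last by apply: big1 => k _; rewrite mul0r.
case: (a =P b) => [_|_] /=; last by apply: big1 => k _; rewrite mulr0.
have DD k : - (ks (mD i k) * e (tgt a)) *
   (if mvtx k == src a then - (ks (mD k l) * e (tgt a)) else 0) =
   ks (mD i k * mD k l) * e (tgt a).
  have [sk|ne] := eqVneq (mvtx k) (src a); first by rewrite mulrNN ksM ee.
  by rewrite mulr0 mD_vtx ?si // !(mul0r, rmorph0).
under eq_bigr => k _ do rewrite DD.
by rewrite -mulr_suml -rmorph_sum mDD rmorph0 mul0r.
Qed.

Lemma res_idemK p : res_idem p * res_idem p = res_idem p.
Proof.
case: p => [i|[a i]] /=; first by rewrite ee.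
by case: ifP => _; rewrite ?mulr0 ?ee.
Qed.

Lemma res_mx_idl p q : res_idem p * res_mx p q = res_mx p q.
Proof.
case: p q => [i|[a i]] [k|[b k]] /=.
- by rewrite mD_e mulrA -kscalar_central -mulrA ee.
- by rewrite mulr0.
- case: ifP => _; rewrite ?mulr0 // mulrBr mulrA -kscalar_central -mulrA ee.
  by case: ifP => _; rewrite ?pres_ea ?mulr0.
case: (mvtx i == src a); rewrite ?andbF ?andbT ?mul0r //.
case: ifP => _; rewrite ?mulr0 //.
by rewrite mulrN mulrA -kscalar_central -mulrA ee.
Qed.

Lemma res_mx_idr p q : res_mx p q * res_idem q = res_mx p q.
Proof.
case: p q => [i|[a i]] [k|[b k]] /=.
- by rewrite -mulrA ee.
- by rewrite mul0r.
- case: eqP => si; rewrite ?mul0r // mulrBl; congr (_ - _).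
    case: eqP => [<-|_]; last by rewrite mul0r.
    by rewrite si pres_ae.
  have [->|ne] := eqVneq (mvtx k) (tgt a); first by rewrite -mulrA ee.
  by rewrite mA_tgt // rmorph0 !mul0r.
case: eqP => [<-|_] /=; last by rewrite mul0r.
case: eqP => si; rewrite ?mul0r //.
have [_|ne] := eqVneq (mvtx k) (src a); first by rewrite mulNr -mulrA ee.
by rewrite mulr0 mD_vtx ?si // rmorph0 mul0r oppr0.
Qed.

Lemma res_mx_deg p q : res_deg q != res_deg p + 1 -> res_mx p q = 0.
Proof.
case: p q => [i|[a i]] [k|[b k]] //=.
- by move=> ne; rewrite mD_deg // rmorph0 mul0r.
- rewrite subrK => ne; case: ifP => // _; rewrite mA_deg // rmorph0 mul0r subr0.
  by case: eqP => // eik; rewrite eik eqxx in ne.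
move=> ne; case: ifP => // _; rewrite mD_deg ?rmorph0 ?mul0r ?oppr0 //.
by apply: contraNneq ne => ->; rewrite addrAC.
Qed.

Definition res_data : proj_data B :=
  @ProjData B _ res_deg res_idem res_mx res_idemK res_mx_idl res_mx_idr
    res_mx_deg res_mxK.

Definition res_cpx := proj_cpx res_data.

(** A chain map out of the resolution is a family of K-linear maps y_v at the
vertices together with homotopies h_a measuring how far they are from
commuting with the arrows. *)
Lemma res_family (Y : bcomplex B) (y : forall j, 'I_N -> Y j)
    (h : forall j, arrow Q -> 'I_N -> Y j) :
  (forall j i, mdeg i = j -> e (mvtx i) *: y j i = y j i) ->
  (forall j i, mdeg i = j ->
     diff Y j (y j i) = \sum_k ks (mD i k) *: y (j + 1) k) ->
  (forall j a i, mdeg i = j + 1 -> e (tgt a) *: h j a i = h j a i) ->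
  (forall j a i, mdeg i = j + 1 -> mvtx i = src a ->
     diff Y j (h j a i) = ar a *: y (j + 1) i
       - \sum_k ks (mA a i k) *: y (j + 1) k
       - \sum_k ks (mD i k) *: h (j + 1) a k) ->
  @proj_family B res_data Y (fun j p => match p with
    inl i => y j i | inr (a, i) => h j a i end).
Proof.
move=> ye yd he hd j p ej; rewrite sum_res.
have yk i k : mdeg i = j -> ks (mD i k) *: y (j + 1) k =
    ks (mD i k) * e (mvtx k) *: y (j + 1) k.
  move=> ei; have [ek|ne] := eqVneq (mdeg k) (mdeg i + 1).
    by rewrite -scalerA ye // ek ei.
  by rewrite mD_deg // rmorph0 mul0r !scale0r.
case: p ej => [i|[a i]] /= ej.
  rewrite -linearZ_LR ye // yd // [X in _ = _ + X]big1 ?addr0 => [|a _].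
    by apply: eq_bigr => k _; rewrite yk.
  by apply: big1 => k _; rewrite scale0r.
have ej1 : mdeg i = j + 1 by rewrite -ej subrK.
case: eqP => [si|_]; last first.
  rewrite scale0r big1 ?add0r => [|k _]; last by rewrite scale0r.
  by rewrite big1 // => b _; apply: big1 => k _; rewrite andbF scale0r.
rewrite -linearZ_LR he // hd //; congr (_ + _).
  under [RHS]eq_bigr => k _ do rewrite scalerBl.
  rewrite sumrB; congr (_ - _).
    rewrite (bigD1 i) //= eqxx big1 ?addr0 // => k ne.
    by rewrite eq_sym (negbTE ne) scale0r.
  apply: eq_bigr => k _; have [ek|ne] := eqVneq (mvtx k) (tgt a); last first.
    by rewrite mA_tgt // rmorph0 mul0r !scale0r.
  have [dk|nd] := eqVneq (mdeg k) (mdeg i); last first.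
    by rewrite mA_deg // rmorph0 mul0r !scale0r.
  by rewrite -scalerA -ek ye // dk.
rewrite (bigD1 a) //= [X in _ = _ + X]big1 ?addr0 => [|b ne]; last first.
  by apply: big1 => k _; rewrite eq_sym (negbTE ne) scale0r.
rewrite -sumrN; apply: eq_bigr => k _; rewrite eqxx scaleNr -scalerA; congr (- _).
have [dk|nd] := eqVneq (mdeg k) (mdeg i + 1); last first.
  by rewrite mD_deg // rmorph0 !scale0r.
by rewrite he // dk ej1.
Qed.

Lemma res_proj_family : @proj_family B res_data X (fun j p => match p with
    inl i => bas j i | inr (a, i) => 0 end).
Proof.
apply: res_family => [j i _|j i _|j a i _|j a i _ si].
- by rewrite mbas_vtx.
- exact: diff_bas.
- by rewrite scaler0.
rewrite linear0 [X in _ - X]big1 ?subr0 => [|k _]; last by rewrite scaler0.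
by rewrite arrow_bas subrr.
Qed.

Definition res_map : chain_map res_cpx X := proj_map res_proj_family.

End Coordinates.

(** * Exactness of the standard resolution *)

Section Exactness.
Variables (K : fieldType) (Q : quiver) (B : kalgebra K) (pp : presentation Q B).
Local Notation ks := (kscalar B).
Local Notation e := (pres_e pp).
Local Notation ar := (pres_a pp).
Variables (X : bcomplex B) (m : model pp X).
Local Notation N := (mN m).
Local Notation crd := (@mcrd _ _ _ _ _ m _).
Local Notation bas := (@mbas _ _ _ _ _ m).
Local Notation M := (res_mx (m := m)).
Local Notation idem := (res_idem (m := m)).

Definition res_bdry (z : arrow Q -> 'I_N -> B) (k : 'I_N) : B :=
  \sum_a \sum_i z a i * M (inr (a, i)) (inl k).

Definition res_coef (z : arrow Q -> 'I_N -> B) : Prop :=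
  forall a i, z a i * idem (inr (a, i)) = z a i.

Lemma res_coef_out z a i : res_coef z -> mvtx i != src a -> z a i = 0.
Proof. by move=> /(_ a i) <- /negbTE /= ->; rewrite mulr0. Qed.

Lemma res_coef_tgt z a i : res_coef z -> z a i * e (tgt a) = z a i.
Proof.
move=> H; have [si|ne] := eqVneq (mvtx i) (src a).
  by rewrite -[RHS]H /= si eqxx.
by rewrite (res_coef_out H ne) mul0r.
Qed.

Lemma res_bdryE z k : res_coef z -> res_bdry z k =
  \sum_a z a k * ar a - \sum_a \sum_i ks (mA a i k) * z a i.
Proof.
move=> H; rewrite -sumrB; apply: eq_bigr => a _.
have -> : z a k * ar a = \sum_i z a i * (if i == k then ar a else 0).
  rewrite (bigD1 k) //= eqxx big1 ?addr0 // => i /negbTE ->.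
  by rewrite mulr0.
rewrite -sumrB; apply: eq_bigr => i _ /=.
case: eqVneq => [si|ne]; last by rewrite (res_coef_out H ne) !(mulr0, mul0r) subr0.
by rewrite mulrBr mulrA -kscalar_central -mulrA (res_coef_tgt _ _ H).
Qed.

(** Exactness on the left: here the absence of relations between the paths
enters. *)
Lemma res_bdry_inj z : res_coef z -> (forall k, res_bdry z k = 0) ->
  forall a i, z a i = 0.
Proof.
move=> H z0; apply: (pres_free (p := pp) (c := fun a i k => mA a i k)).
  by move=> a i; apply: res_coef_tgt.
by move=> k; apply/eqP; rewrite -subr_eq0 -res_bdryE // z0.
Qed.

Definition res_img (j : int) (U : 'I_N -> B) : Prop := exists z,
  [/\ res_coef z, forall a i, mdeg i != j -> z a i = 0
    & forall k, U k = res_bdry z k].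

Lemma res_bdry_lin b z z' k :
  res_bdry (fun a i => b * z a i + z' a i) k = b * res_bdry z k + res_bdry z' k.
Proof.
rewrite /res_bdry mulr_sumr -big_split; apply: eq_bigr => a _ /=.
rewrite mulr_sumr -big_split; apply: eq_bigr => i _ /=.
by rewrite mulrDl mulrA.
Qed.

Lemma res_img_ext j U V : U =1 V -> res_img j U -> res_img j V.
Proof. by move=> E [z [z1 z2 z3]]; exists z; split=> // k; rewrite -E. Qed.

Lemma res_img0 j : res_img j (fun _ => 0).
Proof.
exists (fun _ _ => 0); split=> // [a i|k]; first by rewrite mul0r.
by rewrite /res_bdry big1 // => a _; apply: big1 => i _; rewrite mul0r.
Qed.

Lemma res_img_lin j b U V : res_img j U -> res_img j V ->
  res_img j (fun k => b * U k + V k).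
Proof.
move=> [z [z1 z2 z3]] [w [w1 w2 w3]].
exists (fun a i => b * z a i + w a i); split=> [a i|a i ne|k].
- by rewrite mulrDl -mulrA z1 w1.
- by rewrite z2 // w2 // mulr0 addr0.
by rewrite res_bdry_lin z3 w3.
Qed.

(** Modulo boundaries every element x g_i is the combination of the generators
dictated by the coordinates of x b_i: move the arrows of x one by one across
the tensor sign. *)
Lemma res_img_mod j i (x : B) : mdeg i = j ->
  res_img j (fun k => (if k == i then x * e (mvtx i) else 0)
    - ks (crd (x *: bas j i) k) * e (mvtx k)).
Proof.
move=> ei; elim/(@pres_ind _ _ _ pp): x => [|c x y IHx IHy|v|a x IHx].
- apply: res_img_ext (res_img0 j) => k.
  by rewrite mul0r scale0r mcrd0 rmorph0 mul0r subr0 if_same.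
- apply: res_img_ext (res_img_lin (ks c) IHx IHy) => k.
  rewrite scalerDl -scalerA mcrdD mcrdZ rmorphD rmorphM mulrBr addrACA.
  rewrite -opprD; congr (_ - _); last by rewrite mulrDl mulrA.
  by case: eqP => _; rewrite ?mulr0 ?addr0 // mulrDl mulrA.
- apply: res_img_ext (res_img0 j) => k; rewrite -[bas j i]mbas_vtx scalerA pres_ee.
  case: (v =P mvtx i) => [->|_]; last first.
    by rewrite scale0r mcrd0 rmorph0 mul0r subr0 if_same.
  rewrite mbas_vtx mcrd_bas //; case: eqP => [->|_].
    by rewrite rmorph1 mul1r subrr.
  by rewrite rmorph0 mul0r subr0.
pose c k := crd (x *: bas j i) k.
have S : res_img j (fun k => \sum_l ks (c l) *
    ((if k == l then ar a * e (mvtx l) else 0) - ks (mA a l k) * e (mvtx k))).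
  exists (fun b l => if (b == a) && (mvtx l == src a) then ks (c l) * e (tgt a) else 0).
  have Hz : res_coef (fun b l =>
      if (b == a) && (mvtx l == src a) then ks (c l) * e (tgt a) else 0).
    move=> b l /=; case: (b =P a) => [->|_] /=; last by rewrite mul0r.
    by case: ifP => _; rewrite ?mul0r // -mulrA ee.
  split=> // [b l ne|k].
    by rewrite /c mcrd_deg // rmorph0 mul0r if_same.
  rewrite res_bdryE // (bigD1 a) //= [X in _ = _ + X - _]big1 ?addr0 => [|b /negbTE ->]; last first.
    by rewrite mul0r.
  rewrite eqxx /= [X in _ = _ - X](bigD1 a) //= [X in _ = _ - (_ + X)]big1 ?addr0; last first.
    by move=> b /negbTE ->; apply: big1 => l _; rewrite mulr0.
  under eq_bigr => l _ do rewrite mulrBr.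
  rewrite sumrB; congr (_ - _).
    rewrite (bigD1 k) //= eqxx big1 ?addr0 => [|l]; last first.
      by rewrite eq_sym => /negbTE ->; rewrite mulr0.
    case: eqVneq => [->|ne]; first by rewrite pres_ae -mulrA pres_ea.
    by rewrite pres_ae_neq // mulr0 mul0r.
  apply: eq_bigr => l _; rewrite eqxx /=.
  case: eqVneq => [sl|ne]; last by rewrite mA_src // !(rmorph0, mul0r, mulr0).
  have [->|nk] := eqVneq (mvtx k) (tgt a).
    by rewrite !mulrA -!rmorphM mulrC.
  by rewrite mA_tgt // !(rmorph0, mul0r, mulr0).
apply: res_img_ext (res_img_lin (ar a) IHx S) => k.
have -> : crd ((ar a * x) *: bas j i) k = \sum_l c l * mA a l k.
  by rewrite -scalerA mcrd_arrow.
under eq_bigr => l _ do rewrite mulrBr.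
rewrite sumrB -/(c k) mulrBr mulrA -kscalar_central -mulrA.
have -> : \sum_l ks (c l) * (if k == l then ar a * e (mvtx l) else 0) =
    ks (c k) * (ar a * e (mvtx k)).
  rewrite (bigD1 k) //= eqxx big1 ?addr0 // => l.
  by rewrite eq_sym => /negbTE ->; rewrite mulr0.
rewrite addrA subrK rmorph_sum mulr_suml; congr (_ - _).
  by case: eqP => _; rewrite ?mulr0 // mulrA.
by apply: eq_bigr => l _; rewrite mulrA -rmorphM.
Qed.

(** Exactness in the middle: U is the sum over i of the differences shown to
be boundaries by [res_img_mod], because the coordinates add up to zero. *)
Lemma res_exact j (U : 'I_N -> B) : (forall i, U i * e (mvtx i) = U i) ->
  (forall i, mdeg i != j -> U i = 0) -> \sum_i U i *: bas j i = 0 -> res_img j U.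
Proof.
move=> Ue Ud U0.
pose T i k := (if k == i then U i * e (mvtx i) else 0)
    - ks (crd (U i *: bas j i) k) * e (mvtx k).
have H i : res_img j (T i).
  have [ei|ne] := eqVneq (mdeg i) j; first exact: res_img_mod.
  apply: res_img_ext (res_img0 j) => k.
  by rewrite /T Ud // mul0r scale0r mcrd0 rmorph0 mul0r subr0 if_same.
have : res_img j (fun k => \sum_i T i k).
  rewrite /index_enum; elim: (Finite.enum _) => [|i s IHs].
    by apply: res_img_ext (res_img0 j) => k; rewrite big_nil.
  apply: res_img_ext (res_img_lin 1 (H i) IHs) => k.
  by rewrite big_cons mul1r.
apply: res_img_ext => k; rewrite /T sumrB -mulr_suml -rmorph_sum.
have -> : \sum_i crd (U i *: bas j i) k = crd (\sum_i U i *: bas j i) k.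
  apply: (big_ind2 (fun d (y : X j) => d = crd y k)) => //.
    by rewrite mcrd0.
  by move=> ? ? ? ? -> ->; rewrite mcrdD.
rewrite U0 mcrd0 rmorph0 mul0r subr0 (bigD1 k) //= eqxx Ue big1 ?addr0 //.
by move=> i; rewrite eq_sym => /negbTE ->.
Qed.

Local Notation R := (res_data m).
Local Notation P := (res_cpx m).
Local Notation pi := (res_map m).

Lemma res_mapE j (u : P j) : pi j u = \sum_i (val u (inl i) : B) *: bas j i.
Proof.
rewrite proj_mapE sum_res [X in _ + X]big1 ?addr0 // => a _.
by apply: big1 => i _; rewrite scaler0.
Qed.

Lemma res_diff_inl j (u : P j) k : val (diff P j u) (inl k) =
  \sum_i (val u (inl i) : B) * M (inl i) (inl k) +
  res_bdry (fun a i => val u (inr (a, i))) k.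
Proof. by rewrite SubK ffunE sum_res. Qed.

Lemma res_cycle0 j (u : P j) : diff P j u = 0 ->
  (forall i, val u (inl i) = 0) -> u = 0.
Proof.
move=> du u0; pose z a i : B := val u (inr (a, i)).
have z0 : forall a i, z a i = 0.
  apply: res_bdry_inj => [a i|k]; first exact: (proj_idem u (inr (a, i))).
  have := res_diff_inl u k; rewrite du linear0 ffunE big1 ?add0r => [->//|i _].
  by rewrite u0 mul0r.
apply: val_inj; apply/ffunP => -[i|[a i]]; rewrite linear0 ffunE; first exact: u0.
exact: z0.
Qed.

Lemma res_kernel j (u : P (j + 1)) : pi (j + 1) u = 0 ->
  exists w : P j, (forall i, val w (inl i) = 0) /\
    forall i, val (u - diff P j w) (inl i) = 0.
Proof.
rewrite res_mapE => u0.
have [||z [z1 z2 z3]] := @res_exact (j + 1) (fun i => val u (inl i)) _ _ u0.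
- by move=> i; exact: (proj_idem u (inl i)).
- by move=> i ne; exact: (proj_out u (i := inl i) ne).
pose wv : {ffun pidx R -> B^o} :=
  [ffun p => match p with inl _ => 0 | inr (a, i) => z a i end].
have wP : wv \in @proj_pred _ R j.
  apply/proj_predP; split=> -[i|[a i]]; rewrite ffunE /= ?mul0r //.
  by move=> ne; apply: z2; apply: contraNneq ne => ->; rewrite addrK.
exists (proj_mk wP : P j); split=> i; first by rewrite ffunE.
rewrite linearB !ffunE sum_res big1 ?add0r => [|k _]; last by rewrite ffunE mul0r.
apply/eqP; rewrite subr_eq0; apply/eqP; rewrite z3.
by apply: eq_bigr => a _; apply: eq_bigr => k _; rewrite ffunE.
Qed.

Lemma res_lift j (x : X j) : exists u : P j, pi j u = x.
Proof.
exists (\sum_i ks (crd x i) *: @proj_gen _ R j (inl i)).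
rewrite linear_sum {2}(mcrdE m x); apply: eq_bigr => i _; rewrite linearZ_LR.
congr (_ *: _); rewrite res_mapE (bigD1 i) //= big1 ?addr0 => [|k ne]; last first.
  by rewrite ffunE -[inl k == inl i]/(k == i) (negbTE ne) scale0r.
rewrite ffunE eqxx /=; case: eqVneq => [_|ne]; first by rewrite mbas_vtx.
by rewrite scale0r mbas_deg.
Qed.

Lemma res_map_inl0 j (w : P j) : (forall i, val w (inl i) = 0) -> pi j w = 0.
Proof. by move=> H; rewrite res_mapE big1 // => i _; rewrite H scale0r. Qed.

(** The generators at the arrows are mapped injectively ([res_cycle0]) onto
the kernel ([res_kernel]) of a surjection ([res_lift]) given by the generators
at the vertices. *)
Lemma res_quasi_iso : quasi_iso pi.
Proof.
move=> j; split=> [u du [y ey]|y dy].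
  have [u' eu'] := res_lift y.
  have [|w [w0 wE]] := @res_kernel j (u - diff P j u').
    by rewrite linearB ey cmap_diff eu' subrr.
  exists (u' + w); apply/eqP; rewrite -subr_eq0 linearD opprD addrA; apply/eqP.
  by apply: res_cycle0 wE; rewrite !linearB du !diffK !subr0.
have [u eu] := res_lift y.
have [|w [w0 wE]] := @res_kernel (j + 1) (diff P (j + 1) u).
  by rewrite cmap_diff eu dy.
exists (u - w).
  by rewrite linearB; apply: res_cycle0 wE; rewrite linearB !diffK subr0.
by exists 0; rewrite linearB eu res_map_inl0 // subr0 linear0 subrr.
Qed.

End Exactness.

(** * Euler characteristic of a complex of period two *)

Section EulerCharacteristic.
Variables (K : fieldType) (V : vectType K) (d : 'End(V)) (U0 U1 : {vspace V}).
Hypothesis d01 : (d @: U0 <= U1 :&: lker d)%VS.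
Hypothesis d10 : (d @: U1 <= U0 :&: lker d)%VS.
Hypothesis H1 : (U1 :&: lker d <= d @: U0)%VS.

(** U0 and U1 are the even and the odd part of a complex, which is exact at
U1: the difference of the dimensions is the dimension of the homology at U0,
here 0 and in [euler_line] 1. *)
Lemma euler_exact : (U0 :&: lker d <= d @: U1)%VS -> \dim U0 = \dim U1.
Proof.
move=> H0; rewrite -(limg_ker_dim d U0) -(limg_ker_dim d U1) addnC.
have -> : (U0 :&: lker d)%VS = (d @: U1)%VS by apply/eqP; rewrite eqEsubv H0 d10.
have -> // : (U1 :&: lker d)%VS = (d @: U0)%VS by apply/eqP; rewrite eqEsubv H1 d01.
Qed.

Lemma euler_line r : r \in (U0 :&: lker d)%VS -> r \notin (d @: U1)%VS ->
  (U0 :&: lker d <= <[r]> + d @: U1)%VS -> \dim U0 = (\dim U1).+1.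
Proof.
move=> rU rn H0; rewrite -(limg_ker_dim d U0) -(limg_ker_dim d U1).
have -> : (U0 :&: lker d)%VS = (<[r]> + d @: U1)%VS.
  by apply/eqP; rewrite eqEsubv H0 subv_add d10 -memvE rU.
have -> : (U1 :&: lker d)%VS = (d @: U0)%VS by apply/eqP; rewrite eqEsubv H1 d01.
rewrite dimv_disjoint_sum; last first.
  apply/eqP; rewrite -subv0; apply/subvP => x /memv_capP[/vlineP[k ->]].
  have [->|k0] := eqVneq k 0; first by rewrite scale0r => _; exact: mem0v.
  by move=> /(memvZ k^-1); rewrite scalerA mulVf // scale1r (negbTE rn).
rewrite dim_vline; have -> : r != 0 by apply: contraNneq rn => ->; exact: mem0v.
by rewrite add1n addSn addnC.
Qed.

End EulerCharacteristic.

Section CoordinateSubspace.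
Variables (K : fieldType) (J : finType).
Local Notation V := {ffun J -> K^o}.

Definition coord_delta (j : J) : V := [ffun l => (l == j)%:R].

Definition coord_space (P : pred J) : {vspace V} :=
  <<[seq coord_delta j | j <- enum P]>>%VS.

Lemma coord_deltaE (r : V) : r = \sum_j (r j : K) *: coord_delta j.
Proof.
apply/ffunP => l; rewrite sum_ffunE (bigD1 l) //= big1 => [|j ne].
  by rewrite !ffunE eqxx addr0 -[RHS]/(_ * _) mulr1.
by rewrite !ffunE eq_sym (negbTE ne) scaler0.
Qed.

Lemma coord_spaceP (P : pred J) (r : V) :
  reflect (forall j, ~~ P j -> r j = 0) (r \in coord_space P).
Proof.
apply: (iffP idP) => [rP j nPj|H].
  have evL : linear (fun r : V => r j : K^o) by move=> c u v; rewrite !ffunE.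
  have : (coord_space P <= lker (linfun (mk_linear evL)))%VS.
    apply/span_subvP => u /mapP[l]; rewrite mem_enum => Pl ->.
    rewrite memv_ker lfunE /= /mk_linear ffunE.
    have [ejl|_] := eqVneq j l; last by rewrite eqxx.
    by move: nPj; rewrite ejl -topredE /= in Pl *; rewrite Pl.
  move=> /subvP/(_ r rP); rewrite memv_ker lfunE => /eqP.
  by [].
rewrite (coord_deltaE r); apply: memv_suml => j _.
have [Pj|/H->] := boolP (P j); last by rewrite scale0r mem0v.
by apply: memvZ; apply: memv_span; apply: map_f; rewrite mem_enum.
Qed.

Lemma dim_coord_space (P : pred J) : \dim (coord_space P) = #|P|.
Proof.
have sz : size [seq coord_delta j | j <- enum P] = #|P| by rewrite size_map -cardE.
rewrite -sz; suff F : free (in_tuple [seq coord_delta j | j <- enum P]).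
  exact: (eqP F).
apply/freeP => k /= k0 i.
have lti : (i < #|P|)%N by rewrite -sz.
pose j (i : 'I_(size [seq coord_delta j | j <- enum P])) :=
  enum_val (cast_ord sz i).
have E l : [seq coord_delta j | j <- enum P]`_(nat_of_ord l) = coord_delta (j l).
  rewrite (nth_map (j l)); last by rewrite -cardE -sz.
  by congr coord_delta; apply/esym/(enum_val_nth (j l)).
have := congr1 (fun r : V => r (j i)) k0; rewrite sum_ffunE (bigD1 i) //= big1.
  by rewrite addr0 E !ffunE eqxx -[_ *: _]/(_ * _) mulr1.
move=> l ne; rewrite E !ffunE; case: eqP; last by rewrite scaler0.
by move=> /enum_val_inj/cast_ord_inj eil; rewrite eil eqxx in ne.
Qed.

End CoordinateSubspace.

(** * The complex of matrices and the Euler form *)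

Definition parity (n : int) : bool := odd `|n|%N.

Lemma parityD m n : parity (m + n) = parity m (+) parity n.
Proof. by rewrite /parity; lia. Qed.

Lemma sign_parity1 (R : pzRingType) n :
  (-1) ^+ parity (n + 1) = - (-1) ^+ parity n :> R.
Proof. by rewrite parityD signr_addb expr1 mulrN1. Qed.

Lemma sign_parityB1 (R : pzRingType) n :
  (-1) ^+ parity (n - 1) = - (-1) ^+ parity n :> R.
Proof. by rewrite parityD signr_addb expr1 mulrN1. Qed.

Section MatrixData.
Variables (K : fieldType) (Q : quiver).

(** Complexes of representations of Q in coordinates, all degrees at once. *)
Record matdata := MatData {
  dN : nat;
  ddeg : 'I_dN -> int;
  dvtx : 'I_dN -> vertex Q;
  dD : 'M[K]_dN;
  dA : arrow Q -> 'M[K]_dN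
}.

Record matdata_wf (m : matdata) : Prop := MatDataWf {
  dD_deg : forall i k, dD m i k != 0 -> ddeg k = ddeg i + 1;
  dD_vtx : forall i k, dD m i k != 0 -> dvtx k = dvtx i;
  dA_deg : forall a i k, dA m a i k != 0 -> ddeg k = ddeg i;
  dA_src : forall a i k, dA m a i k != 0 -> dvtx i = src a;
  dA_tgt : forall a i k, dA m a i k != 0 -> dvtx k = tgt a;
  dDD : dD m *m dD m = 0;
  dDA : forall a, dD m *m dA m a = dA m a *m dD m
}.

Section Twist.
Variables (m m' : matdata) (wm : matdata_wf m) (wm' : matdata_wf m').

(** Multiplies the part of degree p by (-1)^p. The usual sign in the
differential of a complex of maps becomes a linear map that does not mention
p. *)
Definition twist (f : 'M[K]_(dN m, dN m')) : 'M[K]_(dN m, dN m') :=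
  \matrix_(i, k) ((-1) ^+ parity (ddeg i + ddeg k) * f i k).

Lemma twist_is_linear : linear twist.
Proof.
by move=> c f g; apply/matrixP => i k; rewrite !mxE mulrDr mulrCA.
Qed.

HB.instance Definition _ := GRing.isLinear.Build K _ _ *:%R twist twist_is_linear.

Lemma twistK f : twist (twist f) = f.
Proof.
by apply/matrixP => i k; rewrite !mxE mulrA -signr_addb addbb mul1r.
Qed.

Lemma twist_mulD f : twist (f *m dD m') = - (twist f *m dD m').
Proof.
apply/matrixP => i k; rewrite !mxE mulr_sumr -sumrN; apply: eq_bigr => l _.
have [->|/(dD_deg wm') E] := eqVneq (dD m' l k) 0; first by rewrite !mulr0 oppr0.
by rewrite mxE E addrA sign_parity1 !mulNr mulrA.
Qed.

Lemma twist_Dmul f : twist (dD m *m f) = - (dD m *m twist f).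
Proof.
apply/matrixP => i k; rewrite !mxE mulr_sumr -sumrN; apply: eq_bigr => l _.
have [->|/(dD_deg wm) E] := eqVneq (dD m i l) 0; first by rewrite !(mul0r, mulr0) oppr0.
by rewrite mxE E addrAC sign_parity1 mulNr mulrN opprK mulrCA.
Qed.

Lemma twist_mulA a f : twist (f *m dA m' a) = twist f *m dA m' a.
Proof.
apply/matrixP => i k; rewrite !mxE mulr_sumr; apply: eq_bigr => l _.
have [->|/(dA_deg wm') E] := eqVneq (dA m' a l k) 0; first by rewrite !mulr0.
by rewrite mxE E mulrA.
Qed.

Lemma twist_Amul a f : twist (dA m a *m f) = dA m a *m twist f.
Proof.
apply/matrixP => i k; rewrite !mxE mulr_sumr; apply: eq_bigr => l _.
have [->|/(dA_deg wm) E] := eqVneq (dA m a i l) 0; first by rewrite !(mul0r, mulr0).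
by rewrite mxE E mulrCA.
Qed.

End Twist.

(** The complex computing maps in the derived category from m to m': the part
[Fm] at the vertices, the homotopies [Hm a] at the arrows. *)
Definition rindex (m m' : matdata) : finType :=
  (option (arrow Q) * ('I_(dN m) * 'I_(dN m')))%type.

Definition rspace m m' : vectType K := {ffun rindex m m' -> K^o}.

Section RComplex.
Variables (m m' : matdata).
Local Notation V := (rspace m m').
Implicit Types r s : V.

Definition Fm r : 'M[K]_(dN m, dN m') := \matrix_(i, k) r (None, (i, k)).
Definition Hm r a : 'M[K]_(dN m, dN m') := \matrix_(i, k) r (Some a, (i, k)).

Definition rF r := Fm r *m dD m' - dD m *m twist (Fm r).
Definition rH r a := Hm r a *m dD m' - dD m *m twist (Hm r a)
  - (twist (Fm r) *m dA m' a - dA m a *m twist (Fm r)).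

Definition rdiff r : V := [ffun j : rindex m m' =>
  match j.1 with
  | None => rF r j.2.1 j.2.2
  | Some a => rH r a j.2.1 j.2.2
  end].

Lemma Fm_lin c r s : Fm (c *: r + s) = c *: Fm r + Fm s.
Proof. by apply/matrixP => i k; rewrite !mxE !ffunE. Qed.

Lemma Hm_lin c r s a : Hm (c *: r + s) a = c *: Hm r a + Hm s a.
Proof. by apply/matrixP => i k; rewrite !mxE !ffunE. Qed.

Lemma rF_lin c r s : rF (c *: r + s) = c *: rF r + rF s.
Proof.
rewrite /rF Fm_lin linearP mulmxDl mulmxDr -scalemxAl -scalemxAr.
by rewrite scalerBr opprD addrACA.
Qed.

Lemma rH_lin c r s a : rH (c *: r + s) a = c *: rH r a + rH s a.
Proof.
rewrite /rH Fm_lin Hm_lin !(linearP (@twist m m')) !mulmxDl !mulmxDr -!scalemxAl -!scalemxAr.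
rewrite !scalerBr !opprD !opprK.
by rewrite [X in X + _ = _]addrACA [X in _ + X = _]addrACA [LHS]addrACA.
Qed.

Lemma rdiff_is_linear : linear rdiff.
Proof.
move=> c r s; apply/ffunP => -[[a|] [i k]]; rewrite !ffunE /=.
  by rewrite rH_lin !mxE.
by rewrite rF_lin !mxE.
Qed.

HB.instance Definition _ := GRing.isLinear.Build K V V *:%R rdiff rdiff_is_linear.

Lemma FmK r : Fm (rdiff r) = rF r.
Proof. by apply/matrixP => i k; rewrite mxE ffunE. Qed.

Lemma HmK r a : Hm (rdiff r) a = rH r a.
Proof. by apply/matrixP => i k; rewrite mxE ffunE. Qed.

(** The generators of the standard resolution at the arrows have degree one
less than the basis element they come from, whence the correction. *)
Definition rdeg (j : rindex m m') : int :=
  ddeg j.2.2 - ddeg j.2.1 + (j.1 != None)%:Z.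

(** The entries that respect the vertices; keeping the others, as zeros,
allows plain matrix multiplication. *)
Definition rmask (j : rindex m m') : bool :=
  match j.1 with
  | None => dvtx j.2.1 == dvtx j.2.2
  | Some a => (dvtx j.2.1 == src a) && (dvtx j.2.2 == tgt a)
  end.

Definition rhom (p : int) r : Prop := forall j, rdeg j != p -> r j = 0.

Definition rmasked r : Prop := forall j, ~~ rmask j -> r j = 0.

Hypotheses (wm : matdata_wf m) (wm' : matdata_wf m').

Lemma rdiffK r : rdiff (rdiff r) = 0.
Proof.
have tF : twist (rF r) = - (twist (Fm r) *m dD m') + dD m *m Fm r.
  rewrite linearB /= twist_mulD // twist_Dmul // twistK opprK.
  by [].
have tH a : twist (rH r a) = - (twist (Hm r a) *m dD m') + dD m *m Hm r a
    - (Fm r *m dA m' a - dA m a *m Fm r).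
  rewrite !(linearB (@twist m m')) /= twist_mulD // twist_Dmul // twistK opprK.
  by rewrite twist_mulA // twist_Amul // !twistK.
have F0 : rF (rdiff r) = 0.
  rewrite {1}/rF FmK tF {1}/rF mulmxBl -(mulmxA (Fm r)) (dDD wm') mulmx0 sub0r.
  by rewrite mulmxDr mulmxN !mulmxA (dDD wm) mul0mx addr0 opprK addNr.
have H0 a : rH (rdiff r) a = 0.
  rewrite {1}/rH HmK FmK tF tH.
  have -> : rH r a *m dD m' = - (dD m *m twist (Hm r a) *m dD m')
      - (twist (Fm r) *m dA m' a *m dD m' - dA m a *m twist (Fm r) *m dD m').
    by rewrite /rH !mulmxBl -(mulmxA (Hm r a)) (dDD wm') mulmx0 sub0r.
  rewrite !(mulmxBr, mulmxDr, mulmxDl, mulmxN, mulNmx) !mulmxA (dDD wm) !mul0mx addr0.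
  rewrite -(mulmxA _ (dA m' a) (dD m')) -(dDA wm') mulmxA (dDA wm).
  have aux (x p q u v : 'M[K]_(dN m, dN m')) :
      - x - (p - q) - (- x - (u - v)) - (- p + u - (- q + v)) = 0.
    by apply/matrixP => i k; rewrite !mxE; ring.
  exact: aux.
apply/ffunP => -[[a|] [i k]]; rewrite !ffunE /=; first by rewrite H0 mxE.
by rewrite F0 mxE.
Qed.

(** The matrices of m and m' respect degrees and vertices, so an entry of the
differential only depends on the entries one degree below with the same mask. *)
Lemma rdiff_local r s j :
  (forall j', rdeg j = rdeg j' + 1 -> rmask j' = rmask j -> r j' = s j') ->
  rdiff r j = rdiff s j.
Proof.
move=> H.
have mulr_eq (x y z : K) : (z != 0 -> x = y) -> x * z = y * z.
  by have [->|z0] := eqVneq z 0; [rewrite !mulr0 | move=> ->].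
have mull_eq (x y z : K) : (z != 0 -> x = y) -> z * x = z * y.
  by have [->|z0] := eqVneq z 0; [rewrite !mul0r | move=> ->].
case: j H => -[a|] [i k] H; rewrite !ffunE /= !mxE; last first.
  congr (_ - _); apply: eq_bigr => l _.
    rewrite !mxE; apply: mulr_eq => nz; apply: H; rewrite /rdeg /rmask /=.
      by rewrite (dD_deg wm' nz); lia.
    by rewrite (dD_vtx wm' nz).
  rewrite !mxE; apply: mull_eq => nz; congr (_ * _); apply: H; rewrite /rdeg /rmask /=.
    by rewrite (dD_deg wm nz); lia.
  by rewrite (dD_vtx wm nz).
congr (_ - _ - (_ - _)); apply: eq_bigr => l _; rewrite !mxE.
- apply: mulr_eq => nz; apply: H; rewrite /rdeg /rmask /=.
    by rewrite (dD_deg wm' nz); lia.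
  by rewrite (dD_vtx wm' nz).
- apply: mull_eq => nz; congr (_ * _); apply: H; rewrite /rdeg /rmask /=.
    by rewrite (dD_deg wm nz); lia.
  by rewrite (dD_vtx wm nz).
- apply: mulr_eq => nz; congr (_ * _); apply: H; rewrite /rdeg /rmask /=.
    by rewrite (dA_deg wm' nz); lia.
  by rewrite (dA_src wm' nz) (dA_tgt wm' nz) eqxx andbT.
apply: mull_eq => nz; congr (_ * _); apply: H; rewrite /rdeg /rmask /=.
  by rewrite (dA_deg wm nz); lia.
by rewrite (dA_src wm nz) (dA_tgt wm nz) eqxx eq_sym.
Qed.

Lemma rdiff_masked r : rmasked r -> rmasked (rdiff r).
Proof.
move=> H j nj; have -> : rdiff r j = rdiff 0 j; last by rewrite linear0 ffunE.
by apply: rdiff_local => j' _ e; rewrite H ?ffunE // e.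
Qed.

Definition rproj (p : int) r : V := [ffun j => if rdeg j == p then r j else 0].

Lemma rproj_rdiff p r : rdiff (rproj p r) = rproj (p + 1) (rdiff r).
Proof.
apply/ffunP => j; rewrite [RHS]ffunE; case: eqVneq => [ej|ne].
  apply: rdiff_local => j' e _; rewrite ffunE.
  by case: eqVneq => // ne; rewrite e in ej; move/addIr: ej ne => ->; rewrite eqxx.
have -> : rdiff (rproj p r) j = rdiff 0 j; last by rewrite linear0 ffunE.
apply: rdiff_local => j' e _; rewrite !ffunE.
by case: eqVneq => // e'; rewrite e e' eqxx in ne.
Qed.

Lemma rproj_hom p r : rhom p (rproj p r).
Proof. by move=> j /negbTE e; rewrite ffunE e. Qed.

Lemma rhom_proj p r : rhom p r -> rproj p r = r.
Proof.
by move=> H; apply/ffunP => j; rewrite ffunE; case: eqVneq => // /H ->.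
Qed.

Lemma rproj_masked p r : rmasked r -> rmasked (rproj p r).
Proof. by move=> H j /H e; rewrite ffunE e if_same. Qed.

Lemma rdiff_hom p r : rhom p r -> rhom (p + 1) (rdiff r).
Proof. by move=> /rhom_proj <-; rewrite rproj_rdiff; apply: rproj_hom. Qed.

Definition rexact (p : int) : Prop := forall r, rmasked r -> rhom p r ->
  rdiff r = 0 -> exists s, [/\ rmasked s, rhom (p - 1) s & r = rdiff s].

Definition rspan (b : bool) : {vspace V} :=
  coord_space K (fun j => rmask j && (parity (rdeg j) == b)).

Lemma rspanP b r : reflect (rmasked r /\ forall j, parity (rdeg j) != b -> r j = 0)
  (r \in rspan b).
Proof.
apply: (iffP (coord_spaceP _ _)) => [H|[H1 H2] j].
  by split=> j nj; apply: H; rewrite ?(negbTE nj) // andbF.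
by rewrite negb_and => /orP[/H1|/H2].
Qed.

Lemma rhom_span p r : rmasked r -> rhom p r -> r \in rspan (parity p).
Proof.
move=> mr hr; apply/rspanP; split=> // j nj; apply: hr.
by apply: contraNneq nj => ->.
Qed.

Lemma rproj_sum r : r = \sum_(p <- undup (codom rdeg)) rproj p r.
Proof.
apply/ffunP => j; rewrite sum_ffunE.
rewrite (bigD1_seq (rdeg j)) ?undup_uniq ?mem_undup ?codom_f //=.
rewrite ffunE eqxx big1 ?addr0 // => p ne.
by rewrite ffunE eq_sym (negbTE ne).
Qed.

Local Notation d := (linfun rdiff).

Lemma rdiff_span b : (d @: rspan b <= rspan (~~ b) :&: lker d)%VS.
Proof.
apply/subvP => _ /memv_imgP[r /rspanP[mr pr] ->].
rewrite memv_cap memv_ker !lfunE /= rdiffK eqxx andbT.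
apply/rspanP; split=> [|j nj]; first exact: rdiff_masked.
have -> : rdiff r j = rdiff 0 j; last by rewrite linear0 ffunE.
apply: rdiff_local => j' e _; rewrite pr ?ffunE //; apply: contra nj.
by rewrite e parityD addbT => /eqP ->.
Qed.

Lemma rexact_img b r : (forall p, parity p = b -> rproj p r \in (d @: rspan (~~ b))%VS) ->
  r \in rspan b -> r \in (d @: rspan (~~ b))%VS.
Proof.
move=> H /rspanP[mr pr]; rewrite (rproj_sum r); apply: memv_suml => p _.
have [/H//|/eqP ne] := eqVneq (parity p) b.
suff -> : rproj p r = 0 by exact: mem0v.
apply/ffunP => j; rewrite !ffunE; case: eqP => // e; apply: pr.
by rewrite e; apply/eqP.
Qed.

Lemma rexact_proj p r : rexact p -> rmasked r -> rdiff r = 0 ->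
  rproj p r \in (d @: rspan (~~ parity p))%VS.
Proof.
move=> ex mr dr.
have [|||s [ms hs ->]] := ex (rproj p r); [exact: rproj_masked|exact: rproj_hom| |].
  by rewrite rproj_rdiff dr; apply/ffunP => j; rewrite !ffunE if_same.
rewrite -[rdiff s]lfunE; apply: memv_img.
have -> : ~~ parity p = parity (p - 1) by rewrite parityD addbT.
exact: rhom_span.
Qed.

Definition reuler : int := \sum_(j | rmask j) (-1) ^+ parity (rdeg j).

Lemma reulerE : reuler = (\dim (rspan false))%:Z - (\dim (rspan true))%:Z.
Proof.
rewrite !dim_coord_space /reuler (bigID (fun j => parity (rdeg j))) /= addrC.
under eq_bigr => j /andP[_ /negbTE ->] do rewrite expr0.
under [X in _ + X]eq_bigr => j /andP[_ ->] do rewrite expr1.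
rewrite !sumr_const mulNrn !natz; congr (Posz _ - Posz _).
  by apply: eq_card => j; rewrite -!topredE /=; case: parity.
by apply: eq_card => j; rewrite -!topredE /= eqb_id.
Qed.

Hypothesis ex : forall p, p != 0 -> rexact p.

Let odd_exact : (rspan true :&: lker d <= d @: rspan false)%VS.
Proof.
apply/subvP => r /memv_capP[rU]; rewrite memv_ker lfunE => /eqP dr.
have [mr _] := rspanP _ _ rU; apply: rexact_img rU => p pt.
have ne : p != 0 by apply: contraTneq pt => ->.
by have := rexact_proj (ex ne) mr dr; rewrite pt.
Qed.

Let even_part r : r \in (rspan false :&: lker d)%VS ->
  rproj 0 r \in (d @: rspan true)%VS -> r \in (d @: rspan true)%VS.
Proof.
move=> /memv_capP[rU]; rewrite memv_ker lfunE => /eqP dr r0.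
have [mr _] := rspanP _ _ rU; apply: rexact_img rU => p pf.
have [->//|ne] := eqVneq p 0.
by have := rexact_proj (ex ne) mr dr; rewrite pf.
Qed.

Lemma reuler_exact : rexact 0 -> reuler = 0.
Proof.
move=> ex0; rewrite reulerE.
rewrite (euler_exact (rdiff_span false) (rdiff_span true) odd_exact) ?subrr //.
apply/subvP => r rU; apply: (even_part rU).
have /memv_capP[/rspanP[mr _]] := rU; rewrite memv_ker lfunE => /eqP dr.
exact: rexact_proj.
Qed.

(** By the hypothesis on the other degrees the homology is concentrated in
degree 0, where it is spanned by the class of r. *)
Lemma reuler_line r : rmasked r -> rhom 0 r -> rdiff r = 0 ->
  ~ (exists s, [/\ rmasked s, rhom (- 1) s & r = rdiff s]) ->
  (forall t, rmasked t -> rhom 0 t -> rdiff t = 0 ->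
     exists c s, [/\ rmasked s, rhom (- 1) s & t - c *: r = rdiff s]) ->
  reuler = 1.
Proof.
move=> mr hr dr nr H; rewrite reulerE.
have rU : r \in (rspan false :&: lker d)%VS.
  by rewrite memv_cap memv_ker lfunE /= dr eqxx andbT; apply: (rhom_span mr hr).
rewrite (euler_line (rdiff_span false) (rdiff_span true) odd_exact rU).
- by rewrite -addn1 PoszD addrC addKr.
- apply/negP => /memv_imgP[s /rspanP[ms _]]; rewrite lfunE => es.
  apply: nr; exists (rproj (- 1) s); split; [exact: rproj_masked|exact: rproj_hom|].
  by rewrite rproj_rdiff addNr -es rhom_proj.
apply/subvP => t tU; have /memv_capP[/rspanP[mt _]] := tU.
rewrite memv_ker lfunE => /eqP dt.
have [|||c [s [ms hs es]]] := H (rproj 0 t); [exact: rproj_masked|exact: rproj_hom| |].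
  by rewrite rproj_rdiff dt; apply/ffunP => j; rewrite !ffunE if_same.
rewrite -[t](subrK (c *: r)) addrC; apply: memv_add; first by apply: memvZ; apply: memv_line.
apply: even_part; first by rewrite rpredB // memvZ.
have -> : rproj 0 (t - c *: r) = rproj 0 t - c *: r.
  rewrite -{2}(rhom_proj hr); apply/ffunP => j; rewrite !ffunE.
  by case: ifP => // _; rewrite scaler0 subr0.
rewrite es -[rdiff s]lfunE; apply: memv_img; exact: (rhom_span ms hs).
Qed.

End RComplex.

(** The class of a complex in the Grothendieck group. *)
Definition dimvec (m : matdata) (v : vertex Q) : int :=
  \sum_(i | dvtx i == v :> vertex Q) (-1) ^+ parity (ddeg (m := m) i).

Definition euler_form (x y : vertex Q -> int) : int :=
  \sum_v x v * y v - \sum_(a : arrow Q) x (src a) * y (tgt a).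

Lemma sum_option (V : nmodType) (T : finType) (F : option T -> V) :
  \sum_o F o = F None + \sum_t F (Some t).
Proof.
rewrite (perm_big (None :: map Some (index_enum T))) ?big_cons ?big_map //.
apply: uniq_perm; first exact: index_enum_uniq.
  rewrite /= map_inj_uniq ?index_enum_uniq ?andbT; last by move=> ? ? [].
  by apply/mapP => -[].
move=> [t|]; rewrite mem_index_enum ?inE //=.
by rewrite mem_map ?mem_index_enum //; move=> ? ? [].
Qed.

(** Count the entries with signs: pairs of basis elements at the same vertex,
and for every arrow the pairs at its two ends, whose degree is raised by one. *)
Lemma reuler_form m m' : reuler m m' = euler_form (dimvec m) (dimvec m').
Proof.
pose F o i k : int := if rmask (m := m) (m' := m') (o, (i, k))
  then (-1) ^+ parity (rdeg (m := m) (m' := m') (o, (i, k))) else 0.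
have -> : reuler m m' = \sum_o \sum_i \sum_k F o i k.
  rewrite /reuler big_mkcond /=.
  under [RHS]eq_bigr => o _ do rewrite pair_bigA.
  by rewrite pair_bigA; apply: eq_bigr => -[o [i k]].
have dd v w : dimvec m v * dimvec m' w = \sum_i \sum_k
    (if (dvtx i == v) && (dvtx k == w) then
      (-1) ^+ parity (ddeg (m := m') k - ddeg (m := m) i) else 0).
  rewrite /dimvec big_mkcond /= mulr_suml; apply: eq_bigr => i _.
  rewrite [X in _ * X]big_mkcond /= mulr_sumr; apply: eq_bigr => k _.
  case: eqP => _; case: eqP => _; rewrite ?mul0r ?mulr0 // -signr_addb.
  by congr (_ ^+ nat_of_bool _); rewrite /parity; lia.
rewrite sum_option /euler_form; congr (_ + _).
  under [RHS]eq_bigr => v _ do rewrite dd.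
  rewrite [RHS]exchange_big; apply: eq_bigr => i _.
  rewrite [RHS]exchange_big; apply: eq_bigr => k _ /=.
  rewrite (bigD1 (dvtx i)) //= eqxx /= [X in _ = _ + X]big1 ?addr0 => [|v ne].
    by rewrite /F /rmask /rdeg /= addr0 eq_sym.
  by rewrite eq_sym (negbTE ne).
rewrite -sumrN; apply: eq_bigr => a _; rewrite dd -sumrN; apply: eq_bigr => i _.
rewrite -sumrN; apply: eq_bigr => k _; rewrite /F /rmask /rdeg /=.
by case: ifP => _; rewrite ?oppr0 // sign_parity1.
Qed.

End MatrixData.

(** * Morphisms as homology classes of matrices *)

Section ShiftMatrixData.
Variables (K : fieldType) (Q : quiver).
Implicit Types m : matdata K Q.

Definition mshift m : matdata K Q :=
  @MatData K Q (dN m) (fun i => ddeg i - 1) (@dvtx _ _ m) (- dD m) (@dA _ _ m).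

(** The shift only changes the signs in the differential. *)
Lemma rexact_shiftr m m' p : rexact m (mshift m') p -> rexact m m' (p + 1).
Proof.
move=> ex r mr hr dr.
have tw (f : 'M[K]_(dN m, dN m')) :
    @twist _ _ m (mshift m') f = - @twist _ _ m m' f.
  by apply/matrixP => i k; rewrite !mxE /= addrA -mulNr -sign_parityB1.
have dE (s : rspace m m') : @rdiff _ _ m (mshift m') s = - @rdiff _ _ m m' s.
  apply/ffunP => -[[a|] [i k]]; rewrite !ffunE /=.
    by rewrite /rH !tw /= !(mulmxN, mulNmx) !mxE; ring.
  by rewrite /rF !tw /= !(mulmxN, mulNmx) !mxE; ring.
have degE (j : rindex m m') : @rdeg _ _ m (mshift m') j = @rdeg _ _ m m' j - 1.
  by rewrite /rdeg /=; lia.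
have [||s [ms hs es]] := ex r mr.
- by move=> j nj; apply: hr; apply: contraNneq nj => e; rewrite degE e addrK.
- by rewrite dE dr oppr0.
exists (- s); split=> [j nj|j nj|].
- by rewrite ffunE ms // oppr0.
- rewrite ffunE hs ?oppr0 //; apply: contraNneq nj => e.
  by apply/eqP; move: e; rewrite degE; lia.
by rewrite linearN /= es dE.
Qed.

Lemma rexact_shiftl m m' p : rexact (mshift m) m' p -> rexact m m' (p - 1).
Proof.
move=> ex r mr hr dr.
(* a sign at the arrows makes up for the sign changes of the shift *)
pose tau (s : rspace m m') : rspace m m' :=
  [ffun j => if j.1 is Some _ then - s j else s j].
have FT s : @Fm _ _ m m' (tau s) = @Fm _ _ m m' s.
  by apply/matrixP => i k; rewrite !mxE ffunE.
have HT s a : @Hm _ _ m m' (tau s) a = - @Hm _ _ m m' s a.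
  by apply/matrixP => i k; rewrite !mxE ffunE.
have tw (f : 'M[K]_(dN m, dN m')) :
    @twist _ _ (mshift m) m' f = - @twist _ _ m m' f.
  by apply/matrixP => i k; rewrite !mxE /= addrAC -mulNr -sign_parityB1.
have dE (s : rspace m m') : @rdiff _ _ (mshift m) m' (tau s) = tau (@rdiff _ _ m m' s).
  apply/ffunP => -[[a|] [i k]]; rewrite !ffunE /=.
    rewrite /rH -[@Fm _ _ (mshift m) m' _]/(@Fm _ _ m m' _) FT.
    rewrite -[@Hm _ _ (mshift m) m' _ _]/(@Hm _ _ m m' _ _) HT !tw !(linearN (@twist _ _ m m')) /=.
    by rewrite !(mulmxN, mulNmx) !mxE; ring.
  rewrite /rF -[@Fm _ _ (mshift m) m' _]/(@Fm _ _ m m' _) FT !tw /=.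
  by rewrite !(mulmxN, mulNmx) !mxE; ring.
have tauK s : tau (tau s) = s.
  by apply/ffunP => -[[a|] ik]; rewrite !ffunE /= ?opprK.
have tau0 (s : rspace m m') j : s j = 0 -> tau s j = 0.
  by rewrite ffunE => ->; case: j.1; rewrite ?oppr0.
have degE (j : rindex m m') : @rdeg _ _ (mshift m) m' j = @rdeg _ _ m m' j + 1.
  by rewrite /rdeg /=; lia.
have [|||s [ms hs es]] := ex (tau r).
- by move=> j nj; apply: tau0; apply: mr.
- by move=> j nj; apply: tau0; apply: hr; apply: contraNneq nj => e; rewrite degE e subrK.
- by rewrite dE dr; apply/ffunP => j; rewrite tau0 ?ffunE.
exists (tau s); split=> [j nj|j nj|].
- by apply: tau0; apply: ms.
- apply: tau0; apply: hs; apply: contraNneq nj => e.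
  by apply/eqP; move: e; rewrite degE; lia.
by rewrite -[r]tauK es -[s in LHS]tauK dE tauK.
Qed.

End ShiftMatrixData.

Section Dictionary.
Variables (K : fieldType) (Q : quiver) (B : kalgebra K) (pp : presentation Q B).
Local Notation ks := (kscalar B).
Local Notation e := (pres_e pp).
Local Notation ar := (pres_a pp).

Definition mdata (X : bcomplex B) (m : model pp X) : matdata K Q :=
  @MatData K Q (mN m) (@mdeg _ _ _ _ _ m) (@mvtx _ _ _ _ _ m)
    (\matrix_(i, k) mD i k) (fun a => \matrix_(i, k) mA a i k).

Lemma mdata_wf (X : bcomplex B) (m : model pp X) : matdata_wf (mdata m).
Proof.
split=> /=.
- move=> i k; rewrite mxE; apply: contra_neq_eq => ne; exact: mD_deg.
- move=> i k; rewrite mxE; apply: contra_neq_eq => ne; exact: mD_vtx.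
- move=> a i k; rewrite mxE; apply: contra_neq_eq => ne; exact: mA_deg.
- move=> a i k; rewrite mxE; apply: contra_neq_eq => ne; exact: mA_src.
- move=> a i k; rewrite mxE; apply: contra_neq_eq => ne; exact: mA_tgt.
- apply/matrixP => i l; rewrite !mxE -[RHS](mDD i l).
  by apply: eq_bigr => k _; rewrite !mxE.
move=> a; apply/matrixP => i l; rewrite !mxE.
under eq_bigr => k _ do rewrite !mxE.
by rewrite mDA; apply: eq_bigr => k _; rewrite !mxE.
Qed.

Definition smodel (X : bcomplex B) (m : model pp X) : model pp (cpx_shift X).
Proof.
apply: (@Model _ _ _ _ (cpx_shift X) (mN m) (fun i => mdeg i - 1)
  (@mvtx _ _ _ _ _ m) (fun j i => @mbas _ _ _ _ _ m (j + 1) i)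
  (fun j x => @mcrd _ _ _ _ _ m (j + 1) x)) => /=.
- by move=> j i ne; apply: mbas_deg; apply: contraNneq ne => ->; rewrite addrK.
- by move=> j i; apply: mbas_vtx.
- by move=> j x; apply: mcrdE.
- by move=> j x i ne; apply: mcrd_deg; apply: contraNneq ne => ->; rewrite addrK.
by move=> j c c0 i ei; apply: (mfree c0); rewrite -ei subrK.
Defined.

Lemma mdata_shift (X : bcomplex B) (m : model pp X) :
  mdata (smodel m) = mshift (mdata m).
Proof.
have bE i : mdeg i - 1 + 1 = mdeg i :> int by rewrite subrK.
rewrite /mdata /mshift /=; congr MatData.
  apply/matrixP => i k; rewrite !mxE.
  have E : diff X (mdeg i - 1 + 1) (@mbas _ _ _ _ _ m (mdeg i - 1 + 1) i) =
      \sum_l ks (mD i l) *: @mbas _ _ _ _ _ m (mdeg i - 1 + 1 + 1) l.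
    exact: diff_bas.
  rewrite {1}/mD /= /shift_diff_fun E -scaleN1r -(rmorphN1 ks) mcrdZ mulN1r.
  congr (- _); have [ek|ne] := eqVneq (mdeg k) (mdeg i - 1 + 1 + 1).
    by rewrite mcrd_sum.
  by rewrite mcrd_deg // -[RHS]/(mD i k) mD_deg //; move: ne; rewrite bE.
apply/funext => a; apply/matrixP => i k; rewrite !mxE {1}/mA /=.
rewrite arrow_bas; have [ek|ne] := eqVneq (mdeg k) (mdeg i - 1 + 1).
  by rewrite mcrd_sum.
by rewrite mcrd_deg // -[RHS]/(mA a i k) mA_deg //; move: ne; rewrite bE.
Qed.

Section Combinations.
Variables (Y : bcomplex B) (m : model pp Y).
Local Notation bas := (@mbas _ _ _ _ _ m).

Definition comb (j : int) (c : 'I_(mN m) -> K) : Y j := \sum_k ks (c k) *: bas j k.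

Lemma eq_comb j (c d : 'I_(mN m) -> K) : c =1 d -> comb j c = comb j d.
Proof. by move=> E; apply: eq_bigr => k _; rewrite E. Qed.

Lemma comb_sum j (J : finType) (x : J -> K) (c : J -> 'I_(mN m) -> K) :
  \sum_q ks (x q) *: comb j (c q) = comb j (fun k => \sum_q x q * c q k).
Proof.
under eq_bigr => q _ do rewrite scaler_sumr.
rewrite exchange_big; apply: eq_bigr => k _.
rewrite rmorph_sum scaler_suml; apply: eq_bigr => q _.
by rewrite scalerA -rmorphM.
Qed.

Lemma combD j c d : comb j c + comb j d = comb j (fun k => c k + d k).
Proof.
rewrite -big_split; apply: eq_bigr => k _ /=.
by rewrite -scalerDl -rmorphD.
Qed.

Lemma combB j c d : comb j c - comb j d = comb j (fun k => c k - d k).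
Proof.
rewrite -sumrB; apply: eq_bigr => k _ /=.
by rewrite -scalerBl -rmorphB.
Qed.

Lemma comb_diff j c :
  diff Y j (comb j c) = comb (j + 1) (fun l => \sum_k c k * mD k l).
Proof.
rewrite linear_sum -comb_sum; apply: eq_bigr => k _.
by rewrite linearZ_LR diff_bas.
Qed.

Lemma comb_arrow j a c :
  ar a *: comb j c = comb j (fun l => \sum_k c k * mA a k l).
Proof.
rewrite scaler_sumr -comb_sum; apply: eq_bigr => k _.
by rewrite ksC arrow_bas.
Qed.

Lemma comb_inj j c d k : mdeg k = j -> comb j c = comb j d -> c k = d k.
Proof.
move=> ek /eqP; rewrite -subr_eq0 combB => /eqP E.
by apply/eqP; rewrite -subr_eq0; apply/eqP; apply: (mfree E).
Qed.

Lemma crd_comb j (x : Y j) : comb j (@mcrd _ _ _ _ _ m j x) = x.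
Proof. by rewrite /comb -mcrdE. Qed.

End Combinations.

Section Pair.
Variables (X Y : bcomplex B) (m : model pp X) (m' : model pp Y).
Local Notation M := (mdata m).
Local Notation M' := (mdata m').
Local Notation V := (rspace M M').
Local Notation bas := (@mbas _ _ _ _ _ m').
Local Notation P := (res_cpx m).
Local Notation R := (res_data m).
Implicit Types r s t : V.

Definition rrow r (p : pidx R) (k : 'I_(mN m')) : K :=
  r (match p with inl i => (None, (i, k)) | inr (a, i) => (Some a, (i, k)) end).

(** The images of the generators of the resolution of X under the map with
matrices r. *)
Definition rfamily r (j : int) (p : pidx R) : Y j := @comb Y m' j (rrow r p).

Lemma rfamily_vtx r j i : rmasked r -> e (mvtx i) *: rfamily r j (inl i) = rfamily r j (inl i).
Proof.
move=> mr; rewrite scaler_sumr; apply: eq_bigr => k _ /=.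
rewrite ksC; have [E|ne] := eqVneq (mvtx i) (mvtx k); first by rewrite E mbas_vtx.
by rewrite /rrow mr ?rmorph0 ?scale0r //= /rmask /= ne.
Qed.

Lemma rfamily_arrow r j a i : rmasked r ->
  e (tgt a) *: rfamily r j (inr (a, i)) = rfamily r j (inr (a, i)).
Proof.
move=> mr; rewrite scaler_sumr; apply: eq_bigr => k _ /=.
rewrite ksC; have [E|ne] := eqVneq (mvtx k) (tgt a); first by rewrite -E mbas_vtx.
by rewrite /rrow mr ?rmorph0 ?scale0r //= /rmask /= (negbTE ne) andbF.
Qed.

Lemma rfamily_idem r j p : rmasked r -> pidem p *: rfamily r j p = rfamily r j p.
Proof.
move=> mr; case: p => [i|[a i]] /=; first exact: rfamily_vtx.
case: ifP => [_|ne]; first exact: rfamily_arrow.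
rewrite scale0r /rfamily /comb big1 // => k _.
by rewrite /rrow mr ?rmorph0 ?scale0r //= /rmask /= ne.
Qed.

Definition rcycle r : Prop := [/\ rmasked r, rhom 0 r & rdiff r = 0].

Lemma twist_Fm p r : rhom p r -> twist (Fm r) = (-1) ^+ parity p *: Fm r.
Proof.
move=> hr; apply/matrixP => i k; rewrite !mxE.
have [E|/hr->] := eqVneq (@rdeg _ _ M M' (None, (i, k))) p; last by rewrite !mulr0.
congr (_ ^+ nat_of_bool _ * _); rewrite -E /rdeg /= /parity; lia.
Qed.

Lemma twist_Hm p r a : rhom p r -> twist (Hm r a) = - (-1) ^+ parity p *: Hm r a.
Proof.
move=> hr; apply/matrixP => i k; rewrite !mxE.
have [E|/hr->] := eqVneq (@rdeg _ _ M M' (Some a, (i, k))) p; last by rewrite !mulr0.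
rewrite -sign_parity1; congr (_ ^+ nat_of_bool _ * _).
by rewrite -E /rdeg /= /parity; lia.
Qed.

Lemma rfamily_diff_inl r j i : diff Y j (rfamily r j (inl i)) =
  comb (m := m') (j + 1) ((Fm r *m dD M') i).
Proof.
rewrite comb_diff; apply: eq_comb => l; rewrite !mxE.
by apply: eq_bigr => k _; rewrite !mxE.
Qed.

Lemma rfamily_diff_inr r j a i : diff Y j (rfamily r j (inr (a, i))) =
  comb (m := m') (j + 1) ((Hm r a *m dD M') i).
Proof.
rewrite comb_diff; apply: eq_comb => l; rewrite !mxE.
by apply: eq_bigr => k _; rewrite !mxE.
Qed.

Lemma rfamily_D_inl r j i : \sum_k ks (mD i k) *: rfamily r j (inl k) =
  comb (m := m') j ((dD M *m Fm r) i).
Proof.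
rewrite comb_sum; apply: eq_comb => l; rewrite !mxE.
by apply: eq_bigr => k _; rewrite !mxE.
Qed.

Lemma rfamily_D_inr r j a i : \sum_k ks (mD i k) *: rfamily r j (inr (a, k)) =
  comb (m := m') j ((dD M *m Hm r a) i).
Proof.
rewrite comb_sum; apply: eq_comb => l; rewrite !mxE.
by apply: eq_bigr => k _; rewrite !mxE.
Qed.

Lemma rfamily_A r j a i : \sum_k ks (mA a i k) *: rfamily r j (inl k) =
  comb (m := m') j ((dA M a *m Fm r) i).
Proof.
rewrite comb_sum; apply: eq_comb => l; rewrite !mxE.
by apply: eq_bigr => k _; rewrite !mxE.
Qed.

Lemma rfamily_a r j a i : ar a *: rfamily r j (inl i) =
  comb (m := m') j ((Fm r *m dA M' a) i).
Proof.
rewrite comb_arrow; apply: eq_comb => l; rewrite !mxE.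
by apply: eq_bigr => k _; rewrite !mxE.
Qed.

Lemma rcycle_family r : rcycle r -> @proj_family B R Y (rfamily r).
Proof.
move=> [mr hr dr].
have p0 : parity 0 = false by [].
have tF : twist (Fm r) = Fm r by rewrite (twist_Fm hr) p0 expr0 scale1r.
have F0 : Fm r *m dD M' = dD M *m Fm r.
  have : rF r = 0 by rewrite -FmK dr; apply/matrixP => i k; rewrite !mxE ffunE.
  by rewrite /rF tF => /eqP; rewrite subr_eq0 => /eqP.
have H0 a : Hm r a *m dD M' = Fm r *m dA M' a - dA M a *m Fm r - dD M *m Hm r a.
  have : rH r a = 0 by rewrite -HmK dr; apply/matrixP => i k; rewrite !mxE ffunE.
  rewrite /rH tF (twist_Hm a hr) p0 expr0 scaleN1r mulmxN opprK.
  by move/eqP; rewrite subr_eq0 => /eqP <-; rewrite addrK.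
have H := @res_family _ _ _ _ _ m Y (fun j i => rfamily r j (inl i))
  (fun j a i => rfamily r j (inr (a, i))).
suff : @proj_family B R Y (fun j p => match p with
    inl i => rfamily r j (inl i) | inr (a, i) => rfamily r j (inr (a, i)) end).
  move=> F j p ep; have := F j p ep; case: p ep => [i|[a i]] ep ->;
    by apply: eq_bigr => -[k|[b k]] _.
apply: H => [j i _|j i _|j a i _|j a i _ si].
- exact: rfamily_vtx.
- by rewrite rfamily_diff_inl F0 rfamily_D_inl.
- exact: rfamily_arrow.
rewrite rfamily_diff_inr H0 rfamily_a rfamily_A rfamily_D_inr !combB.
by apply: eq_comb => k; rewrite !mxE.
Qed.

(** Homotopies in terms of matrices: the boundary of a family of degree -1. *)
Lemma rfamily_boundary t j p : rmasked t -> rhom (- 1) t -> pdeg p = j + 1 ->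
  pidem p *: diff Y j (rfamily t j p) + \sum_q pmx p q *: rfamily t (j + 1) q =
  comb (m := m') (j + 1) (rrow (rdiff t) p).
Proof.
move=> mt ht ep; rewrite sum_res.
have pN : parity (- 1) = true by [].
have tF : twist (Fm t) = - Fm t by rewrite (twist_Fm ht) pN expr1 scaleN1r.
have tH a : twist (Hm t a) = Hm t a by rewrite (twist_Hm a ht) pN expr1 opprK scale1r.
have eD i k : ks (mD i k) * e (mvtx k) *: rfamily t (j + 1) (inl k) =
    ks (mD i k) *: rfamily t (j + 1) (inl k).
  by rewrite -scalerA rfamily_vtx.
case: p ep => [i|[a i]] ep.
  rewrite [X in _ + (_ + X)]big1 ?addr0 => [|a _]; last first.
    by apply: big1 => k _; rewrite scale0r.
  rewrite -linearZ_LR (rfamily_idem _ (inl i)) // rfamily_diff_inl.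
  under eq_bigr => k _ do rewrite eD.
  rewrite rfamily_D_inl combD; apply: eq_comb => k.
  by rewrite /rrow ffunE /= /rF tF mulmxN opprK [RHS]mxE.
have [si|ns] := eqVneq (mvtx i) (src a); last first.
  rewrite /= (negbTE ns) scale0r add0r.
  rewrite big1 => [|k _]; last by rewrite scale0r.
  rewrite add0r big1 => [|b _]; last first.
    by apply: big1 => k _; rewrite andbF scale0r.
  rewrite /comb big1 // => k _; rewrite /rrow.
  rewrite (rdiff_masked (mdata_wf m) (mdata_wf m') mt) ?rmorph0 ?scale0r //.
  by rewrite /rmask /= (negbTE ns).
rewrite -linearZ_LR (rfamily_idem _ (inr (a, i))) // rfamily_diff_inr.
have -> : \sum_k pmx (p := R) (inr (a, i)) (inl k) *: rfamily t (j + 1) (inl k) =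
    comb (m := m') (j + 1) ((Fm t *m dA M' a) i) -
    comb (m := m') (j + 1) ((dA M a *m Fm t) i).
  rewrite -rfamily_a -rfamily_A /= si eqxx.
  under eq_bigr => k _ do rewrite scalerBl.
  rewrite sumrB; congr (_ - _).
    rewrite (bigD1 i) //= eqxx big1 ?addr0 // => k ne.
    by rewrite eq_sym (negbTE ne) scale0r.
  apply: eq_bigr => k _; have [ek|ne] := eqVneq (mvtx k) (tgt a); last first.
    by rewrite mA_tgt // rmorph0 mul0r !scale0r.
  by rewrite -scalerA -ek rfamily_vtx.
have -> : \sum_b \sum_k pmx (p := R) (inr (a, i)) (inr (b, k)) *:
    rfamily t (j + 1) (inr (b, k)) = - comb (m := m') (j + 1) ((dD M *m Hm t a) i).
  rewrite -rfamily_D_inr (bigD1 a) //= [X in _ + X = _]big1 ?addr0 => [|b ne]; last first.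
    by apply: big1 => k _; rewrite eq_sym (negbTE ne) scale0r.
  rewrite -sumrN; apply: eq_bigr => k _; rewrite si !eqxx /= scaleNr.
  by rewrite -scalerA rfamily_arrow.
rewrite combB combB combD; apply: eq_comb => k.
by rewrite /rrow ffunE /= /rH tF tH !(mulNmx, mulmxN) !mxE; ring.
Qed.

Definition rmap r (cr : rcycle r) : chain_map P Y := proj_map (rcycle_family cr).

Lemma rmap_gen r (cr : rcycle r) j p : pdeg p = j ->
  rmap cr j (@proj_gen _ R j p) = rfamily r j p.
Proof.
move=> ep; rewrite proj_mapE (bigD1 p) //= big1 => [|q ne]; last first.
  by rewrite ffunE (negbTE ne) scale0r.
by rewrite addr0 ffunE eqxx ep eqxx /= rfamily_idem //; case: cr.
Qed.

(** By projectivity of the resolution this identifies the morphisms from X to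
Y in the derived category with the homology in degree 0 of the complex of
matrices. *)
Lemma rmap_homotopic r s (cr : rcycle r) (cs : rcycle s) :
  homotopic (rmap cr) (rmap cs) <->
  exists t, [/\ rmasked t, rhom (- 1) t & r - s = rdiff t].
Proof.
rewrite proj_homotopicP; split=> [[k H]|[t [mt ht et]]]; last first.
  exists (fun j p => rfamily t j p) => j p ep.
  rewrite !rmap_gen // rfamily_boundary // combB; apply: eq_comb => l.
  by rewrite /rrow -et !ffunE.
pose idx (x : rindex M M') : pidx R :=
  if x.1 is Some a then inr (a, x.2.1) else inl x.2.1.
pose t : V := [ffun x => @mcrd _ _ _ _ _ m' _
  (pidem (idx x) *: k (pdeg (idx x) - 1) (idx x)) x.2.2].
have mt : rmasked t.
  move=> -[[a|] [i l]]; rewrite /rmask /= ffunE /=; last first.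
    move=> ne; apply: (@mcrd_vtx _ _ _ _ _ m' _ _ (@mvtx _ _ _ _ _ m i)); first by rewrite scalerA ee.
    by rewrite eq_sym.
  case: eqVneq => [si|_] /=; last by rewrite scale0r mcrd0.
  by apply: (@mcrd_vtx _ _ _ _ _ m'); rewrite scalerA ee.
have ht : rhom (- 1) t.
  move=> -[o [i l]] ne; rewrite ffunE mcrd_deg //; apply: contraNneq ne => /=.
  by case: o => [a|] /= E; apply/eqP; rewrite /rdeg /= E; lia.
have tE j p : pdeg p = j + 1 -> rfamily t j p = pidem p *: k j p.
  move=> ep; have ej : j = pdeg p - 1 by rewrite ep addrK.
  rewrite {}ej -[RHS](crd_comb m'); apply: eq_comb => l.
  by case: p {ep} => [i|[a i]]; rewrite /rrow ffunE.
exists t; split=> //.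
have bE j p : pdeg p = j + 1 -> comb (m := m') (j + 1) (rrow (r - s) p) =
    comb (m := m') (j + 1) (rrow (rdiff t) p).
  move=> ep; rewrite -rfamily_boundary //.
  have -> : comb (m := m') (j + 1) (rrow (r - s) p) =
      rfamily r (j + 1) p - rfamily s (j + 1) p.
    by rewrite combB; apply: eq_comb => l; rewrite /rrow !ffunE.
  rewrite -!(rmap_gen _ ep) H // tE // linearZ_LR scalerA pidemK; congr (_ + _).
  apply: eq_bigr => q _; have [eq|ne] := eqVneq (pdeg q) (pdeg p + 1).
    by rewrite tE ?eq ?ep // scalerA pmx_idr.
  by rewrite pmx_deg // !scale0r.
have [mr hr _] := cr; have [ms hs _] := cs.
apply/ffunP => -[o [i l]].
pose p := idx (o, (i, l)).
have rowE (u : V) : u (o, (i, l)) = rrow u p l by rewrite /p /rrow; case: o {p}.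
have [el|ne] := eqVneq (mdeg l) (pdeg p - 1 + 1); last first.
  have nd : @rdeg _ _ M M' (o, (i, l)) != 0.
    apply: contraNneq ne => E; apply/eqP; move: E.
    by rewrite /p /idx /rdeg; case: o {p rowE} => [a|] /=; lia.
  rewrite ffunE hr // ffunE hs // subr0.
  have := rdiff_hom (mdata_wf m) (mdata_wf m') ht; rewrite addNr => hd.
  by rewrite hd.
rewrite !rowE; apply: comb_inj el _; apply: bE.
by rewrite subrK.
Qed.

End Pair.
End Dictionary.

(** * The Euler form of an incidence family *)

(** Cayley-Hamilton, with the product written as a fold to be compared with
composites of chain maps. *)
Lemma annihilating_roots (K : closedFieldType) n (U : 'M[K]_n) :
  exists s : seq K, foldr (fun c M => M *m (U - c%:M)) 1%:M s = 0.
Proof.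
case: n U => [|n] U; first by exists [::]; apply: flatmx0.
have [s Hs] := closed_field_poly_normal (char_poly U); exists s.
rewrite (monicP (char_poly_monic U)) scale1r in Hs.
have := Cayley_Hamilton U; rewrite {}Hs rmorph_prod /= => H0.
suff -> : foldr (fun c M => M *m (U - c%:M)) 1%:M s =
    \prod_(c <- s) horner_mx U ('X - c%:P) by [].
elim: s {H0} => [|c s IHs]; first by rewrite big_nil.
rewrite big_cons /= IHs -!rmorph_prod /= -[U - _]/(U - c%:M).
rewrite -{2}[U]horner_mx_X -(horner_mx_C U) -rmorphB /=.
by rewrite -[_ *m _]/(_ * _) -!rmorphM mulrC.
Qed.

Section Derived.
Variables (K : closedFieldType) (Q : quiver) (B : kalgebra K) (pp : presentation Q B).
Local Notation ks := (kscalar B).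
Local Notation DB := (bounded_derived_category B).
Local Notation dmap f := (DMap f : @hom (derived_cat B) _ _).

Lemma chain_scale_linear X Y (k : K) (f : chain_map X Y) i :
  linear (fun x : X i => ks k *: f i x).
Proof. by move=> b x y; rewrite linearP scalerDr (ksC k b). Qed.

Lemma chain_scale_diff X Y (k : K) (f : chain_map X Y) i (x : X i) :
  mk_linear (@chain_scale_linear X Y k f (i + 1)) (diff X i x) =
  diff Y i (mk_linear (@chain_scale_linear X Y k f i) x).
Proof. by rewrite /mk_linear cmap_diff linearZ_LR. Qed.

Definition chain_scale X Y (k : K) (f : chain_map X Y) : chain_map (A := B) X Y :=
  ChainMap (@chain_scale_diff X Y k f).

Section Pair.
Variables (X Y : bcomplex B) (m : model pp X) (m' : model pp Y).
Local Notation M := (mdata m).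
Local Notation M' := (mdata m').
Local Notation P := (res_cpx m).

Lemma res_iso (C := derived_cat B) : @isomorphic C P X.
Proof.
exists (dmap (res_map m)); exists (DInv (res_quasi_iso m)).
by split; [apply: deq_invl | apply: deq_invr].
Qed.

Lemma rcycle0 : rcycle (0 : rspace M M').
Proof. by split=> [j _|j _|]; rewrite ?ffunE // linear0. Qed.

Lemma hom_trivial_rexact : @hom_trivial (derived_cat B) X Y -> rexact M M' 0.
Proof.
move=> T r mr hr dr; have cr : rcycle r by split.
have T' : @hom_trivial (derived_cat B) P Y.
  apply: hom_trivial_iso T; first by apply: isomorphic_sym; apply: res_iso.
  exact: isomorphic_refl.
have := hprojective_faithful (hprojective_proj (p := res_data m)) (T' (DMap (rmap cr)) (DMap (rmap rcycle0))).
move=> /rmap_homotopic[t [mt ht]]; rewrite subr0 => E.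
by exists t; split.
Qed.

End Pair.

Lemma hom_trivial_rexact_pos k X Y (m : model pp X) (m' : model pp Y) :
  @hom_trivial (derived_cat B) X (@shiftn DB k Y) -> rexact (mdata m) (mdata m') k%:Z.
Proof.
elim: k Y m' => [|k IHk] Y m' T; first exact: hom_trivial_rexact.
rewrite -addn1 PoszD; apply: rexact_shiftr; rewrite -mdata_shift; apply: IHk.
by move: T; rewrite /shiftn iterSr.
Qed.

Lemma hom_trivial_rexact_neg k X Y (m : model pp X) (m' : model pp Y) :
  @hom_trivial (derived_cat B) (@shiftn DB k X) Y -> rexact (mdata m) (mdata m') (- k%:Z).
Proof.
elim: k X m => [|k IHk] X m T; first exact: hom_trivial_rexact.
rewrite -addn1 PoszD opprD; apply: rexact_shiftl; rewrite -mdata_shift; apply: IHk.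
by move: T; rewrite /shiftn iterSr.
Qed.

Section ChainMatrix.
Variables (X Y : bcomplex B) (m : model pp X) (m' : model pp Y).

Definition chain_mx (f : chain_map X Y) : 'M[K]_(mN m, mN m') :=
  \matrix_(i, k) @mcrd _ _ _ _ _ m' _ (f (mdeg i) (@mbas _ _ _ _ _ m (mdeg i) i)) k.

Lemma chain_mx_bas (f : chain_map X Y) j i :
  f j (@mbas _ _ _ _ _ m j i) = comb (m := m') j (chain_mx f i).
Proof.
have [<-|ne] := eqVneq (mdeg i) j.
  by rewrite -[LHS](crd_comb m'); apply: eq_comb => k; rewrite mxE.
rewrite mbas_deg // linear0 /comb big1 // => k _; rewrite mxE.
have [ek|nk] := eqVneq (mdeg k) j; last by rewrite (mbas_deg nk) scaler0.
by rewrite mcrd_deg ?rmorph0 ?scale0r // ek eq_sym.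
Qed.

Lemma chain_mxE (f : chain_map X Y) j (x : X j) :
  f j x = comb (m := m') j (fun k => \sum_i @mcrd _ _ _ _ _ m j x i * chain_mx f i k).
Proof.
rewrite {1}(mcrdE m x) linear_sum -comb_sum; apply: eq_bigr => i _.
by rewrite linearZ_LR chain_mx_bas.
Qed.

Lemma chain_mx_deg f i k : mdeg k != mdeg i -> chain_mx f i k = 0.
Proof. by move=> ne; rewrite mxE mcrd_deg. Qed.

(** A chain map commutes with the arrows strictly, hence the zero homotopies. *)
Definition chain_cycle (f : chain_map X Y) : rspace (mdata m) (mdata m') :=
  [ffun x => if x.1 is None then chain_mx f x.2.1 x.2.2 else 0].

Lemma chain_cycleP f : rcycle (chain_cycle f).
Proof.
have FE : Fm (chain_cycle f) = chain_mx f.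
  by apply/matrixP => i k; rewrite mxE ffunE.
have HE a : Hm (chain_cycle f) a = 0.
  by apply/matrixP => i k; rewrite !mxE ffunE.
have hr : rhom 0 (chain_cycle f).
  move=> -[[a|] [i k]] ne; rewrite ffunE //=; apply: chain_mx_deg.
  by apply: contraNneq ne => E; rewrite /rdeg /= E; apply/eqP; lia.
have mr : rmasked (chain_cycle f).
  move=> -[[a|] [i k]] ne; rewrite ffunE //= mxE.
  apply: (@mcrd_vtx _ _ _ _ _ m' _ _ (@mvtx _ _ _ _ _ m i)).
    by rewrite -linearZ_LR mbas_vtx.
  by rewrite eq_sym.
split=> //; have tF : twist (Fm (chain_cycle f)) = Fm (chain_cycle f).
  by rewrite (twist_Fm hr) (_ : parity 0 = false) // expr0 scale1r.
have hd := rdiff_hom (mdata_wf m) (mdata_wf m') hr.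
apply/ffunP => x; rewrite [RHS]ffunE.
have [ex|/hd//] := eqVneq (rdeg x) (0 + 1).
case: x ex => -[a|] [i k]; rewrite /rdeg /= => ex; rewrite ffunE /= /rH /rF tF FE ?HE.
  have ek : mdeg k = mdeg i by lia.
  rewrite (linear0 (@twist _ _ (mdata m) (mdata m'))) mul0mx mulmx0 subrr sub0r !mxE.
  apply/eqP; rewrite oppr_eq0 subr_eq0; apply/eqP.
  have := linearZ_LR (f (mdeg i)) (pres_a pp a) (@mbas _ _ _ _ _ m (mdeg i) i).
  rewrite arrow_bas linear_sum chain_mx_bas comb_arrow.
  under eq_bigr => l _ do rewrite linearZ_LR chain_mx_bas.
  rewrite comb_sum => /(comb_inj ek) E.
  transitivity (\sum_l chain_mx f i l * mA a l k).
    by apply: eq_bigr => l _; rewrite !mxE.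
  by rewrite -E; apply: eq_bigr => l _; rewrite !mxE.
have ek : mdeg k = mdeg i + 1 by lia.
rewrite !mxE; apply/eqP; rewrite subr_eq0; apply/eqP.
have := cmap_diff f (@mbas _ _ _ _ _ m (mdeg i) i).
rewrite diff_bas linear_sum chain_mx_bas comb_diff.
under eq_bigr => l _ do rewrite linearZ_LR chain_mx_bas.
rewrite comb_sum => /(comb_inj ek) E.
transitivity (\sum_l chain_mx f i l * mD l k).
  by apply: eq_bigr => l _; rewrite !mxE.
by rewrite -E; apply: eq_bigr => l _; rewrite !mxE.
Qed.

Lemma rmap_chain_cycle f (c : rcycle (chain_cycle f)) j u :
  rmap c j u = f j (res_map m j u).
Proof.
rewrite !proj_mapE linear_sum; apply: eq_bigr => -[i|[a i]] _; rewrite linearZ_LR.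
  by rewrite chain_mx_bas; congr (_ *: _); apply: eq_comb => k; rewrite /rrow ffunE.
rewrite linear0 /rfamily /comb big1 ?scaler0 // => k _.
by rewrite /rrow ffunE rmorph0 scale0r.
Qed.

End ChainMatrix.
Section Scalars.
Variables (X : bcomplex B) (m : model pp X).
Hypothesis hX : hprojective X.

Let minus (f : chain_map X X) c := chain_sub f (chain_scale c (chain_id X)).

Let steps (f : chain_map X X) (s : seq K) : chain_map X X :=
  foldr (fun c g => chain_comp (minus f c) g) (chain_id X) s.

Let steps_crd f s j (x : X j) k : @mcrd _ _ _ _ _ m j (steps f s j x) k =
  \sum_i @mcrd _ _ _ _ _ m j x i * foldr (fun c M => M *m (chain_mx m m f - c%:M)) 1%:M s i k.
Proof.
elim: s k => [|c s IHs] k /=.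
  rewrite (bigD1 k) //= big1 ?addr0 => [|i ne]; last first.
    by rewrite mxE (negbTE ne) mulr0.
  by rewrite mxE eqxx mulr1.
set S := foldr _ _ _ in IHs *; pose U := chain_mx m m f.
rewrite -[mk_linear _ _]/(ks c *: steps f s j x).
rewrite -scaleNr -rmorphN mcrdD mcrdZ.
have -> : @mcrd _ _ _ _ _ m j (f j (steps f s j x)) k =
    \sum_l @mcrd _ _ _ _ _ m j (steps f s j x) l * U l k.
  rewrite (chain_mxE m m); have [ek|ne] := eqVneq (mdeg k) j; first by rewrite mcrd_sum.
  rewrite mcrd_deg // big1 // => l _.
  have [el|nl] := eqVneq (mdeg l) j; last by rewrite mcrd_deg // mul0r.
  by rewrite /U chain_mx_deg ?mulr0 // el.
rewrite IHs mulr_sumr; under [X in X + _ = _]eq_bigr => l _ do rewrite IHs mulr_suml.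
rewrite [X in X + _ = _]exchange_big -big_split; apply: eq_bigr => i _ /=.
rewrite mulmxBr mul_mx_scalar !mxE mulrBr mulr_sumr mulNr mulrCA; congr (_ - _).
by apply: eq_bigr => l _; rewrite mulrA.
Qed.

(** An endomorphism f satisfies a split polynomial, since it acts on a
finite-dimensional space over an algebraically closed field; so some f - c is
not invertible, and in the absence of noninvertible nonzero endomorphisms f = c. *)
Lemma local_scalar : ~ @hom_trivial (derived_cat B) X X ->
  (forall u : dmor X X, @is_iso (derived_cat B) _ _ u \/
     forall v w : dmor X X, deq (DComp u v) (DComp u w)) ->
  forall f : chain_map X X, exists c, homotopic f (chain_scale c (chain_id X)).
Proof.
move=> nt loc f; have [s Hs] := annihilating_roots (chain_mx m m f).
have steps0 j (x : X j) : steps f s j x = 0.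
  rewrite -[LHS](crd_comb m) /comb big1 // => k _.
  by rewrite steps_crd Hs big1 ?rmorph0 ?scale0r // => i _; rewrite mxE mulr0.
suff [c [_ Hc]] : exists c, c \in s /\ deq (DMap (minus f c)) (DMap (chain_zero X X)).
  by exists c; apply/homotopic_sub; apply: hprojective_faithful hX _ _ _ _.
apply: contrapT => H; apply: nt.
have iso_steps t : {subset t <= s} -> @is_iso (derived_cat B) _ _ (DMap (steps f t)).
  elim: t => [|c t IHt] sub /=; first exact: (@is_iso_id (derived_cat B)).
  apply: (@is_iso_heq (derived_cat B) _ _ _ _ (deq_sym (deq_comp _ _))).
  apply: (@is_iso_comp (derived_cat B)); last first.
    by apply: IHt => d dt; apply: sub; rewrite inE dt orbT.
  case: (loc (DMap (minus f c))) => // Z; case: H; exists c; split.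
    by apply: sub; rewrite mem_head.
  have := Z (DMap (chain_id X)) (DMap (chain_zero X X)) => E.
  apply: deq_trans (deq_sym (deq_idr _)) _; apply: deq_trans E _.
  apply: deq_trans (deq_sym (deq_comp _ _)) _; apply: deq_map => i x.
  exact: (linear0 (minus f c i)).
have [g [g1 g2]] := iso_steps s (fun _ => id).
have id0 : deq (DMap (chain_id X)) (DMap (chain_zero X X)).
  apply: deq_trans (deq_sym g2) _; have [h Hh] := hprojective_full hX g.
  apply: deq_trans (deq_cong (deq_refl _) Hh) _.
  apply: deq_trans (deq_sym (deq_comp _ _)) _; apply: deq_map => i x /=.
  exact: steps0.
have all0 (u : dmor X X) : deq u (DMap (chain_zero X X)).
  have [h Hh] := hprojective_full hX u.
  apply: deq_trans (deq_sym (deq_idr _)) _; apply: deq_trans (deq_cong Hh id0) _.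
  apply: deq_trans (deq_sym (deq_comp _ _)) _; apply: deq_map => i x /=.
  by rewrite linear0.
move=> u v; apply: deq_trans (all0 u) (deq_sym (all0 v)).
Qed.

End Scalars.

Section OneDimensional.
Variables (X Y : bcomplex B) (m : model pp X) (m' : model pp Y).

(** The class of g spans the homology in degree 0. Were it a boundary, all
multiples of g would be trivial, hence all morphisms from X to Y. *)
Lemma reuler_one (g : chain_map X Y) :
  ~ @hom_trivial (derived_cat B) X Y ->
  (forall u : dmor X Y, exists c, deq u (DMap (chain_scale c g))) ->
  (forall p, p != 0 -> rexact (mdata m) (mdata m') p) ->
  reuler (mdata m) (mdata m') = 1.
Proof.
move=> nt span ex.
pose r c := chain_cycle m m' (chain_scale c g).
have cr c : rcycle (r c) := chain_cycleP m m' _.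
have rE c : r c = c *: r 1.
  apply/ffunP => -[[a|] [i k]]; rewrite !ffunE /= ?scaler0 // !mxE.
  by rewrite -[chain_scale _ _ _ _]/(ks c *: g _ _) -[chain_scale 1 _ _ _]/(ks 1 *: g _ _)
    rmorph1 scale1r mcrdZ.
pose pi := res_map m; pose qpi := res_quasi_iso m.
have hP : hprojective (res_cpx m) by exact: hprojective_proj.
have rmapE c : deq (DMap (rmap (cr c))) (DComp (DMap (chain_scale c g)) (DMap pi)).
  by apply: deq_trans (deq_comp _ _); apply: deq_map => j u; apply: rmap_chain_cycle.
apply: (reuler_line (mdata_wf m) (mdata_wf m') ex (r := r 1)).
- by case: (cr 1).
- by case: (cr 1).
- by case: (cr 1).
- move=> [s [ms hs es]]; apply: nt.
  have c0 := rcycle0 m m'.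
  have /(homotopic_deq) h0 : homotopic (rmap (cr 1)) (rmap c0).
    by apply/rmap_homotopic; exists s; split; rewrite ?subr0.
  have g0 c : deq (DMap (chain_scale c g)) (DMap (chain_zero X Y)).
    apply: (deq_trans (v := DMap (chain_comp (chain_scale c (chain_id Y)) (chain_scale 1 g)))).
      apply: deq_map => i x; rewrite -[LHS]/(ks c *: g i x).
      by rewrite -[RHS]/(ks c *: (ks 1 *: g i x)) rmorph1 scale1r.
    apply: deq_trans (deq_comp _ _) _.
    have E : deq (DMap (chain_scale 1 g)) (DMap (chain_zero X Y)).
      apply: deq_trans (deq_sym (deq_idr _)) _.
      apply: deq_trans (deq_cong (deq_refl _) (deq_sym (deq_invr qpi))) _.
      apply: deq_trans (deq_assoc _ _ _) _.
      apply: deq_trans (deq_cong (deq_sym (rmapE 1)) (deq_refl _)) _.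
      apply: deq_trans (deq_cong h0 (deq_refl _)) _.
      apply: (deq_trans (v := DComp (DMap (chain_comp (chain_zero X Y) pi)) (DInv qpi))).
        apply: deq_cong (deq_refl _); apply: deq_map => j u.
        rewrite proj_mapE big1 //= => p _; rewrite /rfamily /comb big1 ?scaler0 // => k _.
        by rewrite /rrow; case: p => [i|[a i]]; rewrite ffunE rmorph0 scale0r.
      apply: deq_trans (deq_cong (deq_comp _ _) (deq_refl _)) _.
      apply: deq_trans (deq_sym (deq_assoc _ _ _)) _.
      apply: deq_trans (deq_cong (deq_refl _) (deq_invr qpi)) _.
      exact: deq_idr.
    apply: deq_trans (deq_cong (deq_refl _) E) _.
    apply: deq_trans (deq_sym (deq_comp _ _)) _; apply: deq_map => i x.
    by rewrite -[LHS]/(ks c *: (0 : Y i)) scaler0.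
  move=> u v; have [c Hc] := span u; have [d Hd] := span v.
  by apply: deq_trans Hc _; apply: deq_trans (g0 c) _;
    apply: deq_trans (deq_sym (g0 d)) _; apply: deq_sym.
move=> t mt ht dt; have ct : rcycle t by split.
have [c Hc] := span (DComp (DMap (rmap ct)) (DInv qpi)).
exists c; rewrite -rE; apply/(rmap_homotopic ct (cr c)).
apply: (hprojective_faithful hP); apply: deq_trans (deq_sym (rmapE c)).
apply: deq_trans (deq_cong Hc (deq_refl _)).
apply: deq_trans (deq_sym (deq_idr _)) _.
apply: deq_trans (deq_assoc _ _ _).
by apply: deq_cong (deq_refl _) (deq_sym (deq_invl _)).
Qed.

End OneDimensional.

(** The Euler form of two classes counts the dimensions of the morphisms to
all shifts with signs. Only the shift by zero contributes, and there the
morphisms form a line or vanish: they are obtained from one of them by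
endomorphisms, which are scalars by [local_scalar]. *)
Theorem incidence_family_euler (I : Type) (z : rel I) (X : I -> DB) :
  (forall x, z x x) -> incidence_family z X -> exists w : I -> vertex Q -> int,
    forall x y, euler_form (w x) (w y) = (z x y)%:Z.
Proof.
move=> zxx inc.
have mex (Y : bcomplex B) : exists _ : model pp Y, True.
  by have [m] := model_ex pp Y; exists m.
pose Y x : bcomplex B := res_cpx (projT1 (cid (mex (X x)))).
have {}inc : @incidence_family DB I z Y.
  by apply: incidence_family_iso inc => x; apply: isomorphic_sym; apply: res_iso.
pose m x : model pp (Y x) := projT1 (cid (mex (Y x))).
have hY x : hprojective (Y x) by exact: hprojective_proj.
exists (fun x => dimvec (mdata (m x))) => x y; rewrite -reuler_form.
have ex p : p != 0 -> rexact (mdata (m x)) (mdata (m y)) p.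
  case: p => [[|k]|k] // _.
    by apply: hom_trivial_rexact_pos; apply: (inc_pos inc).
  by rewrite NegzE; apply: hom_trivial_rexact_neg; apply: (inc_neg inc).
have [zxy|nz] := boolP (z x y); last first.
  rewrite (reuler_exact (mdata_wf _) (mdata_wf _) ex) //.
  by apply: hom_trivial_rexact; apply: (inc_zero inc).
have [g Hg] := inc_one inc zxy; have [g' Hg'] := hprojective_full (@hY x) g.
suff -> : reuler (mdata (m x)) (mdata (m y)) = 1 by [].
apply: (reuler_one (g := g')) => //.
  exact: (inc_nontrivial inc zxy).
move=> u; have [w Hw] := Hg u; have [f Hf] := hprojective_full (@hY x) w.
have [c Hc] := local_scalar (m x) (@hY x) (inc_nontrivial inc (zxx x)) (inc_local inc (x := x)) f.
exists c; apply: deq_trans Hw _; apply: deq_trans (deq_cong Hg' (deq_trans Hf (homotopic_deq Hc))) _.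
apply: deq_trans (deq_sym (deq_comp _ _)) _; apply: deq_map => i v.
exact: (linearZ_LR (g' i) (ks c) v).
Qed.

End Derived.

(** * Unique paths and quivers of type A *)

Definition reach (Q : quiver) (x y : vertex Q) : bool :=
  `[< exists p : qpath Q, psrc p = x /\ ptgt p = y >].

Definition parallel_unique (Q : quiver) : Prop := forall p q : qpath Q,
  psrc p = psrc q -> ptgt p = ptgt q -> p = q.

Section Reachability.
Variable Q : quiver.

Lemma reach_refl (x : vertex Q) : reach x x.
Proof. by apply/asboolP; exists (trivial_path x). Qed.

Lemma reach_trans (y x z : vertex Q) : reach x y -> reach y z -> reach x z.
Proof.
move=> /asboolP[p [sp tp]] /asboolP[q [sq tq]]; apply/asboolP.
have [r [_ sr tr _]] := @pcompP _ q p (etrans tp (esym sq)).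
by exists r; rewrite sr tr.
Qed.

Hypothesis uQ : parallel_unique Q.

Lemma reach_anti (x y : vertex Q) : reach x y -> reach y x -> x = y.
Proof.
move=> /asboolP[p [sp tp]] /asboolP[q [sq tq]].
have [r [_ sr tr ar]] := @pcompP _ q p (etrans tp (esym sq)).
have er : r = trivial_path x.
  by apply: uQ; [rewrite sr | rewrite tr].
have := congr1 (fun r => size (parrows r)) er; rewrite /= ar size_cat.
move=> /eqP; rewrite addn_eq0 => /andP[/nilP p0 _].
by rewrite -sp -tp /ptgt p0.
Qed.

Lemma unique_finitely_many : finitely_many_paths Q.
Proof.
pose F (xy : vertex Q * vertex Q) : option (qpath Q) :=
  if pselect (exists p : qpath Q, psrc p = xy.1 /\ ptgt p = xy.2) is left e
  then Some (projT1 (cid e)) else None.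
exists (pmap F (enum {: vertex Q * vertex Q})) => p.
rewrite mem_pmap; apply/mapP; exists (psrc p, ptgt p); first by rewrite mem_enum.
rewrite /F; case: pselect => [e|[]] /=; last by exists p.
by case: (cid e) => q [sq tq] /=; congr Some; apply: uQ.
Qed.

End Reachability.

Section TypeA.
Variables (n : nat) (Q : quiver) (f : vertex Q -> 'I_n).
Hypothesis bf : bijective f.
Hypothesis ef : forall x y : vertex Q,
  #|edges x y| = ((f x).+1 == f y) || ((f y).+1 == f x) :> nat.

Lemma arrow_adjacent (a : arrow Q) :
  ((f (src a)).+1 == f (tgt a)) || ((f (tgt a)).+1 == f (src a)).
Proof.
have : (0 < #|edges (src a) (tgt a)|)%N.
  by apply/card_gt0P; exists a; rewrite inE !eqxx.
by rewrite ef; case: (_ || _).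
Qed.

Lemma arrow_unique (a b : arrow Q) : a \in edges (src b) (tgt b) -> a = b.
Proof.
move=> ab; apply/eqP; apply: contraT => ne.
have : (#|[set a; b]| <= #|edges (src b) (tgt b)|)%N.
  apply: subset_leq_card; apply/subsetP => c; rewrite !inE => /orP[]/eqP-> //.
    by rewrite inE in ab.
  by rewrite !eqxx.
by rewrite cards2 ne ef; case: (_ || _).
Qed.

(** A path cannot turn back: it would have to use an edge in both directions,
but there is only one arrow between neighbours. *)
Lemma walk_monotone x a s : walk x (a :: s) ->
  if (f x < f (tgt a))%N then f (walk_end x (a :: s)) = (f x + (size s).+1)%N :> nat
  else f x = (f (walk_end x (a :: s)) + (size s).+1)%N :> nat.
Proof.
elim: s x a => [|b s IHs] x a /=.
  move=> /andP[/eqP<- _]; have := arrow_adjacent a; rewrite /walk_end /=.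
  by case: ifP; lia.
move=> /andP[/eqP sa /andP[/eqP sb ws]].
have wb : walk (tgt a) (b :: s) by rewrite /= sb eqxx.
have := IHs _ _ wb; rewrite /walk_end /=.
have := arrow_adjacent a; have := arrow_adjacent b; rewrite sa sb.
have nb : f (tgt b) != f x.
  apply/negP => /eqP/(bij_inj bf) tb.
  have := @arrow_unique b a; rewrite inE sb tb sa !eqxx orbT => /(_ isT) eb.
  by have := arrow_adjacent a; rewrite -sb eb; lia.
move: nb; rewrite -val_eqE /=; case: ifP; case: ifP; lia.
Qed.

Lemma typeA_unique : parallel_unique Q.
Proof.
move=> [x s ws] [y t wt] /= exy; subst y; rewrite /ptgt /= => et.
apply: qpath_eq => //=; elim: s x t ws wt et => [|a s IHs] x [|b t] // ws wt et.
- by have := walk_monotone wt; rewrite -et /walk_end /=; case: ifP; lia.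
- by have := walk_monotone ws; rewrite et /walk_end /=; case: ifP; lia.
have := walk_monotone ws; have := walk_monotone wt; rewrite et.
move: ws wt; rewrite /= => /andP[/eqP sa ws] /andP[/eqP sb wt].
have := arrow_adjacent a; have := arrow_adjacent b; rewrite sa sb => ab aa H1 H2.
have tab : tgt a = tgt b.
  apply: (bij_inj bf); apply: val_inj => /=; move: H1 H2 ab aa.
  by case: ifP; case: ifP; lia.
have eab : a = b by apply: arrow_unique; rewrite inE sa sb tab !eqxx.
subst b; congr cons; apply: (IHs (tgt a)) => //.
Qed.

End TypeA.

Lemma underlying_graph_A_unique n Q : underlying_graph_A n Q -> parallel_unique Q.
Proof. by case=> f bf ef; apply: typeA_unique bf ef. Qed.

Section Quotients.
Variables (K : fieldType) (Q : quiver) (A : kalgebra K).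
Variable phi : {rmorphism path_kalgebra K Q -> A}.
Hypothesis phik : forall k, phi (kscalar _ k) = kscalar A k.
Hypothesis phi_surj : forall a : A, exists x, phi x = a.
Hypothesis phi_par : forall p q : qpath Q, psrc p = psrc q -> ptgt p = ptgt q ->
  phi (basis_elt K p) = phi (basis_elt K q).
Hypothesis phi_neq0 : forall p : qpath Q, phi (basis_elt K p) != 0.

Local Notation bas := (basis_elt K).
Local Notation e x := (phi (bas (trivial_path x))).

Lemma phi_scale k (x : path_algebra K Q) : phi (k *: x) = kscalar A k * phi x.
Proof. by rewrite -path_kscalarE rmorphM phik. Qed.

Lemma bas_corner (x y : vertex Q) (p : qpath Q) :
  e x * phi (bas p) * e y =
  if (ptgt p == x) && (psrc p == y) then phi (bas p) else 0.
Proof.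
rewrite -!rmorphM.
case: eqVneq => [tp|ne] /=; last by rewrite (bas_mul0 K (p := trivial_path x)) // mul0r rmorph0.
rewrite (bas_mul_comp K (r := p)) ?cats0 //.
case: eqVneq => [sp|ne]; last by rewrite bas_mul0 ?rmorph0 // eq_sym.
by rewrite (bas_mul_comp K (r := p)).
Qed.

Lemma corner_span (x y : vertex Q) (p : qpath Q) : psrc p = y -> ptgt p = x ->
  forall a, exists k, e x * a * e y = kscalar A k * phi (bas p).
Proof.
move=> sp tp a; have [g <-] := phi_surj a.
elim/path_algebra_ind: g => [|k g h [c Hc] [d Hd]|q].
- by exists 0; rewrite !rmorph0 mulr0 !mul0r.
- exists (k * c + d); rewrite rmorphD phi_scale mulrDr mulrDl Hd.
  rewrite mulrA -kscalar_central -!mulrA (mulrA (e x)) Hc.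
  by rewrite rmorphD rmorphM mulrDl mulrA.
rewrite bas_corner; case: ifP => [/andP[/eqP tq /eqP sq]|_]; last first.
  by exists 0; rewrite rmorph0 mul0r.
by exists 1; rewrite rmorph1 mul1r; apply: phi_par; rewrite ?sp ?tp.
Qed.

Lemma corner_zero (x y : vertex Q) : ~~ reach y x -> forall a, e x * a * e y = 0.
Proof.
move=> nr a; have [g <-] := phi_surj a.
elim/path_algebra_ind: g => [|k g h Hg Hh|q].
- by rewrite rmorph0 mulr0 mul0r.
- rewrite rmorphD phi_scale mulrDr mulrDl Hh addr0.
  by rewrite mulrA -kscalar_central -!mulrA (mulrA (e x)) Hg mulr0.
rewrite bas_corner; case: ifP => // /andP[/eqP tq /eqP sq].
by case/negP: nr; apply/asboolP; exists q.
Qed.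

(** The block e_x A e_y is spanned by the image of any path from y to x. *)
Lemma quotient_incidence_family : exists X : vertex Q -> bounded_derived_category A,
  incidence_family (fun x y => reach y x) X.
Proof.
have ee x : e x * e x = e x.
  by rewrite -rmorphM (bas_mul_comp K (r := trivial_path x)).
eexists; apply: (@idem_incidence_family K A (vertex Q) (fun x y => reach y x)
  (fun x => e x) ee).
- exact: corner_zero.
- move=> x y /asboolP[p [sp tp]]; exists (phi (bas p)); split=> //.
    by rewrite bas_corner sp tp !eqxx.
  exact: corner_span.
by move=> x a; apply: corner_span.
Qed.

End Quotients.

(** * Incidence algebras *)

Section QuotientMap.
Variables (K : pzRingType) (A : kalgebra K) (S : A -> Prop).

Definition quot_map (x : A) : quot_kalgebra S := (\pi_(quot_algebra S) x)%qT.

Lemma quot_map_zmod : zmod_morphism quot_map.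
Proof. by move=> x y; rewrite /quot_map quot_piD quot_piN. Qed.

Lemma quot_map_monoid : monoid_morphism quot_map.
Proof. by split=> [|x y] //; rewrite -[RHS]/(quot_mul _ _) quot_piM. Qed.

HB.instance Definition _ := GRing.isZmodMorphism.Build A (quot_kalgebra S)
  quot_map quot_map_zmod.
HB.instance Definition _ := GRing.isMonoidMorphism.Build A (quot_kalgebra S)
  quot_map quot_map_monoid.

Lemma quot_map_surj (y : quot_kalgebra S) : exists x, quot_map x = y.
Proof. by exists (repr (y : quot_algebra S)); rewrite /quot_map reprK. Qed.

Lemma quot_map_eq x y : quot_map x = quot_map y <-> ideal_gen S (x - y).
Proof.
split=> [E|H]; first by apply/ideal_predP/quot_eqP.
by apply/quot_eqP/ideal_predP.
Qed.

End QuotientMap.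

Section Incidence.
Variables (K : fieldType) (d : Order.disp_t) (D : finPOrderType d).
Local Notation Q := (hasse_quiver D).
Local Notation PA := (path_algebra K Q).
Local Notation bas := (basis_elt K).

Lemma walk_le (x : D) (s : seq (arrow Q)) : walk (Q := Q) x s -> (x <= walk_end (Q := Q) x s)%O.
Proof.
elim: s x => [|a s IHs] x //= /andP[/eqP<- /IHs].
rewrite /walk_end /=; apply: le_trans; case: a => -[u v] /= /andP[/= uv _].
exact: ltW.
Qed.

(** By induction on the interval above x, of which a minimal element covers x. *)
Lemma le_walk (x y : D) : (x <= y)%O ->
  exists p : qpath Q, psrc p = x /\ ptgt p = y.
Proof.
move: {2}#|_|.+1 (ltnSn #|[set c : D | (x < c <= y)%O]|) => n.
elim: n x => // n IHn x ltn lexy.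
have [->|ne] := eqVneq x y; first by exists (trivial_path (Q := Q) y).
have ltxy : (x < y)%O by rewrite lt_neqAle ne.
pose S := [set c : D | (x < c <= y)%O].
have yS : y \in S by rewrite inE ltxy lexx.
case: (arg_minnP (P := mem S) (fun c => #|[set b in S | (b <= c)%O]|) yS) => c cS cmin.
have {}cS : c \in S by exact: cS.
have := cS; rewrite inE => /andP[ltxc lecy].
have cov : hasse_cover (x, c).
  rewrite /hasse_cover /= ltxc; apply/existsPn => b; apply/negP => /andP[xb bc].
  have bS : b \in S by rewrite inE xb (le_trans (ltW bc)).
  have := cmin b bS; rewrite leqNgt => /negP; apply; apply: proper_card.
  apply/properP; split.
    by apply/subsetP => a; rewrite !inE => /andP[-> /le_trans]; apply; apply: ltW.
  exists c; first by rewrite inE cS lexx.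
  by rewrite !inE negb_and; apply/orP; right; apply/negP => /le_lt_trans/(_ bc); rewrite ltxx.
have [|p [sp tp]] := IHn c _ lecy.
  rewrite ltnS in ltn; apply: leq_trans ltn; apply: proper_card; apply/properP; split.
    by apply/subsetP => a; rewrite !inE => /andP[/(lt_trans ltxc) -> ->].
  by exists c; rewrite ?inE ?ltxx ?ltxc ?lecy.
have [r [_ sr tr _]] := @pcompP Q p (arrow_path (Q := Q) (exist _ (x, c) cov)) (esym sp).
by exists r; rewrite sr tr.
Qed.

Lemma hasse_reach (x y : D) : reach (Q := Q) x y = (x <= y)%O.
Proof.
apply/asboolP/idP => [[p [<- <-]]|/le_walk //]; exact: walk_le (pwalk p).
Qed.

(** Vanishes on the ideal of parallel differences, so that no path becomes
zero in the incidence algebra. *)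
Definition path_sum (x y : D) : PA -> K^o := lin_ext (fun p : qpath Q =>
  ((psrc p == x) && (ptgt p == y))%:R : K^o).

HB.instance Definition _ x y := GRing.isLinear.Build K PA K^o *:%R (path_sum x y)
  (lin_ext_is_linear _).

Lemma path_sumE x y p : path_sum x y (bas p) = ((psrc p == x) && (ptgt p == y))%:R.
Proof. exact: lin_ext_basis. Qed.

Lemma path_sum_mull x y (p : qpath Q) (g : PA) : path_sum x y (bas p * g) =
  if ptgt p == y then path_sum x (psrc p) g else 0.
Proof.
elim/path_algebra_ind: g => [|k g h Hg Hh|q].
- by rewrite mulr0 !linear0 if_same.
- rewrite mulrDr -path_scaleAr !linearP /= Hg Hh.
  by case: ifP; rewrite ?scaler0 ?addr0.
have [e|ne] := eqVneq (ptgt q) (psrc p).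
  have [r [_ sr tr ar]] := pcompP e.
  rewrite (bas_mul_comp K (r := r)) // !path_sumE sr tr e eqxx.
  by case: ifP; rewrite ?andbT ?andbF.
by rewrite bas_mul0 // linear0 path_sumE (negbTE ne) andbF if_same.
Qed.

Lemma path_sum_mulr x y (p : qpath Q) (g : PA) : path_sum x y (g * bas p) =
  if psrc p == x then path_sum (ptgt p) y g else 0.
Proof.
elim/path_algebra_ind: g => [|k g h Hg Hh|q].
- by rewrite mul0r !linear0 if_same.
- rewrite mulrDl -path_scaleAl !linearP /= Hg Hh.
  by case: ifP; rewrite ?scaler0 ?addr0.
have [e|ne] := eqVneq (ptgt p) (psrc q).
  have [r [_ sr tr ar]] := pcompP e.
  rewrite (bas_mul_comp K (r := r)) // !path_sumE sr tr -e eqxx.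
  by case: ifP.
by rewrite bas_mul0 // linear0 path_sumE [psrc q == _]eq_sym (negbTE ne) if_same.
Qed.

Lemma path_sum_ideal g :
  ideal_gen (parallel_difference (D := D) (K := K)) g ->
  forall x y, path_sum x y g = 0.
Proof.
have s0 x y : path_sum x y 0 = 0 by apply: linear0.
have sP x y k a b : path_sum x y a = 0 -> path_sum x y b = 0 ->
    path_sum x y (k *: a + b) = 0.
  by move=> Ha Hb; rewrite linearP /= Ha Hb scaler0 addr0.
elim=> {g} [g [p [q [es et ->]]]||g h _ Hg _ Hh|a g _ Hg|a g _ Hg] x y.
- by rewrite linearB /= !path_sumE es et subrr.
- exact: s0.
- by have := sP x y 1 g h (Hg x y) (Hh x y); rewrite scale1r.
- elim/path_algebra_ind: a => [|k a b Ha Hb|p].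
  + by have -> : (0 : PA) * g = 0 by exact: mul0r.
  + have -> : (k *: a + b : PA) * g = k *: (a * g) + b * g :> PA.
      exact: (etrans (mulrDl _ _ _) (congr1 (+%R^~ _) (esym (path_scaleAl _ _ _)))).
    exact: sP.
  by apply: etrans (path_sum_mull x y p g) _; rewrite Hg if_same.
elim/path_algebra_ind: a => [|k a b Ha Hb|p].
+ by have -> : (g : PA) * 0 = 0 by exact: mulr0.
+ have -> : (g : PA) * (k *: a + b) = k *: ((g : PA) * a) + (g : PA) * b :> PA.
    exact: (etrans (mulrDr _ _ _) (congr1 (+%R^~ _) (esym (path_scaleAr _ _ _)))).
  exact: (sP x y k ((g : PA) * a) ((g : PA) * b) Ha Hb).
by apply: etrans (path_sum_mulr x y p g) _; rewrite Hg if_same.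
Qed.

Lemma incidence_incidence_family :
  exists X : D -> bounded_derived_category (incidence_algebra D K),
    incidence_family (fun x y => (y <= x)%O) X.
Proof.
have [||||X HX] := @quotient_incidence_family K Q (incidence_algebra D K)
  (@quot_map K (path_kalgebra K Q) (parallel_difference (D := D) (K := K))).
- by [].
- exact: quot_map_surj.
- move=> p q es et; apply/quot_map_eq; apply: ideal_in.
  by exists p, q.
- move=> p; apply/eqP => E.
  have /quot_map_eq : @quot_map K (path_kalgebra K Q) (parallel_difference (D := D) (K := K)) (bas p) = @quot_map K (path_kalgebra K Q) (parallel_difference (D := D) (K := K)) 0.
    by rewrite E rmorph0.
  rewrite subr0 => /path_sum_ideal/(_ (psrc p) (ptgt p)); rewrite path_sumE !eqxx.
  by move/eqP; rewrite oner_eq0.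
exists X; have -> // : (fun x y : D => (y <= x)%O) = (fun x y => reach (Q := Q) y x).
by apply/funext => x; apply/funext => y; rewrite hasse_reach.
Qed.

Lemma path_incidence_family (Q' : quiver) : parallel_unique Q' ->
  exists X : vertex Q' -> bounded_derived_category (path_kalgebra K Q'),
    incidence_family (fun x y => reach y x) X.
Proof.
move=> uQ; apply: (@quotient_incidence_family K Q' (path_kalgebra K Q') idfun) => //.
- by move=> a; exists a.
- by move=> p q es et; rewrite (uQ p q).
move=> p /=; apply/eqP => /(congr1 (lin_ext (fun _ : qpath Q' => 1 : K^o))).
by rewrite lin_ext_basis linear0 => /eqP; rewrite oner_eq0.
Qed.

Lemma incidence_path_iso : parallel_unique Q ->
  alg_isomorphic (path_kalgebra K Q) (incidence_algebra D K).
Proof.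
move=> uQ.
have I0 g : ideal_gen (parallel_difference (D := D) (K := K)) g -> g = 0.
  elim=> {g} [g [p [q [es et ->]]]||g h _ -> _ ->|a g _ ->|a g _ ->].
  - by rewrite (uQ p q) // subrr.
  - by [].
  - by rewrite addr0.
  - by rewrite mulr0.
  by rewrite mul0r.
exists (@quot_map K (path_kalgebra K Q) (parallel_difference (D := D) (K := K))).
split=> //; exists (fun y : quot_algebra _ => repr y) => [x|y].
  apply/eqP; rewrite -subr_eq0; apply/eqP/I0; exact: quot_repr.
exact: (reprK (y : quot_algebra _)).
Qed.

End Incidence.

Lemma alg_isomorphic_sym (K : pzRingType) (A B : kalgebra K) :
  alg_isomorphic A B -> alg_isomorphic B A.
Proof.
move=> [f [[g fK gK] fk]].
have gz : zmod_morphism g.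
  by move=> x y; apply: (can_inj fK); rewrite rmorphB !gK.
have gm : monoid_morphism g.
  by split=> [|x y]; apply: (can_inj fK); rewrite ?rmorph1 ?rmorphM !gK.
pose G : {rmorphism B -> A} := HB.pack g (GRing.isZmodMorphism.Build B A g gz)
  (GRing.isMonoidMorphism.Build B A g gm).
exists G; split; first by exists f.
by move=> k; apply: (can_inj fK); rewrite gK fk.
Qed.

Lemma alg_isomorphic_refl (K : pzRingType) (A : kalgebra K) : alg_isomorphic A A.
Proof. by exists idfun; split=> //; exists id. Qed.

(** * Classes as vectors of a root lattice *)

Section Independence.
Variables (Q : quiver) (I : finType) (z : rel I) (w : I -> vertex Q -> int).
Hypotheses (z_refl : reflexive z) (z_trans : transitive z) (z_anti : antisymmetric z).
Hypothesis wz : forall x y, euler_form (w x) (w y) = (z x y)%:Z.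

(** The Gram matrix of the classes is unitriangular for any linear extension
of the order z, hence invertible. *)
Lemma classes_free (c : I -> rat) :
  (forall v, \sum_x c x * (w x v)%:~R = 0) -> forall x, c x = 0.
Proof.
move=> c0.
have cz y : \sum_x c x * (z x y)%:R = 0.
  transitivity (\sum_x c x * (euler_form (w x) (w y))%:~R).
    by apply: eq_bigr => x _; rewrite wz.
  transitivity (\sum_v (\sum_x c x * (w x v)%:~R) * (w y v)%:~R -
    \sum_(a : arrow Q) (\sum_x c x * (w x (src a))%:~R) * (w y (tgt a))%:~R : rat).
    under eq_bigr => x _ do rewrite /euler_form rmorphB !rmorph_sum /= mulrBr !mulr_sumr.
    rewrite sumrB; congr (_ - _); rewrite exchange_big; apply: eq_bigr => v _;
      by rewrite mulr_suml; apply: eq_bigr => x _; rewrite rmorphM mulrA.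
  by rewrite !big1 ?subr0 // => v _; rewrite c0 mul0r.
move=> x0; apply/eqP; apply: contraT => cx0.
case: (arg_minnP (P := fun x => c x != 0) (fun y => #|[set x | z x y]|) cx0) => y cy ymin.
have := cz y; rewrite (bigD1 y) //= z_refl mulr1 big1 ?addr0 => [/eqP|x ne].
  by rewrite (negbTE cy).
have [zxy|] := boolP (z x y); last by rewrite mulr0.
have [->|cx] := eqVneq (c x) 0; first by rewrite mul0r.
have := ymin x cx; rewrite leqNgt => /negP[]; apply: proper_card; apply/properP; split.
  by apply/subsetP => u; rewrite !inE => /z_trans; apply.
exists y; rewrite inE ?z_refl //; apply/negP => zyx.
by move/eqP: ne; apply; apply: z_anti; rewrite zxy zyx.
Qed.

Lemma classes_card : (#|I| <= #|vertex Q|)%N.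
Proof.
pose W : 'M[rat]_(#|I|, #|vertex Q|) :=
  \matrix_(i, k) (w (enum_val i) (enum_val k))%:~R.
suff /eqP <- : row_free W by exact: rank_leq_col.
apply: inj_row_free => u uW; apply/rowP => i; rewrite mxE.
suff H : forall x, u 0 (enum_rank x) = 0 by rewrite -(enum_valK i).
apply: classes_free => v; have := congr1 (fun M : 'rV_#|vertex Q| => M 0 (enum_rank v)) uW.
rewrite !mxE => {2}<-; rewrite (reindex (@enum_rank I)) /=; last first.
  by apply: onW_bij; exact: enum_rank_bij.
by apply: eq_bigr => x _; rewrite mxE !enum_rankK.
Qed.

End Independence.

Section RootVectors.
Variables (n : nat) (Q : quiver) (f : vertex Q -> 'I_n).
Hypothesis bf : bijective f.
Hypothesis ef : forall x y : vertex Q,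
  #|edges x y| = ((f x).+1 == f y) || ((f y).+1 == f x) :> nat.

(** The sequence 0, u_0, ..., u_(n-1), 0 in the order of the vertices of the
diagram. *)
Definition padded (u : vertex Q -> int) (k : nat) : int :=
  if [pick v | (f v).+1 == k] is Some v then u v else 0.

Lemma paddedE u v : padded u (f v).+1 = u v.
Proof.
rewrite /padded; case: pickP => [v' /eqP[/val_inj/(bij_inj bf)->]//|/(_ v)].
by rewrite eqxx.
Qed.

Lemma padded0 u : padded u 0 = 0.
Proof. by rewrite /padded; case: pickP. Qed.

Lemma padded_last u : padded u n.+1 = 0.
Proof.
rewrite /padded; case: pickP => // v /eqP e.
by have := ltn_ord (f v); lia.
Qed.

(** Coordinates in which the symmetrized Euler form of the Dynkin diagram A_n
is the restriction of the standard scalar product to the hyperplane of sum 0. *)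
Definition root_coord (u : vertex Q -> int) (i : 'I_n.+1) : int :=
  padded u i.+1 - padded u i.

Lemma root_coord_sum u : \sum_i root_coord u i = 0.
Proof.
rewrite -(big_mkord predT (fun i => padded u i.+1 - padded u i)) telescope_sumr //.
by rewrite padded_last padded0 subrr.
Qed.

Lemma sum_vertices (F : nat -> int) : \sum_v F (f v) = \sum_(k < n) F k.
Proof. by rewrite [RHS](reindex f) //; apply: onW_bij. Qed.

(** Every edge of the diagram carries one arrow and is indexed by its lower
end. *)
Lemma sum_arrows (F : nat -> int) : F n.-1 = 0 ->
  \sum_(a : arrow Q) F (minn (f (src a)) (f (tgt a))) = \sum_(k < n) F k.
Proof.
move=> Fn; have kp (a : arrow Q) : (minn (f (src a)) (f (tgt a)) < n)%N.
  by rewrite gtn_min ltn_ord.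
rewrite (partition_big (fun a => Ordinal (kp a)) predT) //=; apply: eq_bigr => k _.
rewrite (eq_bigr (fun _ => F k)) => [|a /eqP <- //]; rewrite sumr_const.
have [ltk|lenk] := ltnP k.+1 n; last first.
  by rewrite (_ : nat_of_ord k = n.-1) ?Fn ?mul0rn //; have := ltn_ord k; lia.
have [g fK gK] := bf.
rewrite -[X in F X *+ _]/(nat_of_ord k).
have := ef (g k) (g (Ordinal ltk)); rewrite !gK eqxx /= => c1.
rewrite (_ : #|_| = 1%N) ?mulr1n // -[RHS]c1; apply: eq_card => a.
rewrite !inE unfold_in /=.
have fg v i : (v == g i) = (f v == i) by apply/eqP/eqP => [->|<-].
rewrite !fg -!(inj_eq val_inj) /=.
by have := arrow_adjacent ef a; lia.
Qed.

Lemma root_coord_dot u u' : \sum_i root_coord u i * root_coord u' i =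
  euler_form u u' + euler_form u' u.
Proof.
pose h := padded u; pose h' := padded u'.
have vE : \sum_v u v * u' v = \sum_(k < n) h k.+1 * h' k.+1.
  rewrite -(sum_vertices (fun k => h k.+1 * h' k.+1)).
  by apply: eq_bigr => v _; rewrite /h /h' !paddedE.
pose G k := h k.+1 * h' k.+2 + h k.+2 * h' k.+1.
have aE : \sum_(a : arrow Q) (u (src a) * u' (tgt a) + u' (src a) * u (tgt a)) =
    \sum_(k < n) G k.
  rewrite -sum_arrows /G.
    apply: eq_bigr => a _; rewrite -!(paddedE u) -!(paddedE u') -/h -/h'.
    have /orP[/eqP e|/eqP e] := arrow_adjacent ef a.
      by rewrite (_ : minn _ _ = f (src a)) ?e ?[u' _ * _]mulrC 1?[X in _ + X]mulrC //; lia.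
    rewrite (_ : minn _ _ = f (tgt a)) ?e; last by lia.
    by rewrite addrC [X in X + _]mulrC [X in _ + X]mulrC; ring.
  have e : n = 0 \/ n.-1.+2 = n.+1 by case: (n); [left|right].
  case: e => e; last by rewrite e /h /h' !padded_last mulr0 mul0r.
  by have := padded_last u; have := padded_last u'; rewrite -/h -/h' e => -> ->; rewrite mul0r mulr0.
transitivity (\sum_(k < n) h k.+1 * h' k.+1 *+ 2 - \sum_(k < n) G k); last first.
  rewrite -aE big_split /= /euler_form.
  have -> : \sum_v u' v * u v = \sum_v u v * u' v by apply: eq_bigr => v _; rewrite mulrC.
  by rewrite vE !big_split /=; ring.
rewrite (eq_bigr (fun i : 'I_n.+1 => h i.+1 * h' i.+1 + (h i * h' i -
  (h i * h' i.+1 + h i.+1 * h' i)))) => [|i _]; last by rewrite /root_coord -/h -/h'; ring.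
rewrite big_split sumrB /= big_ord_recr [X in _ + (X - _)]big_ord_recl [X in _ + (_ - X)]big_ord_recl /=.
rewrite /bump /= /h /h' !padded0 !padded_last -/h -/h'.
rewrite !(mul0r, mulr0, addr0, add0r) big_split /= addrA; congr (_ - _).
by rewrite -big_split; apply: eq_bigr.
Qed.

End RootVectors.

(** * Roots as pairs of a head and a tail *)

Lemma exists_positive N (om : 'I_N -> int) :
  \sum_i om i = 0 -> \sum_i om i * om i = 2 -> exists p, 0 < om p.
Proof.
move=> s0 s2; case: (pickP (fun i => 0 < om i)) => [p|neg]; first by exists p.
have om0 i : om i = 0.
  apply: oppr_inj; rewrite oppr0.
  apply: (psumr_eq0P (P := predT) (F := fun i => - om i)) => // [j _|].
    by have := neg j; lia.
  by rewrite sumrN s0 oppr0.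
by move: s2; rewrite big1 // => i _; rewrite om0 mulr0.
Qed.

(** A positive and a negative coordinate exhaust the sum of squares. *)
Lemma root_vectorP N (om : 'I_N -> int) :
  \sum_i om i = 0 -> \sum_i om i * om i = 2 ->
  exists p q, p != q /\ forall i, om i = (i == p)%:Z - (i == q)%:Z.
Proof.
move=> s0 s2; have [p p0] := exists_positive s0 s2.
have [||q q0] := @exists_positive N (fun i => - om i); first by rewrite sumrN s0 oppr0.
  by rewrite -s2; apply: eq_bigr => i _; rewrite mulrNN.
have pq : q != p by apply/eqP => e; move: q0; rewrite e; lia.
move: s2; rewrite (bigD1 p) //= (bigD1 q) //=.
have pos i : 0 <= om i * om i by rewrite -expr2 sqr_ge0.
set S := \sum_(i | _) _ => s2.
have S0 : 0 <= S by apply: sumr_ge0.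
have p1 : om p = 1 by nia.
have q1 : om q = -1 by nia.
have S1 : S = 0 by move: s2; rewrite p1 q1; lia.
exists p, q; split=> [|i]; first by rewrite eq_sym.
have [->|ip] := eqVneq i p; first by rewrite eq_sym (negbTE pq).
have [->|iq] := eqVneq i q; first by rewrite q1.
have sq0 : om i * om i = 0 by apply: (psumr_eq0P (fun j _ => pos j) S1); rewrite ip.
by apply/eqP; move/eqP: sq0; rewrite mulf_eq0 orbb.
Qed.

Section HeadsTails.
Variables (d : Order.disp_t) (D : finPOrderType d) (N : nat).
Variables (om : D -> 'I_N -> int) (h t : D -> 'I_N).
Hypothesis ht : forall x, h x != t x.
Hypothesis omE : forall x i, om x i = (i == h x)%:Z - (i == t x)%:Z.
Hypothesis dotE : forall x y, \sum_i om x i * om y i = (y <= x)%O%:Z + (x <= y)%O%:Z.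

(** If the head of u were the tail of v, then the scalar product of their
vectors would be negative. So only common heads and common tails contribute to
the scalar products. *)
Lemma shared_ends x y :
  ((h x == h y) + (t x == t y) = (x <= y)%O + (y <= x)%O)%N.
Proof.
have pick (p : 'I_N) (F : 'I_N -> int) : \sum_i (i == p)%:Z * F i = F p.
  by rewrite (bigD1 p) //= eqxx mul1r big1 ?addr0 // => i /negbTE->; rewrite mul0r.
have e u v : (h u == h v)%:Z - (h u == t v)%:Z - ((t u == h v)%:Z - (t u == t v)%:Z) =
    (v <= u)%O%:Z + (u <= v)%O%:Z.
  rewrite -dotE; under [RHS]eq_bigr => i _ do rewrite omE mulrBl.
  by rewrite sumrB !pick !omE.
have nht u v : (h u == t v) = false.
  apply/eqP => huv; have := e u v; rewrite -huv eqxx (eq_sym (t u) (h u)) (negbTE (ht u)).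
  have -> : (h u == h v) = false by rewrite huv eq_sym (negbTE (ht v)).
  by lia.
by have := e x y; rewrite nht (eq_sym (t x)) nht; lia.
Qed.

End HeadsTails.

(** * Degrees in the Hasse diagram *)

Section HasseDegrees.
Variables (d : Order.disp_t) (D : finPOrderType d) (J : eqType) (h t : D -> J).
Hypothesis ends : forall x y,
  ((h x == h y) + (t x == t y) = (x <= y)%O + (y <= x)%O)%N.

Local Notation cov x y := (hasse_cover (x : D, y : D)).

Definition neighbours (x : D) : {set D} := [set y | cov x y || cov y x].

Definition up_sharing (g : D -> J) (x : D) : {set D} := [set y | cov x y & g x == g y].
Definition down_sharing (g : D -> J) (x : D) : {set D} := [set y | cov y x & g x == g y].

Lemma cover_lt x y : cov x y -> (x < y)%O.
Proof. by case/andP. Qed.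

Lemma cover_between x y c : cov x y -> (x < c)%O -> (c < y)%O -> False.
Proof. by case/andP=> _ /existsP nc xc cy; apply: nc; exists c; apply/andP. Qed.

Lemma ends_lt x y : (x < y)%O -> ((h x == h y) + (t x == t y) = 1)%N.
Proof. by move=> xy; rewrite ends (ltW xy) lt_geF. Qed.

Lemma ends_lt' x y : (x < y)%O -> ((t x == t y) + (h x == h y) = 1)%N.
Proof. by rewrite addnC; apply: ends_lt. Qed.

Definition sharing (g : D -> J) : Prop :=
  forall x y, g x = g y -> (x <= y)%O || (y <= x)%O.

Lemma sharing_h : sharing h.
Proof. by move=> x y e; have := ends x y; rewrite e eqxx; lia. Qed.
Lemma sharing_t : sharing t.
Proof. by move=> x y e; have := ends x y; rewrite e eqxx; lia. Qed.

Lemma up_sharing_le1 g x : sharing g -> (#|up_sharing g x| <= 1)%N.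
Proof.
move=> gP; apply/card_le1_eqP => y y'; rewrite !inE.
move=> /andP[cy /eqP gy] /andP[cy' /eqP gy']; apply/eqP; apply: contraT => ne.
case/orP: (gP y y' (etrans (esym gy) gy')) => l.
  by exfalso; apply: (cover_between cy' (cover_lt cy)); rewrite lt_neqAle eq_sym ne l.
by exfalso; apply: (cover_between cy (cover_lt cy')); rewrite lt_neqAle ne l.
Qed.

Lemma down_sharing_le1 g x : sharing g -> (#|down_sharing g x| <= 1)%N.
Proof.
move=> gP; apply/card_le1_eqP => y y'; rewrite !inE.
move=> /andP[cy /eqP gy] /andP[cy' /eqP gy']; apply/eqP; apply: contraT => ne.
case/orP: (gP y y' (etrans (esym gy) gy')) => l.
  by exfalso; apply: (cover_between cy _ (cover_lt cy')); rewrite lt_neqAle eq_sym ne l.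
by exfalso; apply: (cover_between cy' _ (cover_lt cy)); rewrite lt_neqAle ne l.
Qed.

(** An element above x along one end and an element below x along the other
would be comparable without sharing an end. *)
Lemma up_down_excl g g' x :
  (forall x y, (x < y)%O -> (g x == g y) + (g' x == g' y) = 1)%N ->
  (#|up_sharing g x| * #|down_sharing g' x| = 0)%N.
Proof.
move=> gP; apply/eqP; rewrite muln_eq0 !cards_eq0; apply: contraT.
rewrite negb_or => /andP[/set0Pn[y] + /set0Pn[u]]; rewrite !inE.
move=> /andP[/cover_lt xy /eqP gy] /andP[/cover_lt ux /eqP gu].
have := gP _ _ xy; have := gP _ _ ux; have := gP _ _ (lt_trans ux xy).
by rewrite -gy -gu !eqxx; lia.
Qed.

Lemma degree_split x : #|neighbours x| =
  (#|up_sharing h x| + #|down_sharing h x| + (#|up_sharing t x| + #|down_sharing t x|))%N.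
Proof.
have sums (P : pred D) : (#|[set y | P y]| = \sum_y P y)%N.
  by rewrite -sum1dep_card big_mkcond; apply: eq_bigr => y _; case: (P y).
rewrite /neighbours /up_sharing /down_sharing !sums -!big_split; apply: eq_bigr => y _ /=.
have anti : cov x y -> cov y x = false.
  by move/cover_lt => l; apply/negP => /cover_lt; rewrite lt_gtF.
have up : cov x y -> ((h x == h y) + (t x == t y) = 1)%N by move/cover_lt/ends_lt.
have dn : cov y x -> ((h x == h y) + (t x == t y) = 1)%N.
  by move/cover_lt/ends_lt; rewrite (eq_sym (h x)) (eq_sym (t x)).
by move: anti up dn; case: (cov x y); case: (cov y x) => //=; lia.
Qed.

(** Each covering pair sharing the end i is counted once with each sign. *)
Lemma sharing_balance (g : D -> J) (i : J) :
  \sum_(x | g x == i) (#|up_sharing g x|%:Z - #|down_sharing g x|%:Z) = 0.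
Proof.
have sums (P : rel D) : \sum_(x | g x == i) #|[set y | P x y]|%:Z =
    \sum_x \sum_y ((g x == i) && P x y)%:Z.
  rewrite big_mkcond; apply: eq_bigr => x _; case: (g x == i); last by rewrite big1.
  rewrite -sum1dep_card big_mkcond /= (big_morph Posz PoszD (erefl _)).
  by apply: eq_bigr => y _; case: (P x y).
rewrite sumrB /up_sharing /down_sharing.
rewrite (sums (fun x y => cov x y && (g x == g y))) (sums (fun x y => cov y x && (g x == g y))).
rewrite exchange_big; apply/eqP; rewrite subr_eq0; apply/eqP.
apply: eq_bigr => y _; apply: eq_bigr => x _; rewrite (eq_sym (g y) (g x)).
by case: (eqVneq (g x) (g y)) => [->|_]; rewrite ?andbF.
Qed.

Hypothesis free : forall c : D -> int,
  (forall i, \sum_(x | h x == i) c x = \sum_(x | t x == i) c x) -> forall x, c x = 0.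

(** Each of the four kinds of covers occurs at most once, and upper covers
along one end exclude lower covers along the other. *)
Lemma degree_le2 x : (#|neighbours x| <= 2)%N.
Proof.
rewrite degree_split; have := up_down_excl x ends_lt; have := up_down_excl x ends_lt'.
have := up_sharing_le1 x sharing_h; have := up_sharing_le1 x sharing_t.
have := down_sharing_le1 x sharing_h; have := down_sharing_le1 x sharing_t.
by nia.
Qed.

(** If every element had two neighbours, then the number of upper minus lower
covers of x sharing an end with x would be the same for both ends; summed over
an end these numbers vanish, so they would give a linear relation, which is
nonzero at a minimal element. *)
Lemma degree_le1 (x0 : D) : exists x, (#|neighbours x| <= 1)%N.
Proof.
case: (pickP (fun x => #|neighbours x| <= 1)%N) => [x|deg]; first by exists x.
pose c x := #|up_sharing h x|%:Z - #|down_sharing h x|%:Z.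
have cE x : c x = #|up_sharing t x|%:Z - #|down_sharing t x|%:Z.
  have := deg x; rewrite degree_split /c.
  have := up_down_excl x ends_lt; have := up_down_excl x ends_lt'.
  have := up_sharing_le1 x sharing_h; have := up_sharing_le1 x sharing_t.
  have := down_sharing_le1 x sharing_h; have := down_sharing_le1 x sharing_t.
  by nia.
have c0 : forall x, c x = 0.
  apply: free => i; rewrite sharing_balance.
  by under [RHS]eq_bigr => x _ do rewrite cE; rewrite sharing_balance.
case: (arg_minnP (P := predT) (fun x => #|[set y | (y < x)%O]|) (erefl : predT x0)) => x _ xmin.
have down0 g : #|down_sharing g x| = 0%N.
  apply: eq_card0 => y; rewrite !inE; apply/negP => /andP[/cover_lt yx _].
  have := xmin y isT; rewrite leqNgt => /negP[]; apply: proper_card; apply/properP; split.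
    by apply/subsetP => u; rewrite !inE => /lt_trans; apply.
  by exists y; rewrite inE ?ltxx.
have := deg x; have := c0 x; have := cE x; rewrite degree_split /c !down0.
by lia.
Qed.

End HasseDegrees.

(** * Connected graphs of degree at most two *)

Section PathGraph.
Local Open Scope nat_scope.
Variables (T : finType) (e : rel T) (x0 : T).
Hypotheses (e_sym : symmetric e) (e_irr : irreflexive e).
Hypothesis e_conn : forall x y, connect e x y.
Hypothesis deg2 : forall x, #|[set y | e x y]| <= 2.
Hypothesis deg1 : #|[set y | e x0 y]| <= 1.

Lemma maximal_path : exists p, [/\ path e x0 p, uniq (x0 :: p) &
  forall y, e (last x0 p) y -> y \in x0 :: p].
Proof.
pose P n := [exists p : n.-tuple T, path e x0 p && uniq (x0 :: p)].
have ex : exists n, P n by exists 0; apply/existsP; exists [tuple].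
have bound n : P n -> n <= #|T|.
  case/existsP => p /andP[_ /card_uniqP e1].
  by have := max_card (mem (x0 :: p)); rewrite e1 /= size_tuple; apply: leq_trans.
case: (ex_maxnP ex bound) => n /existsP[p /andP[pp up]] nmax.
exists p; split=> // y ey; apply: contraT => yp.
have := nmax n.+1 _; rewrite ltnn => -> //; apply/existsP; exists [tuple of rcons p y].
by rewrite rcons_path pp ey -rcons_cons rcons_uniq yp up.
Qed.

(** Along a maximal path from x0 every vertex has all its neighbours on the
path already, so by connectedness the path exhausts the graph. *)
Lemma path_graph : exists2 f : T -> 'I_#|T|, bijective f &
  forall x y, e x y = ((f x).+1 == f y) || ((f y).+1 == f x).
Proof.
have [p [pp up pmax]] := maximal_path.
pose s := x0 :: p; pose N := size p.
have sN : size s = N.+1 by [].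
have step i : i < N -> e (nth x0 s i) (nth x0 s i.+1) by move/(pathP x0 pp).
have last_s : last x0 p = nth x0 s N by rewrite nth_last.
have s_inj i j : i <= N -> j <= N -> nth x0 s i = nth x0 s j -> i = j.
  by move=> iN jN /eqP; rewrite nth_uniq // => /eqP.
have inner i y : i < N -> e (nth x0 s i) y ->
    y = nth x0 s i.+1 \/ 0 < i /\ y = nth x0 s i.-1.
  move=> iN ey; have [->|n1] := eqVneq y (nth x0 s i.+1); [by left | right].
  have [i0|i0] := posnP i.
    move: ey deg1; rewrite i0 /= => ey; rewrite leqNgt => /negP[].
    apply: (@leq_trans #|[set y; nth x0 s i.+1]|); first by rewrite cards2 n1.
    apply: subset_leq_card; apply/subsetP => u; rewrite !inE => /orP[]/eqP-> //.
    by have := step i iN; rewrite i0.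
  split=> //; apply/eqP; apply: contraT => n2.
  have := deg2 (nth x0 s i); rewrite leqNgt => /negP[].
  apply: (@leq_trans #|y |: [set nth x0 s i.+1; nth x0 s i.-1]|).
    rewrite cardsU1 cards2 !inE negb_or n1 n2 /=.
    by case: eqP => // /(@s_inj i.+1 i.-1); lia.
  apply: subset_leq_card; apply/subsetP => u; rewrite !inE => /or3P[]/eqP-> //.
    exact: step.
  by rewrite e_sym; have := @step i.-1; rewrite prednK //; apply; lia.
have closed i y : i <= N -> e (nth x0 s i) y -> y \in s.
  move=> iN ey; have [lt|ge] := ltnP i N; last first.
    by apply: pmax; rewrite last_s (_ : N = i) //; lia.
  by case: (inner i y lt ey) => [|[_]] ->; apply: mem_nth; rewrite sN; lia.
have all_s y : y \in s.
  have : connect e x0 y by [].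
  case/connectP => q pq ->; have : x0 \in s by rewrite mem_head.
  elim: q x0 pq => //= z q IH u /andP[euz pq] us; apply: IH => //.
  by apply: (closed (index u s)); rewrite ?nth_index // -ltnS -sN index_mem.
have cardT : size s = #|T|.
  by rewrite -(card_uniqP up); apply: eq_card => y; rewrite all_s.
have idx y : index y s < #|T| by rewrite -cardT index_mem.
exists (fun y => Ordinal (idx y)).
  exists (fun i : 'I_#|T| => nth x0 s i) => [y|i]; first by rewrite /= nth_index.
  by apply: val_inj; apply: (index_uniq x0 _ up); rewrite cardT.
move=> x y; rewrite -[nat_of_ord (Ordinal (idx x))]/(index x s) -[nat_of_ord (Ordinal (idx y))]/(index y s).
have edge i j : i <= N -> j <= N -> e (nth x0 s i) (nth x0 s j) -> i < N ->
    (i.+1 == j) || (j.+1 == i).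
  move=> iN jN eij lt; case: (inner i _ lt eij) => [/s_inj|[i0 /s_inj]]; lia.
have xN : index x s <= N by rewrite -ltnS -sN index_mem.
have yN : index y s <= N by rewrite -ltnS -sN index_mem.
rewrite -{1}(nth_index x0 (all_s x)) -{1}(nth_index x0 (all_s y)).
move: (index x s) (index y s) xN yN => i j iN jN.
apply/idP/idP => [eij|].
  have [lt|ge] := ltnP i N; first exact: edge.
  have [lt'|ge'] := ltnP j N.
    by rewrite orbC; apply: edge => //; rewrite e_sym.
  by move: eij; rewrite (_ : i = j) ?e_irr //; lia.
case/orP => /eqP ij; first by rewrite -ij; apply: step; lia.
by rewrite e_sym -ij; apply: step; lia.
Qed.

End PathGraph.

(** * The Hasse quiver has type A *)

Lemma hasse_edges (d : Order.disp_t) (D : finPOrderType d) (x y : D) :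
  #|edges (Q := hasse_quiver D) x y| = hasse_cover (x, y) || hasse_cover (y, x) :> nat.
Proof.
have mem (a : arrow (hasse_quiver D)) : a \in edges (Q := hasse_quiver D) x y =
    (val a == (x, y)) || (val a == (y, x)).
  by rewrite inE /=; case: (val a) => u v; rewrite !xpair_eqE.
have sub p (cp : hasse_cover p) (E : {set arrow (hasse_quiver D)}) :
    (forall a, (a \in E) = (val a == p)) -> #|E| = 1%N.
  move=> EE; rewrite -(cards1 (exist _ p cp : arrow (hasse_quiver D))).
  by apply: eq_card => a; rewrite EE inE -val_eqE.
have no p : ~~ hasse_cover p -> forall a : arrow (hasse_quiver D), (val a == p) = false.
  by move=> np a; apply: contraNF np => /eqP <-; exact: (valP a).
have [cxy|nxy] := boolP (hasse_cover (x, y)).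
  apply: (sub _ cxy) => a; rewrite mem (no (y, x)) ?orbF //.
  by apply/negP => /cover_lt; rewrite lt_gtF // cover_lt.
have [cyx|nyx] := boolP (hasse_cover (y, x)).
  by apply: (sub _ cyx) => a; rewrite mem (no (x, y)).
by apply: eq_card0 => a; rewrite mem (no (x, y)) ?(no (y, x)).
Qed.

Section Combinatorics.
Variables (d : Order.disp_t) (D : finPOrderType d) (n : nat) (Q : quiver).
Variable w : D -> vertex Q -> int.
Hypothesis wz : forall x y, euler_form (w x) (w y) = (y <= x)%O%:Z.

(** The classes give every element a head and a tail, which determine
comparability; their linear independence is the one of the classes, because a
vector is determined by its root coordinates. *)
Lemma classes_type_A : underlying_graph_A n Q -> connected_quiver (hasse_quiver D) ->
  underlying_graph_A #|D| (hasse_quiver D).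
Proof.
move=> [f bf ef] [/card_gt0P[x1 _] conn].
pose om x := root_coord f (w x).
have dotE x y : \sum_i om x i * om y i = (y <= x)%O%:Z + (x <= y)%O%:Z.
  by rewrite (root_coord_dot bf ef) !wz.
have root x : exists pq : 'I_n.+1 * 'I_n.+1, pq.1 != pq.2 /\
    forall i, om x i = (i == pq.1)%:Z - (i == pq.2)%:Z.
  have [||p [q []]] := @root_vectorP _ (om x); first exact: root_coord_sum.
    by rewrite dotE lexx.
  by exists (p, q).
pose h x := (projT1 (cid (root x))).1; pose t x := (projT1 (cid (root x))).2.
have ht x : h x != t x by case: (projT2 (cid (root x))).
have omE x i : om x i = (i == h x)%:Z - (i == t x)%:Z.
  by case: (projT2 (cid (root x))).
have ends := shared_ends ht omE dotE.
have free (c : D -> int) :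
    (forall i, \sum_(x | h x == i) c x = \sum_(x | t x == i) c x) -> forall x, c x = 0.
  move=> bal x.
  have relation i : \sum_x c x * om x i = 0.
    under eq_bigr => y _ do rewrite omE mulrBr !(eq_sym i).
    rewrite sumrB; apply/eqP; rewrite subr_eq0; apply/eqP.
    have pick (g : D -> 'I_n.+1) : \sum_x c x * (g x == i)%:Z = \sum_(x | g x == i) c x.
      by rewrite [RHS]big_mkcond; apply: eq_bigr => y _; case: (g y == i); rewrite ?mulr1 ?mulr0.
    by rewrite !pick.
  have partial k : (k <= n.+1)%N -> \sum_x c x * padded f (w x) k = 0.
    elim: k => [_|k IHk ltk].
      by rewrite big1 // => y _; rewrite padded0 mulr0.
    have := relation (Ordinal ltk); under eq_bigr => y _ do rewrite /om /root_coord mulrBr.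
    by rewrite sumrB IHk ?subr0 // ltnW.
  suff : (c x)%:~R = 0 :> rat by move/eqP; rewrite intr_eq0 => /eqP.
  apply: (@classes_free Q D (fun x y => (y <= x)%O) w _ _ _ wz (fun x => (c x)%:~R)).
  - exact: lexx.
  - by move=> a b e /= l1 l2; apply: le_trans l2 l1.
  - by move=> a b /=; rewrite andbC; apply: le_anti.
  move=> v; have := partial (f v).+1 (leqW (ltn_ord (f v))).
  under eq_bigr => y _ do rewrite (paddedE bf).
  move=> s0; transitivity ((\sum_y c y * w y v)%:~R : rat); last by rewrite s0.
  rewrite rmorph_sum /=.
  by apply: eq_bigr => y _; rewrite rmorphM.
have [x0 deg1] := degree_le1 ends free x1.
pose e : rel D := fun x y => hasse_cover (x, y) || hasse_cover (y, x).
have [|||x||g bg gE] := @path_graph D e x0.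
- by move=> x y; rewrite /e orbC.
- by move=> x; rewrite /e /hasse_cover /= ltxx.
- move=> x y; have := conn x y; apply: connect_sub => u v /= ne; apply: connect1.
  by move: ne; rewrite -card_gt0 hasse_edges /e; case: (_ || _).
- exact: (degree_le2 ends x).
- exact: deg1.
by exists g => // x y; rewrite hasse_edges -gE.
Qed.

End Combinatorics.

Theorem corollary3p7 (K : closedFieldType) (d : Order.disp_t)
    (Delta : finPOrderType d) (n : nat) (hn : (0 < n)%N)
    (hconn : connected_quiver (hasse_quiver Delta))
    (hPHI : PHI_type_A K n Delta) :
  exists2 Q : quiver, underlying_graph_A n Q &
    alg_isomorphic (incidence_algebra Delta K) (path_kalgebra K Q).
Proof.
have [Q gQ /shift_equivalent_tri eqv] := hPHI.
have uQ := underlying_graph_A_unique gQ.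
have [pQ] := presentation_iso (alg_isomorphic_refl (path_kalgebra K Q)) (unique_finitely_many uQ).
have [X famX] := incidence_incidence_family K Delta.
have [Y famY] := incidence_family_equiv eqv famX.
have [w wE] := incidence_family_euler (z := fun x y : Delta => (y <= x)%O) pQ (fun x => lexx x) famY.
have gD := classes_type_A wE gQ hconn.
have uD := underlying_graph_A_unique gD.
have iso := incidence_path_iso K uD.
have [pD] := presentation_iso iso (unique_finitely_many uD).
have [X' famX'] := path_incidence_family K uQ.
have [Y' famY'] := incidence_family_equiv (shift_equivalent_sym eqv) famX'.
have [w' wE'] := incidence_family_euler (z := fun x y : vertex Q => reach y x) pD (fun x => reach_refl x) famY'.
have le1 : (#|Delta| <= #|vertex Q|)%N.
  apply: classes_card wE => // [a b e /= l1 l2|a b /=]; first exact: le_trans l2 l1.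
  by rewrite andbC; apply: le_anti.
have le2 : (#|vertex Q| <= #|Delta|)%N.
  apply: (classes_card (Q := hasse_quiver Delta)) wE' => [a|a b e /= l1 l2|a b /= /andP[l1 l2]].
  - exact: reach_refl.
  - exact: reach_trans l2 l1.
  - exact: reach_anti l2 l1.
have cQ : #|vertex Q| = n.
  by case: gQ => f bf _; rewrite (bij_eq_card bf) card_ord.
exists (hasse_quiver Delta); last exact: alg_isomorphic_sym iso.
by rewrite -cQ (_ : #|vertex Q| = #|Delta|) //; apply/eqP; rewrite eqn_leq le1 le2.
Qed.
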